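(* There exists a universal constant $C>0$ such that the following holds. Let $n\to\infty$ and let $p=p_n\in(0,1/2]$, $d=d_n$, $k=k_n\le n$ satisfy $$k\ge C\log^2 n,\qquad C\vee(5\log(1/p))^4\le d\le\frac{k^2p^6\log^6(1/p)}{C\log n}.$$ Let $k^-=\lfloor 0.9k\rfloor$, $$f_{\mathrm{scan}}(G)=\max_{A\subseteq[n],\,|A|=k^-}\ \sum_{i<j<\ell\in A}(G_{ij}-p)(G_{j\ell}-p)(G_{i\ell}-p),$$ $$\gamma_{\mathrm{scan}}=\frac12\binom{k^-}{3}\mathbb E_{G\sim\mathcal G(n,p,d)}[(G_{12}-p)(G_{23}-p)(G_{13}-p)].$$ Then $$\mathbb P_{G\sim\mathcal Q}\big(f_{\mathrm{scan}}(G)>\gamma_{\mathrm{scan}}\big)+\mathbb P_{G\sim\mathcal P}\big(f_{\mathrm{scan}}(G)\le\gamma_{\mathrm{scan}}\big)=o(1).$$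
   Context: Graphs are on vertex set $[n]$ and $G_{ij}\in\{0,1\}$ denotes the indicator of edge $ij$. For $p\in(0,1)$, $\tau(p,d)$ is the number such that $\mathbb P(\langle U,U'\rangle\ge\tau(p,d))=p$ for independent $U,U'$ uniform on the unit sphere $\mathbb S^{d-1}\subset\mathbb R^d$. $\mathcal Q=\mathcal G(n,p)$ is the Erdős–Rényi distribution (edges independent with probability $p$). $\mathcal G(n,p,d)$ is the random geometric graph: $U_1,\dots,U_n$ are i.i.d. uniform on $\mathbb S^{d-1}$ and edge $ij$ is present iff $\langle U_i,U_j\rangle\ge\tau(p,d)$. $\mathcal P=\mathcal G(n,p,d,k)$ is the following distribution: each $i\in[n]$ joins a hidden set $S$ independently with probability $k/n$; each $i\in S$ gets an independent $U_i$ uniform on $\mathbb S^{d-1}$; for $i\ne j$, if $i,j\in S$ then edge $ij$ is present iff $\langle U_i,U_j\rangle\ge\tau(p,d)$, otherwise edge $ij$ is present independently with probability $p$. Notation: $a\vee b=\max(a,b)$; $\log^a b=(\log b)^a$. Asymptotics are as $n\to\infty$ with $k=k(n)\to\infty$. *)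

(* Defs.v *)
From HB Require Import structures.
From mathcomp Require Import all_boot all_order all_algebra.
From mathcomp Require Import all_classical all_reals all_analysis.
From mathcomp Require Import measurable_realfun.

Set Implicit Arguments.
Unset Strict Implicit.
Unset Printing Implicit Defensive.

Import Order.TTheory GRing.Theory Num.Theory.
Import numFieldNormedType.Exports.

Local Open Scope classical_set_scope.
Local Open Scope ring_scope.

(* The product measure [mu x ... x mu] ([n] factors) on [n]-tuples. *)
Section power_measure.
Context {disp : measure_display} {T : measurableType disp} {R : realType}.

Definition pair_cons (n : nat) (x : (T * n.-tuple T)%type) : n.+1.-tuple T :=
  [tuple of x.1 :: x.2].

Lemma measurable_pair_cons (n : nat) : measurable_fun [set: _] (@pair_cons n).
Proof. by apply: measurable_cons; [exact: measurable_fst|exact: measurable_snd]. Qed.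

Section cons_measure.
Variables (n : nat) (mu : {sigma_finite_measure set T -> \bar R})
  (nu : {sigma_finite_measure set (n.-tuple T) -> \bar R}).

Definition cons_measure : set (n.+1.-tuple T) -> \bar R :=
  pushforward (mu \x nu)%E (@pair_cons n).

Let cons_measure0 : cons_measure set0 = 0%E.
Proof. by rewrite /cons_measure /pushforward preimage_set0 measure0. Qed.

Let cons_measure_ge0 A : (0 <= cons_measure A)%E.
Proof. by rewrite /cons_measure /pushforward measure_ge0. Qed.

Let cons_measure_sigma_additive : semi_sigma_additive cons_measure.
Proof. by apply: measure_semi_sigma_additive; exact: measurable_pair_cons. Qed.

HB.instance Definition _ := isMeasure.Build _ _ _ cons_measure
  cons_measure0 cons_measure_ge0 cons_measure_sigma_additive.

Let cons_measure_sigma_finite : sigma_finite [set: _] cons_measure.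
Proof.
have /sigma_finiteP[F [FT ndF Foo]] := sigma_finiteT mu.
have /sigma_finiteP[G [GT ndG Goo]] := sigma_finiteT nu.
pose u (x : n.+1.-tuple T) : (T * n.-tuple T)%type :=
  (tnth x ord0, [tuple of behead x]).
have mu_ : measurable_fun [set: _] u.
  apply/measurable_fun_pair; [exact: measurable_tnth|exact: measurable_behead].
have uK : cancel (@pair_cons n) u.
  by move=> [a t]; rewrite /u /pair_cons; congr pair; apply/val_inj.
exists (fun k => u @^-1` (F k `*` G k)).
  apply/esym; rewrite -subTset => x _.
  have [k _ Fk] : (\bigcup_i F i) (u x).1 by rewrite -FT.
  have [l _ Gl] : (\bigcup_i G i) (u x).2 by rewrite -GT.
  exists (maxn k l) => //; split => /=.
    by have /subsetPset := ndF _ _ (leq_maxl k l); exact.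
  by have /subsetPset := ndG _ _ (leq_maxr k l); exact.
move=> k; have [mF Fk] := Foo k; have [mG Gk] := Goo k.
have mFG : measurable (F k `*` G k) by exact: measurableX.
split; first by rewrite -[X in measurable X]setTI; exact: mu_.
rewrite /cons_measure /pushforward -comp_preimage.
rewrite (_ : u \o _ = id); last by apply/funext => x /=; rewrite uK.
by rewrite preimage_id product_measure1E// lte_mul_pinfty// ge0_fin_numE.
Qed.

HB.instance Definition _ := Measure_isSigmaFinite.Build _ _ _ cons_measure
  cons_measure_sigma_finite.

End cons_measure.

Fixpoint power_measure (mu : {sigma_finite_measure set T -> \bar R}) (n : nat) :
    {sigma_finite_measure set (n.-tuple T) -> \bar R} :=
  match n with
  | 0 => \d_([tuple] : 0.-tuple T)
  | n'.+1 => cons_measure mu (power_measure mu n')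
  end.

End power_measure.

Section sphere.
Context {R : realType}.

Definition vec (d : nat) := d.-tuple (measurableTypeR R).

Definition dot (d : nat) (x y : vec d) : R :=
  \sum_(i < d) (tnth x i : R) * (tnth y i : R).

Definition enorm (d : nat) (x : vec d) : R := Num.sqrt (dot x x).

Definition direction (d : nat) (x : vec d) : vec d :=
  [tuple (tnth x i : R) / enorm x | i < d].

Definition unit_ball (d : nat) : set (vec d) := [set x | enorm x <= 1].
Arguments unit_ball d : clear implicits.

Lemma measurable_dot_self (d : nat) :
  measurable_fun [set: vec d] (fun x => dot x x).
Proof.
apply: measurable_sum => i.
by apply: measurable_funM; exact: measurable_tnth.
Qed.

Lemma measurable_enorm (d : nat) : measurable_fun [set: vec d] (@enorm d).
Proof.
apply: (@measurableT_comp _ _ _ _ _ _ (@Num.sqrt R)).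
  by apply: continuous_measurable_fun; exact: sqrt_continuous.
exact: measurable_dot_self.
Qed.

Lemma measurable_unit_ball (d : nat) : measurable (unit_ball d).
Proof.
rewrite /unit_ball (_ : mkset _ = @enorm d @^-1` `]-oo, 1]); last first.
  by apply/seteqP; split => x /=; rewrite in_itv.
by rewrite -[X in measurable X]setTI; apply: measurable_enorm => //;
  exact: measurable_itv.
Qed.

Lemma measurable_direction (d : nat) :
  measurable_fun [set: vec d] (@direction d).
Proof.
apply/measurable_fun_tnthP => i.
rewrite (_ : _ \o _ = fun x : vec d => (tnth x i : R) * enorm x `^ (-1)); last first.
  by apply/funext => x /=; rewrite tnth_mktuple powR_inv1// sqrtr_ge0.
apply: measurable_funM; first exact: measurable_tnth.
apply: (@measurableT_comp _ _ _ _ _ _ (fun r : R => r `^ (-1))).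
  exact: measurable_powR.
exact: measurable_enorm.
Qed.

Definition lebesgue_vec (d : nat) :
    {sigma_finite_measure set (vec d) -> \bar R} :=
  power_measure (@lebesgue_measure R) d.

(* Up to the factor [d], the surface area of a measurable part [A] of the
   sphere: the volume of the cone [{r x | x \in A, 0 < r <= 1}]. *)
Definition cone_measure (d : nat) : set (vec d) -> \bar R :=
  pushforward (mrestr (lebesgue_vec d) (@measurable_unit_ball d)) (@direction d).
Arguments cone_measure d : clear implicits.

Section cone_measure_instances.
Variable d : nat.

Let cone_measure0 : cone_measure d set0 = 0%E.
Proof. by rewrite /cone_measure /pushforward preimage_set0 measure0. Qed.

Let cone_measure_ge0 A : (0 <= cone_measure d A)%E.
Proof. by rewrite /cone_measure /pushforward measure_ge0. Qed.

Let cone_measure_sigma_additive : semi_sigma_additive (cone_measure d).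
Proof. by apply: measure_semi_sigma_additive; exact: measurable_direction. Qed.

HB.instance Definition _ := isMeasure.Build _ _ _ (cone_measure d)
  cone_measure0 cone_measure_ge0 cone_measure_sigma_additive.

End cone_measure_instances.

(* The uniform distribution on the unit sphere: normalized surface area. The
   Dirac mass is the default that [mnormalize] requires; it plays no role, as
   the unit ball has positive finite volume. *)
Definition uniform_sphere (d : nat) : probability (vec d) R :=
  mnormalize (cone_measure d) (\d_([tuple 0 | _ < d] : vec d)).

(* [P(<U, U'> >= t) = p] determines [t] for [0 < p < 1] and [2 <= d]. *)
Definition tau (p : R) (d : nat) : R :=
  get [set t : R | (uniform_sphere d \x uniform_sphere d)%E
    [set u | t <= dot u.1 u.2] = p%:E].

End sphere.

Definition simple_edges (n : nat) (E : {set 'I_n * 'I_n}) : bool :=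
  [forall i, (i, i) \notin E] &&
  [forall i, forall j, ((i, j) \in E) == ((j, i) \in E)].

Definition graph (n : nat) := {E : {set 'I_n * 'I_n} | simple_edges E}.

Definition adj (n : nat) (G : graph n) (i j : 'I_n) : bool :=
  (i, j) \in val G.

Section random_graphs.
Context {R : realType}.

(* A law on graphs is given by its probability mass function. *)
Definition prob (n : nat) (law : graph n -> R) (A : pred (graph n)) : R :=
  \sum_(G : graph n | A G) law G.

Definition expect (n : nat) (law : graph n -> R) (f : graph n -> R) : R :=
  \sum_(G : graph n) law G * f G.

Definition bern (p : R) (b : bool) : R := if b then p else 1 - p.

Definition erdos_renyi (n : nat) (p : R) (G : graph n) : R :=
  \prod_(i < n) \prod_(j < n | (i < j)%N) bern p (adj G i j).

Definition sphere_points (n d : nat) :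
    {sigma_finite_measure set (n.-tuple (@vec R d)) -> \bar R} :=
  power_measure (uniform_sphere d) n.

Definition geometric (n : nat) (p : R) (d : nat) (G : graph n) : R :=
  fine (sphere_points n d [set U | forall i j : 'I_n, (i < j)%N ->
    adj G i j = (tau p d <= dot (tnth U i) (tnth U j))]).

(* Given the hidden set [S], the pairs inside [S] and the other pairs are
   independent. Only the points [U_i] with [i \in S] matter. *)
Definition planted_given (n : nat) (p : R) (d : nat) (S : {set 'I_n})
    (G : graph n) : R :=
  fine (sphere_points n d [set U | forall i j : 'I_n, (i < j)%N ->
    i \in S -> j \in S ->
    adj G i j = (tau p d <= dot (tnth U i) (tnth U j))]) *
  \prod_(i < n) \prod_(j < n | (i < j)%N && ~~ ((i \in S) && (j \in S)))
    bern p (adj G i j).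

Definition planted (n : nat) (p : R) (d k : nat) (G : graph n) : R :=
  \sum_(S : {set 'I_n})
    (\prod_(i < n) bern (k%:R / n%:R) (i \in S)) * planted_given p d S G.

Definition signed_triangle (n : nat) (p : R) (G : graph n)
    (i j l : 'I_n) : R :=
  ((adj G i j)%:R - p) * ((adj G j l)%:R - p) * ((adj G i l)%:R - p).

Definition scan_size (k : nat) : nat := ((9 * k) %/ 10)%N.

(* The maximum is over a nonempty family as soon as [k <= n]. *)
Definition f_scan (n : nat) (p : R) (k : nat) (G : graph n) : \bar R :=
  \big[maxe/-oo%E]_(A : {set 'I_n} | #|A| == scan_size k)
    (\sum_(i in A) \sum_(j in A | (i < j)%N) \sum_(l in A | (j < l)%N)
       signed_triangle p G i j l)%:E.

(* Vertices are numbered from 0; there is no triangle when [n < 3]. *)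
Definition gamma_scan (n : nat) (p : R) (d k : nat) : R :=
  2^-1 * 'C(scan_size k, 3)%:R *
  match n with
  | m.+3 => expect (@geometric m.+3 p d) (fun G =>
      signed_triangle p G (inord 0) (inord 1) (inord 2))
  | _ => 0
  end.

End random_graphs.

(* Main.v *)
(** Under the null model, fix a set [A] of at most [k] vertices. By Jensen's
    inequality the exponential moment of its signed triangle count is at most
    the average, over random 3-colorings of the vertices, of that of the sum of
    the triangles with one vertex of each color. Given the edges between two
    color classes this sum is a quadratic form in sub-Gaussian variables (with
    variance proxy of order [1 / ln (1/p)]), whose exponential moment is
    controlled by the operator and Frobenius norms of the matrix of these
    edges; both norms are small outside an event of probability
    [exp (- 3 k ln n)], by a net argument. A union bound over the at most
    [n ^ k] sets [A] concludes.

    Under the planted model, the hidden set has at least [0.9 k] vertices by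
    Chebyshev's inequality. Inside it two triangles with at most one common
    vertex are uncorrelated, since the sphere is homogeneous, so the count of a
    subset of the hidden set has a small variance, and Chebyshev's inequality
    applies again once the mean [T] of a signed triangle is bounded below by a
    multiple of [p ^ 3 ln (1/p) ^ (3/2) / sqrt d]. For that bound, condition on
    the heights of two neighbors of a vertex: the higher they are, the smaller
    the inner product required from their horizontal directions. *)

Require Import Defs.
From mathcomp Require Import all_boot all_order all_algebra.
From mathcomp Require Import all_classical all_reals all_analysis.
From mathcomp Require Import measurable_realfun ring lra zify.

Set Implicit Arguments.
Unset Strict Implicit.
Unset Printing Implicit Defensive.

Import Order.TTheory GRing.Theory Num.Theory.
Import numFieldNormedType.Exports.

Local Open Scope classical_set_scope.
Local Open Scope ring_scope.

(** The measure of the sphere is defined through cones, so its symmetries come from Lebesgue measure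
    on tuples: a plane rotation is a product of three shears, each translating one coordinate.
    Slicing balls horizontally gives the law of the height of a uniform point, with density
    proportional to [(1 - x^2)^(m/2)] in dimension [m + 3]; its tails are compared with Wallis
    integrals.

    The colors decouple: the count is cubic in the edges, but a colored count is linear in each of
    three disjoint, hence independent, families of pairs. One family is integrated as a linear form,
    the next as a quadratic form, and only the norms of the third matter.

    The mean has two regimes. If the threshold is at least [2 / sqrt d], conditioning on neighbors
    above the threshold itself gains enough. For [p] near [1/2] the threshold may vanish and this
    gains nothing; the neighbors higher than [2 / sqrt d], a constant proportion, are used instead.

    The upper bound on [d] says that [gamma_scan ^ 2 * ln (1/p) ^ 3] exceeds a large multiple of
    [k ^ 4 * ln n]. This one inequality serves both the exponential bound under the null model and
    Chebyshev's inequality under the planted one. *)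

Definition thd (T : Type) (n : nat) (x : n.+1.-tuple T) : T := tnth x ord0.
Definition ttl (T : Type) (n : nat) (x : n.+1.-tuple T) : n.-tuple T :=
  [tuple of behead x].

(** * Integration over tuples and rotations *)

Section power_integral.
Context {disp : measure_display} {T : measurableType disp} {R : realType}.
Local Open Scope ereal_scope.


Lemma thd_cons n (a : T) (x : n.-tuple T) : thd (pair_cons (a, x)) = a.
Proof. by []. Qed.

Lemma ttl_cons n (a : T) (x : n.-tuple T) : ttl (pair_cons (a, x)) = x.
Proof. exact/val_inj. Qed.

Lemma cons_thd_ttl n (x : n.+1.-tuple T) : pair_cons (thd x, ttl x) = x.
Proof. by case/tupleP: x => a x; apply/val_inj. Qed.

Lemma measurable_thd n : measurable_fun setT (@thd T n).
Proof. exact: measurable_tnth. Qed.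

Lemma measurable_ttl n : measurable_fun setT (@ttl T n).
Proof. exact: measurable_behead. Qed.

Lemma measurable_fun_cons d' (X : measurableType d') n (f : X -> T)
    (g : X -> n.-tuple T) : measurable_fun setT f -> measurable_fun setT g ->
  measurable_fun setT (fun x => pair_cons (f x, g x)).
Proof. by move=> mf mg; exact: measurable_cons. Qed.

Variable mu : {sigma_finite_measure set T -> \bar R}.

Lemma integral_power_measureS (n : nat) (f : n.+1.-tuple T -> \bar R) :
  measurable_fun setT f -> (forall x, 0 <= f x) ->
  \int[power_measure mu n.+1]_x f x =
  \int[mu]_a \int[power_measure mu n]_x f (pair_cons (a, x)).
Proof.
move=> mf f0.
rewrite (_ : \int[_]_x f x = \int[pushforward (mu \x power_measure mu n) (@pair_cons _ T n)]_x f x) //.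
rewrite ge0_integral_pushforward //=; [|exact: measurable_pair_cons].
rewrite preimage_setT.
rewrite fubini_tonelli1 //=.
apply: measurableT_comp => //; exact: measurable_pair_cons.
Qed.

Lemma measurable_int_cons (n : nat) (f : n.+1.-tuple T -> \bar R) :
  measurable_fun setT f -> (forall x, 0 <= f x) ->
  measurable_fun setT (fun a => \int[power_measure mu n]_x f (pair_cons (a, x))).
Proof.
move=> mf f0.
apply: (@measurable_fun_fubini_tonelli_F _ _ _ _ _ (power_measure mu n) (f \o @pair_cons _ T n)).
  apply: measurableT_comp => //; exact: measurable_pair_cons.
by move=> x; exact: f0.
Qed.

Lemma measurable_int_cons2 (n : nat) (f : n.+2.-tuple T -> \bar R) :
  measurable_fun setT f -> (forall x, 0 <= f x) ->
  measurable_fun setT (fun u : T * T => \int[power_measure mu n]_x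
    f (pair_cons (u.1, pair_cons (u.2, x)))).
Proof.
move=> mf f0.
apply: (@measurable_fun_fubini_tonelli_F _ _ _ _ _ (power_measure mu n)
  (fun v : (T * T) * n.-tuple T => f (pair_cons (v.1.1, pair_cons (v.1.2, v.2))))) => //.
apply: measurableT_comp => //.
apply: measurable_fun_cons.
  by apply: measurableT_comp => //; exact: measurable_fst.
apply: measurable_fun_cons; last exact: measurable_snd.
by apply: measurableT_comp => //; exact: measurable_snd.
Qed.

Lemma measurable_cons_l n (a : T) :
  measurable_fun setT (fun x : n.-tuple T => pair_cons (a, x)).
Proof. by apply: measurable_fun_cons. Qed.

Lemma integral_power_measureSS (n : nat) (f : n.+2.-tuple T -> \bar R) :
  measurable_fun setT f -> (forall x, 0 <= f x) ->
  \int[power_measure mu n.+2]_x f x =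
  \int[mu]_a \int[mu]_b \int[power_measure mu n]_x
    f (pair_cons (a, pair_cons (b, x))).
Proof.
move=> mf f0; rewrite integral_power_measureS//.
apply: eq_integral => a _.
rewrite integral_power_measureS//.
by apply: measurableT_comp => //; exact: measurable_cons_l.
Qed.

End power_integral.

(** * Invariance of Lebesgue measure under rotations and its scaling *)

Section lebesgue_invariance.
Context {R : realType}.
Local Open Scope ereal_scope.
Notation mu := (@lebesgue_measure R).
Notation RT := (measurableTypeR R).

Lemma integral_translate (f : RT -> \bar R) (c : R) :
  measurable_fun setT f -> (forall x, 0 <= f x) ->
  \int[mu]_x f (x + c)%R = \int[mu]_x f x.
Proof.
move=> mf f0.
have mc : measurable_fun setT (fun x : RT => (x + c)%R : RT).
  by apply: measurable_funD.
transitivity (\int[pushforward mu (fun x : RT => (x + c)%R : RT)]_x f x).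
  by rewrite (ge0_integral_pushforward mc)// preimage_setT.
apply: eq_measure_integral => A mA _.
apply/esym; apply: lebesgue_measure_unique => //= X [[a b]] /= _ <-.
rewrite /pushforward.
rewrite [X in _ = mu X](_ : _ = `](a - c)%R, (b - c)%R]%classic); last first.
  by apply/seteqP; split => x /=; rewrite !in_itv/= ltrBlDr lerBrDr.
by rewrite !lebesgue_measure_itv/= !lte_fin ltrD2r -!EFinD; case: ifP => // _; congr EFin; lra.
Qed.

Lemma integral_scale (f : RT -> \bar R) (c : R) : (0 < c)%R ->
  measurable_fun setT f -> (forall x, 0 <= f x) ->
  c%:E * \int[mu]_x f (c * x)%R = \int[mu]_x f x.
Proof.
move=> c0 mf f0.
have mc : measurable_fun setT (fun x : RT => (c * x)%R : RT).
  by apply: measurable_funM.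
have c0' : (0 <= c)%R by exact: ltW.
pose nu : {measure set RT -> \bar R} :=
  measure_function_pushforward__canonical__measure_function_Measure mu mc.
transitivity (\int[mscale (NngNum c0') nu]_x f x).
  rewrite ge0_integral_mscale//; congr (_ * _).
  by rewrite (ge0_integral_pushforward mc)// preimage_setT.
apply: eq_measure_integral => A mA _.
apply/esym; apply: lebesgue_measure_unique => //= X [[a b]] /= _ <-.
rewrite /mscale /pushforward/=.
rewrite [X in _ = _ * mu X](_ : _ = `](a / c)%R, (b / c)%R]%classic); last first.
  apply/seteqP; split => x /=; rewrite !in_itv/=.
    by rewrite ltr_pdivrMr// ler_pdivlMr// (mulrC c).
  by rewrite ltr_pdivrMr// ler_pdivlMr// (mulrC c).
rewrite !lebesgue_measure_itv/= !lte_fin ltr_pM2r ?invr_gt0//.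
case: ifP => _; last by rewrite mule0.
by rewrite -!EFinD -EFinM; congr EFin; field; rewrite gt_eqF.
Qed.

Lemma integral_lebesgueS (n : nat) (f : @vec R n.+1 -> \bar R) :
  measurable_fun setT f -> (forall x, 0 <= f x) ->
  \int[lebesgue_vec n.+1]_x f x =
  \int[mu]_a \int[lebesgue_vec n]_x f (pair_cons (a, x)).
Proof. exact: integral_power_measureS. Qed.

Lemma integral_lebesgueSS (n : nat) (f : @vec R n.+2 -> \bar R) :
  measurable_fun setT f -> (forall x, 0 <= f x) ->
  \int[lebesgue_vec n.+2]_x f x =
  \int[mu]_a \int[mu]_b \int[lebesgue_vec n]_x
    f (pair_cons (a, pair_cons (b, x))).
Proof. exact: integral_power_measureSS. Qed.

(** Invariance is asked of integrals of nonnegative functions rather than of measures of sets: in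
    this form it composes and passes through Tonelli one coordinate at a time. *)
Definition preserving n (phi : vec n -> vec n) :=
  measurable_fun setT phi /\
  forall f : @vec R n -> \bar R, measurable_fun setT f -> (forall x, 0 <= f x) ->
    \int[lebesgue_vec n]_x f (phi x) = \int[lebesgue_vec n]_x f x.

Lemma preserving_comp n (phi psi : vec n -> vec n) :
  preserving phi -> preserving psi -> preserving (phi \o psi).
Proof.
move=> [m1 h1] [m2 h2]; split; first exact: (measurableT_comp m1 m2).
move=> f mf f0 /=; rewrite -(h1 f)//; apply: (h2 (f \o phi)) => //.
  exact: (measurableT_comp mf m1).
by move=> x; exact: f0.
Qed.

Lemma preserving_id n : preserving (@id (vec n)).
Proof. by split. Qed.

Definition tail_map n (phi : vec n -> vec n) (x : @vec R n.+1) : vec n.+1 :=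
  pair_cons (thd x, phi (ttl x)).

Lemma preserving_tail n (phi : vec n -> vec n) :
  preserving phi -> preserving (tail_map phi).
Proof.
move=> [m h]; split.
  apply: measurable_fun_cons; first exact: measurable_thd.
  by apply: (measurableT_comp m); exact: measurable_ttl.
move=> f mf f0.
have mcl a : measurable_fun setT (fun x : vec n => f (pair_cons (a, x))).
  by apply: measurableT_comp => //; exact: measurable_cons_l.
have mt : measurable_fun setT (tail_map phi).
  apply: measurable_fun_cons; first exact: measurable_thd.
  by apply: (measurableT_comp m); exact: measurable_ttl.
rewrite [LHS](integral_lebesgueS (measurableT_comp mf mt) (fun x => f0 _)).
rewrite [RHS](integral_lebesgueS mf f0).
apply: eq_integral => a _.
rewrite -(h (fun x => f (pair_cons (a, x))))//.
by apply: eq_integral => x _; rewrite /tail_map /= thd_cons ttl_cons.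
Qed.

Definition shear1 (c : R) n (x : @vec R n.+2) : vec n.+2 :=
  pair_cons ((thd x : R) + c * (thd (ttl x) : R), ttl x)%R.
Definition shear2 (c : R) n (x : @vec R n.+2) : vec n.+2 :=
  pair_cons (thd x, pair_cons ((thd (ttl x) : R) + c * (thd x : R), ttl (ttl x)))%R.

Lemma measurable_shear1 c n : measurable_fun setT (@shear1 c n).
Proof.
apply: measurable_fun_cons; last exact: measurable_ttl.
apply: measurable_funD; first exact: measurable_thd.
apply: measurable_funM => //.
by apply: measurableT_comp; [exact: measurable_thd|exact: measurable_ttl].
Qed.

Lemma measurable_shear2 c n : measurable_fun setT (@shear2 c n).
Proof.
apply: measurable_fun_cons; first exact: measurable_thd.
apply: measurable_fun_cons; last by apply: measurableT_comp; exact: measurable_ttl.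
apply: measurable_funD.
  by apply: measurableT_comp; [exact: measurable_thd|exact: measurable_ttl].
by apply: measurable_funM => //; exact: measurable_thd.
Qed.

Lemma preserving_shear1 c n : preserving (@shear1 c n).
Proof.
split; first exact: measurable_shear1.
move=> f mf f0; rewrite [LHS](integral_lebesgueSS (measurableT_comp mf (measurable_shear1 c (n:=n))) (fun x => f0 _)).
rewrite [RHS](integral_lebesgueSS mf f0).
pose g (u : RT * RT) := \int[lebesgue_vec n]_x f (pair_cons (u.1, pair_cons (u.2, x))).
have g0 u : 0 <= g u by apply: integral_ge0 => x _.
have mg : measurable_fun setT g by exact: measurable_int_cons2.
transitivity (\int[mu]_a \int[mu]_b g ((a + c * b)%R, b)).
  by apply: eq_integral => a _; apply: eq_integral => b _; apply: eq_integral => x _;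
    rewrite /= /shear1 !ttl_cons !thd_cons.
pose h (u : RT * RT) := g ((u.1 + c * u.2)%R, u.2).
have mh : measurable_fun setT h.
  apply: measurableT_comp => //; apply: measurable_fun_pair; last exact: measurable_snd.
  by apply: measurable_funD; [exact: measurable_fst | apply: measurable_funM => //; exact: measurable_snd].
have E1 := @fubini_tonelli _ _ RT RT R mu mu h mh (fun u => g0 _).
have E2 := @fubini_tonelli _ _ RT RT R mu mu g mg g0.
apply: (etrans E1); apply: (etrans _ (esym E2)).
apply: eq_integral => b _; rewrite /h/=.
apply: (@integral_translate (fun a => g (a, b))) => [|x]; last exact: g0.
exact: measurable_fun_pair1.
Qed.

Lemma preserving_shear2 c n : preserving (@shear2 c n).
Proof.
split; first exact: measurable_shear2.
move=> f mf f0; rewrite [LHS](integral_lebesgueSS (measurableT_comp mf (measurable_shear2 c (n:=n))) (fun x => f0 _)).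
rewrite [RHS](integral_lebesgueSS mf f0).
pose g (u : RT * RT) := \int[lebesgue_vec n]_x f (pair_cons (u.1, pair_cons (u.2, x))).
have g0 u : 0 <= g u by apply: integral_ge0 => x _.
have mg : measurable_fun setT g by exact: measurable_int_cons2.
transitivity (\int[mu]_a \int[mu]_b g (a, (b + c * a)%R)).
  by apply: eq_integral => a _; apply: eq_integral => b _; apply: eq_integral => x _;
    rewrite /= /shear2 !ttl_cons !thd_cons.
apply: eq_integral => a _.
apply: (@integral_translate (fun b => g (a, b))) => [|x]; last exact: g0.
exact: measurable_fun_pair2.
Qed.

Definition rot2 (c s : R) n (x : @vec R n.+2) : vec n.+2 :=
  pair_cons (c * (thd x : R) - s * (thd (ttl x) : R),
    pair_cons (s * (thd x : R) + c * (thd (ttl x) : R), ttl (ttl x)))%R.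

(** A rotation is a product of three shears of slopes [(c - 1) / s], [s] and [(c - 1) / s], which
    requires [s != 0]. Otherwise it is the identity or a half turn, the square of a quarter turn. *)
Lemma preserving_rot2 (c s : R) n : (c ^+ 2 + s ^+ 2 = 1)%R ->
  preserving (@rot2 c s n).
Proof.
have key (c' s' : R) : (c' ^+ 2 + s' ^+ 2 = 1)%R -> s' != 0%R -> preserving (@rot2 c' s' n).
  move=> cs s0.
  have -> : @rot2 c' s' n = @shear1 ((c' - 1) / s')%R n \o (@shear2 s' n \o @shear1 ((c' - 1) / s')%R n).
    apply/funext => x; rewrite /shear1 /shear2 /rot2 /= !ttl_cons !thd_cons.
    have E1 : (thd (ttl x) + s' * (thd x + (c' - 1) / s' * thd (ttl x)) = s' * thd x + c' * thd (ttl x) :> R)%R.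
      by field.
    have E2 : (thd x + (c' - 1) / s' * thd (ttl x) + (c' - 1) / s' * (s' * thd x + c' * thd (ttl x)) = c' * thd x - s' * thd (ttl x) :> R)%R.
      apply: (@mulfI _ s'); first by [].
      transitivity (s' * thd x + (c' - 1) * thd (ttl x) + (c' - 1) * (s' * thd x + c' * thd (ttl x)) :> R)%R.
        by field.
      have -> : (s' * (c' * thd x - s' * thd (ttl x)) = s' * c' * thd x - s' ^+ 2 * thd (ttl x) :> R)%R by ring.
      have -> : (s' ^+ 2 = 1 - c' ^+ 2)%R by rewrite -cs; ring.
      by ring.
    by rewrite E1 E2.
  apply: preserving_comp; first exact: preserving_shear1.
  by apply: preserving_comp; [exact: preserving_shear2|exact: preserving_shear1].
move=> cs; have [s0|] := eqVneq s 0%R; last exact: key.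
have [c1|c1] : (c = 1 \/ c = -1)%R.
- have : (c ^+ 2 == 1)%R by rewrite -cs s0 expr0n/= addr0.
  by rewrite sqrf_eq1 => /orP[/eqP|/eqP]; [left|right].
- rewrite (_ : @rot2 c s n = id); first exact: preserving_id.
  apply/funext => x; rewrite /rot2 c1 s0 !mul0r !mul1r subr0 add0r.
  by rewrite !cons_thd_ttl.
rewrite (_ : @rot2 c s n = @rot2 0 1 n \o @rot2 0 1 n).
  by apply: preserving_comp; apply: key; rewrite ?oner_eq0// expr0n/= expr1n add0r.
apply/funext => x; rewrite /rot2 /= !ttl_cons !thd_cons c1 s0.
by congr (pair_cons (_, pair_cons (_, _))); rewrite ?mul0r ?mul1r; ring.
Qed.

Definition scalev n (c : R) (x : @vec R n) : vec n := [tuple (c * tnth x i)%R | i < n].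

Lemma tnth_scalev n c (x : vec n) i : tnth (scalev c x) i = (c * tnth x i)%R :> R.
Proof. by rewrite tnth_mktuple. Qed.

Lemma scalev_cons n c (a : R) (x : vec n) :
  scalev c (pair_cons (a, x)) = pair_cons ((c * a)%R, scalev c x).
Proof.
apply: eq_from_tnth => i; rewrite tnth_scalev.
have [j ->|->] := unliftP ord0 i; last by [].
by rewrite !tnthS tnth_scalev.
Qed.

Lemma measurable_scalev n c : measurable_fun setT (@scalev n c).
Proof.
apply/measurable_fun_tnthP => i.
rewrite (_ : _ \o _ = fun x : vec n => (c * tnth x i)%R).
  by apply: measurable_funM => //; exact: measurable_tnth.
by apply/funext => x /=; rewrite tnth_scalev.
Qed.

Lemma integral_scalev n (c : R) (f : @vec R n -> \bar R) : (0 < c)%R ->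
  measurable_fun setT f -> (forall x, 0 <= f x) ->
  (c ^+ n)%:E * \int[lebesgue_vec n]_x f (scalev c x) = \int[lebesgue_vec n]_x f x.
Proof.
move=> c0; elim: n f => [f mf f0|n IH f mf f0].
  rewrite expr0 mul1e; apply: eq_integral => x _; congr f.
  by rewrite tuple0; apply/esym; rewrite tuple0.
rewrite (integral_lebesgueS (measurableT_comp mf (measurable_scalev c)) (fun x => f0 _)).
rewrite [RHS](integral_lebesgueS mf f0).
pose g (a : RT) := \int[lebesgue_vec n]_x f (pair_cons (a, x)).
have mg : measurable_fun setT g by exact: measurable_int_cons.
have g0 a : 0 <= g a by apply: integral_ge0 => x _.
rewrite -[RHS]/(\int[mu]_a g a) -[RHS](integral_scale c0 mg g0) exprS EFinM -muleA; congr (_ * _).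
have cn0 : (0 <= c ^+ n)%R by rewrite exprn_ge0// ltW.
rewrite -ge0_integralZl//; last 2 first.
- apply: (@measurable_int_cons _ _ _ mu n (f \o scalev c)) => [|x]; last exact: f0.
  exact: (measurableT_comp mf (measurable_scalev c)).
- by move=> x _; apply: integral_ge0 => y _; exact: f0.
apply: eq_integral => a _.
have mfa : measurable_fun setT (fun x : vec n => f (pair_cons ((c * a)%R, x))).
  exact: (measurableT_comp mf (measurable_cons_l _)).
rewrite /g -(IH _ mfa)//.
by congr (_ * _); apply: eq_integral => x _; rewrite /= scalev_cons.
Qed.

End lebesgue_invariance.

Notation vcons a x := (pair_cons ((a : measurableTypeR _), x)).

Section vectors.
Context {R : realType}.
Implicit Types n : nat.

Lemma measurable_lebS n (A : set (@vec R n.+1)) (a : R) : measurable A ->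
  measurable [set x : vec n | A (vcons a x)].
Proof. by move=> mA; rewrite -[X in measurable X]setTI; exact: (measurable_cons_l (a : measurableTypeR R)). Qed.

Lemma lebesgue_vecS n (A : set (@vec R n.+1)) : measurable A ->
  (lebesgue_vec n.+1 A = \int[@lebesgue_measure R]_a
    lebesgue_vec n [set x | A (vcons a x)])%E.
Proof.
move=> mA.
have mI : measurable_fun setT (fun x : @vec R n.+1 => (\1_A x)%:E : \bar R).
  by apply/measurable_EFinP; exact: measurable_indic.
have I0 x : (0 <= (\1_A x)%:E :> \bar R)%E by rewrite lee_fin.
have := integral_lebesgueS mI I0.
rewrite integral_indic// setIT => ->; apply: eq_integral => a _.
transitivity (\int[lebesgue_vec n]_x (\1_[set x | A (vcons a x)] x)%:E)%E.
  by apply: eq_integral => x _; rewrite !indicE; congr (_%:R%:E); apply/idP/idP; rewrite !inE.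
by rewrite integral_indic ?setIT//; exact: measurable_lebS.
Qed.

Lemma preserving_set n (phi : @vec R n -> vec n) (A : set (vec n)) :
  preserving phi -> measurable A -> lebesgue_vec n (phi @^-1` A) = lebesgue_vec n A.
Proof.
move=> [mphi h] mA.
have mI : measurable_fun setT (fun x : @vec R n => (\1_A x)%:E : \bar R).
  by apply/measurable_EFinP; exact: measurable_indic.
have I0 x : (0 <= (\1_A x)%:E :> \bar R)%E by rewrite lee_fin.
have := h _ mI I0; rewrite [RHS]integral_indic// setIT => <-.
have mpA : measurable (phi @^-1` A) by rewrite -[X in measurable X]setTI; exact: mphi.
transitivity (\int[lebesgue_vec n]_x (\1_(phi @^-1` A) x)%:E)%E.
  by rewrite integral_indic ?setIT.
by apply: eq_integral => x _; rewrite !indicE; congr (_%:R%:E); apply/idP/idP; rewrite !inE.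
Qed.

Lemma scalev_set n (c : R) (A : set (@vec R n)) : 0 < c -> measurable A ->
  ((c ^+ n)%:E * lebesgue_vec n (scalev c @^-1` A) = lebesgue_vec n A)%E.
Proof.
move=> c0 mA.
have mI : measurable_fun setT (fun x : @vec R n => (\1_A x)%:E : \bar R).
  by apply/measurable_EFinP; exact: measurable_indic.
have I0 x : (0 <= (\1_A x)%:E :> \bar R)%E by rewrite lee_fin.
have := integral_scalev c0 mI I0; rewrite [RHS]integral_indic// setIT => <-.
have mpA : measurable (scalev c @^-1` A).
  by rewrite -[X in measurable X]setTI; exact: measurable_scalev.
congr (_ * _)%E.
transitivity (\int[lebesgue_vec n]_x (\1_(scalev c @^-1` A) x)%:E)%E.
  by rewrite integral_indic ?setIT.
by apply: eq_integral => x _; rewrite !indicE; congr (_%:R%:E); apply/idP/idP; rewrite !inE.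
Qed.

Lemma dot_cons n (a b : R) (x y : @vec R n) :
  dot (vcons a x) (vcons b y) = a * b + dot x y.
Proof.
rewrite /dot big_ord_recl /=; congr (_ + _).
by apply: eq_bigr => i _; rewrite !tnthS.
Qed.

Lemma dotC n (x y : @vec R n) : dot x y = dot y x.
Proof. by apply: eq_bigr => i _; rewrite mulrC. Qed.

Lemma dot_scalel n c (x y : @vec R n) : dot (scalev c x) y = c * dot x y.
Proof. by rewrite /dot mulr_sumr; apply: eq_bigr => i _; rewrite tnth_scalev mulrA. Qed.

Lemma dot_scaler n c (x y : @vec R n) : dot x (scalev c y) = c * dot x y.
Proof. by rewrite dotC dot_scalel dotC. Qed.

Lemma dot_ge0 n (x : @vec R n) : 0 <= dot x x.
Proof. by apply: sumr_ge0 => i _; rewrite -expr2 sqr_ge0. Qed.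

Lemma enorm_ge0 n (x : @vec R n) : 0 <= enorm x.
Proof. exact: sqrtr_ge0. Qed.

Lemma sqr_enorm n (x : @vec R n) : enorm x ^+ 2 = dot x x.
Proof. by rewrite sqr_sqrtr// dot_ge0. Qed.

Lemma enorm_scalev n c (x : @vec R n) : 0 <= c -> enorm (scalev c x) = c * enorm x.
Proof.
move=> c0; rewrite /enorm dot_scalel dot_scaler mulrA -expr2 sqrtrM ?sqr_ge0//.
by rewrite sqrtr_sqr ger0_norm.
Qed.

Lemma directionE n (x : @vec R n) : direction x = scalev (enorm x)^-1 x.
Proof. by apply: eq_from_tnth => i; rewrite !tnth_mktuple mulrC. Qed.

Definition zerov n : @vec R n := [tuple 0 | _ < n].

Lemma tnth_zerov n (i : 'I_n) : tnth (zerov n) i = 0 :> R.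
Proof. by rewrite tnth_mktuple. Qed.

Lemma zerov_cons n : zerov n.+1 = vcons 0 (zerov n).
Proof.
apply: eq_from_tnth => i; rewrite tnth_zerov.
have [j ->|->] := unliftP ord0 i; last by [].
by rewrite tnthS tnth_zerov.
Qed.

Lemma dot0v n (x : @vec R n) : dot (zerov n) x = 0.
Proof. by rewrite /dot big1// => i _; rewrite tnth_zerov mul0r. Qed.

Lemma enorm0 n : enorm (zerov n) = 0.
Proof. by rewrite /enorm dot0v sqrtr0. Qed.

Lemma enorm_eq0 n (x : @vec R n) : enorm x = 0 -> x = zerov n.
Proof.
move=> x0; have : dot x x = 0 by rewrite -sqr_enorm x0 expr0n.
move=> /eqP; rewrite psumr_eq0; last by move=> i _; rewrite -expr2 sqr_ge0.
move=> /allP h; apply: eq_from_tnth => i; rewrite tnth_zerov.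
by have := h i (mem_index_enum _); rewrite /= -expr2 sqrf_eq0 => /eqP.
Qed.

Lemma enorm_direction n (x : @vec R n) : enorm x != 0 -> enorm (direction x) = 1.
Proof.
by move=> x0; rewrite directionE enorm_scalev ?invr_ge0 ?enorm_ge0// mulVf.
Qed.

Lemma scalev_enorm_direction n (x : @vec R n) : scalev (enorm x) (direction x) = x.
Proof.
have [x0|x0] := eqVneq (enorm x) 0.
  apply: eq_from_tnth => i; rewrite tnth_scalev x0 mul0r.
  by rewrite (enorm_eq0 x0) tnth_zerov.
by apply: eq_from_tnth => i; rewrite tnth_scalev directionE tnth_scalev mulrA mulfV// mul1r.
Qed.

(** Homogeneity makes [phi] commute with [direction], so that the invariance of Lebesgue measure
    descends to the sphere. *)
Definition isometric n (phi : @vec R n -> vec n) :=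
  [/\ preserving phi, forall x y, dot (phi x) (phi y) = dot x y &
      forall c x, phi (scalev c x) = scalev c (phi x)].

Lemma isometric_id n : isometric (@id (@vec R n)).
Proof. by split => //; exact: preserving_id. Qed.

Lemma isometric_comp n (phi psi : @vec R n -> vec n) :
  isometric phi -> isometric psi -> isometric (phi \o psi).
Proof.
move=> [p1 d1 s1] [p2 d2 s2]; split => [|x y|c x] /=; first exact: preserving_comp.
  by rewrite d1 d2.
by rewrite s2 s1.
Qed.

Lemma isometric_tail n (phi : @vec R n -> vec n) :
  isometric phi -> isometric (tail_map phi).
Proof.
move=> [p d s]; split; first exact: preserving_tail.
  move=> x y; rewrite -(cons_thd_ttl x) -(cons_thd_ttl y) /tail_map !thd_cons !ttl_cons.
  by rewrite !dot_cons d.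
move=> c x; rewrite -(cons_thd_ttl x) /tail_map scalev_cons !thd_cons !ttl_cons.
by rewrite s scalev_cons.
Qed.

Lemma isometric_rot2 n (c s : R) : c ^+ 2 + s ^+ 2 = 1 ->
  isometric (@rot2 R c s n).
Proof.
move=> cs; split; first exact: preserving_rot2.
  move=> x y; rewrite -(cons_thd_ttl x) -(cons_thd_ttl y).
  rewrite -(cons_thd_ttl (ttl x)) -(cons_thd_ttl (ttl y)).
  set a := thd x; set b := thd (ttl x); set a' := thd y; set b' := thd (ttl y).
  rewrite /rot2 !ttl_cons !thd_cons !dot_cons !addrA; congr (_ + _).
  transitivity ((c ^+ 2 + s ^+ 2) * ((a : R) * a' + (b : R) * b')); last by rewrite cs mul1r.
  by ring.
move=> k x; rewrite -(cons_thd_ttl x) -(cons_thd_ttl (ttl x)) /rot2.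
rewrite !scalev_cons !ttl_cons !thd_cons.
by congr (pair_cons (_, pair_cons (_, _))); ring.
Qed.

(** Rotate the tail onto its own axis by induction, then turn the plane of the first two
    coordinates. In dimension 1 no rotation changes a sign, so [0 <= r] is only promised from
    dimension 2 on. *)
Lemma rotate_to_axis_weak n (u : @vec R n.+1) : exists (phi : vec n.+1 -> vec n.+1) (r : R),
  [/\ isometric phi, phi u = vcons r (zerov n) & (0 < n)%N -> 0 <= r].
Proof.
elim: n u => [u|n IH u].
  exists id, (thd u); split; [exact: isometric_id| |by []].
  by rewrite -{1}(cons_thd_ttl u); congr (pair_cons (_, _)); rewrite tuple0; apply/esym; rewrite tuple0.
have [psi [r [ipsi psiE _]]] := IH (ttl u).
set a : R := thd u.
pose rho : R := Num.sqrt (a ^+ 2 + r ^+ 2).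
have rho2 : rho ^+ 2 = a ^+ 2 + r ^+ 2 by rewrite sqr_sqrtr// addr_ge0// sqr_ge0.
have tE : tail_map psi u = vcons a (vcons r (zerov n)).
  by rewrite /tail_map psiE.
have [rho0|rho0] := eqVneq rho 0.
  exists (tail_map psi), a; split; first exact: isometric_tail.
    rewrite tE zerov_cons; congr (pair_cons (_, pair_cons (_, _))).
    move: rho2; rewrite rho0 expr0n/= => /esym/eqP; rewrite paddr_eq0 ?sqr_ge0//.
    by rewrite !sqrf_eq0 => /andP[_ /eqP].
  move=> _; move: rho2; rewrite rho0 expr0n/= => /esym/eqP; rewrite paddr_eq0 ?sqr_ge0//.
  by rewrite !sqrf_eq0 => /andP[/eqP -> _].
exists (rot2 (a / rho) (- (r / rho)) (n:=n) \o tail_map psi), rho; split.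
- apply: isometric_comp; last exact: isometric_tail.
  apply: isometric_rot2; rewrite sqrrN !expr_div_n -mulrDl -rho2 mulfV//.
  by rewrite sqrf_eq0.
- rewrite /= tE /rot2 !ttl_cons !thd_cons zerov_cons.
  congr (pair_cons (_, pair_cons (_, _))).
    rewrite mulNr opprK; apply: (mulIf rho0); rewrite -expr2 rho2.
    by field.
  by field.
- by move=> _; exact: sqrtr_ge0.
Qed.

Lemma isometric_enorm n (phi : @vec R n -> vec n) x : isometric phi ->
  enorm (phi x) = enorm x.
Proof. by case=> _ h _; rewrite /enorm h. Qed.

Lemma isometric_direction n (phi : @vec R n -> vec n) x : isometric phi ->
  direction (phi x) = phi (direction x).
Proof.
by move=> i; rewrite !directionE (isometric_enorm x i); case: i => _ _ ->.
Qed.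

Lemma rotate_to_axis n (u : @vec R n.+2) : exists phi : vec n.+2 -> vec n.+2,
  isometric phi /\ phi u = vcons (enorm u) (zerov n.+1).
Proof.
have [phi [r [i E h]]] := rotate_to_axis_weak u.
exists phi; split => //; rewrite E; congr (pair_cons (_, _)).
rewrite -(isometric_enorm u i) E /enorm dot_cons dot0v addr0 -expr2 sqrtr_sqr.
by rewrite ger0_norm// h.
Qed.

Lemma dot_axis n (r : R) (x : @vec R n.+1) : dot (vcons r (zerov n)) x = r * thd x.
Proof. by rewrite -{1}(cons_thd_ttl x) dot_cons dot0v addr0. Qed.

End vectors.

(** * Wallis integrals *)

Section cosine_primitive.
Context {R : realType}.
Implicit Types (x t : R) (n : nat).

(** The radius of the slice of the unit ball at height [x]. As [Num.sqrt] is 0 on negative numbers,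
    it is continuous on the whole line and vanishes outside [[-1, 1]]. *)
Definition cosine x : R := Num.sqrt (1 - x ^+ 2).

Lemma cosine_ge0 x : 0 <= cosine x.
Proof. exact: sqrtr_ge0. Qed.

Lemma cosine1 : cosine 1 = 0.
Proof. by rewrite /cosine expr1n subrr sqrtr0. Qed.

Lemma sqr_cosine x : x ^+ 2 <= 1 -> cosine x ^+ 2 = 1 - x ^+ 2.
Proof. by move=> x1; rewrite sqr_sqrtr// subr_ge0. Qed.

Lemma cosine_le1 x : cosine x <= 1.
Proof.
rewrite -(@sqrtr1 R) ler_wsqrtr// gerBl; exact: sqr_ge0.
Qed.

Lemma cosine_antitone x y : 0 <= x -> x <= y -> cosine y <= cosine x.
Proof.
move=> x0 xy; rewrite ler_wsqrtr// lerD2l lerN2 ler_pXn2r ?nnegrE//.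
exact: le_trans xy.
Qed.

Lemma continuous_cosine : continuous cosine.
Proof.
move=> x; rewrite /cosine.
apply: (@continuous_comp _ _ _ (fun y : R => 1 - y ^+ 2) (@Num.sqrt R)); last exact: sqrt_continuous.
by apply: cvgB; [exact: cvg_cst|exact: exprn_continuous].
Qed.

Lemma continuous_cosineX n : continuous (fun x => cosine x ^+ n).
Proof.
by move=> x; apply: (@continuous_comp _ _ _ cosine (fun y => y ^+ n));
  [exact: continuous_cosine|exact: exprn_continuous].
Qed.

Lemma integrable_cosineX n (a b : R) :
  lebesgue_measure.-integrable `[a, b] (EFin \o (fun x => cosine x ^+ n)).
Proof.
apply: continuous_compact_integrable; first exact: segment_compact.
by apply: continuous_subspaceT; exact: continuous_cosineX.
Qed.

(** The base point -1 makes 0 an interior point, so that the primitive is derivable on all of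
    [[0, 1]]. *)
Definition cosine_prim n x : R :=
  \int[lebesgue_measure]_(y in `[(-1)%R, x]) (cosine y ^+ n).

Lemma is_derive_cosine_prim n x : -1 < x ->
  is_derive x (1 : R) (cosine_prim n) (cosine x ^+ n).
Proof.
move=> x1; have xx : x < x + 1 by rewrite ltrDl.
have [d E] := continuous_FTC1_closed xx (integrable_cosineX n (-1) (x + 1)) x1 (@continuous_cosineX n x).
by apply: DeriveDef; [exact: d|rewrite -derive1E; exact: E].
Qed.

Lemma continuous_cosine_prim n (a b : R) : -1 < a ->
  {within `[a, b], continuous (cosine_prim n)}.
Proof.
move=> a1; apply: derivable_within_continuous => x; rewrite in_itv/= => /andP[ax _].
by have [] := is_derive_cosine_prim n (lt_le_trans a1 ax).
Qed.

Lemma integral_cosineX n (a b : R) : -1 < a -> a <= b ->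
  (\int[lebesgue_measure]_(x in `[a, b]) (cosine x ^+ n)%:E)%E =
  (cosine_prim n b - cosine_prim n a)%:E.
Proof.
move=> a1; rewrite le_eqVlt => /orP[/eqP <-|ab].
  by rewrite subrr set_itv1 integral_set1.
rewrite (@continuous_FTC2 _ _ (cosine_prim n)) ?EFinB//.
- by apply: continuous_subspaceT; exact: continuous_cosineX.
- have := @continuous_cosine_prim n a b a1.
  move=> /(continuous_within_itvP _ ab) [_ h1 h2]; split => //.
  move=> x; rewrite in_itv/= => /andP[ax _].
  by have [] := is_derive_cosine_prim n (lt_trans a1 ax).
- move=> x; rewrite in_itv/= => /andP[ax _].
  by have [_] := is_derive_cosine_prim n (lt_trans a1 ax); rewrite derive1E.
Qed.

Lemma cosine_prim_MVT n (a b : R) : -1 < a -> a <= b ->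
  exists2 c, c \in `[a, b] & cosine_prim n b - cosine_prim n a = cosine c ^+ n * (b - a).
Proof.
move=> a1 ab; apply: (MVT_segment ab) => [x|]; last exact: continuous_cosine_prim.
by rewrite in_itv/= => /andP[ax _]; apply: is_derive_cosine_prim; exact: lt_trans ax.
Qed.

Lemma cosine_prim_homo n (a b : R) : -1 < a -> a <= b ->
  cosine_prim n a <= cosine_prim n b.
Proof.
move=> a1 ab; have [c _ E] := cosine_prim_MVT n a1 ab.
by rewrite -subr_ge0 E mulr_ge0 ?exprn_ge0 ?cosine_ge0// subr_ge0.
Qed.

Lemma cosine_prim_gap n (a b : R) : 0 <= a -> a <= b ->
  cosine b ^+ n * (b - a) <= cosine_prim n b - cosine_prim n a.
Proof.
move=> a0 ab; have a1 : -1 < a by rewrite (lt_le_trans _ a0)// ltrN10.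
have [c] := cosine_prim_MVT n a1 ab; rewrite in_itv/= => /andP[ac cb] ->.
by rewrite ler_wpM2r ?subr_ge0// lerXn2r ?nnegrE ?cosine_ge0// cosine_antitone// (le_trans a0).
Qed.

Lemma cosine_prim_strict n (a b : R) : 0 <= a -> a < b -> b < 1 ->
  cosine_prim n a < cosine_prim n b.
Proof.
move=> a0 ab b1; rewrite -subr_gt0 (lt_le_trans _ (cosine_prim_gap n a0 (ltW ab)))//.
rewrite mulr_gt0 ?subr_gt0// exprn_gt0// sqrtr_gt0 subr_gt0 expr_lt1//.
by rewrite ltW// (le_lt_trans a0).
Qed.

(* [(x w ^ (n + 2))' = (n + 3) w ^ (n + 2) - (n + 2) w ^ n] *)
Lemma cosine_prim_rec n t : 0 <= t <= 1 ->
  n.+3%:R * (cosine_prim n.+2 1 - cosine_prim n.+2 t) + t * cosine t ^+ n.+2 =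
  n.+2%:R * (cosine_prim n 1 - cosine_prim n t).
Proof.
move=> /andP[t0 t1].
pose f x : R := n.+3%:R * cosine_prim n.+2 x - n.+2%:R * cosine_prim n x - x * cosine x ^+ n.+2.
suff : f 1 - f t = 0 by rewrite /f cosine1 expr0n/= mulr0 subr0; lra.
have d0 x : x \in `]t, 1[ -> is_derive x 1 f 0.
  rewrite in_itv/= => /andP[tx x1].
  have x0 : 0 < x by exact: le_lt_trans tx.
  have xm1 : -1 < x by rewrite (lt_trans _ x0)// ltrN10.
  have x21 : 0 < 1 - x ^+ 2 by rewrite subr_gt0 expr_lt1// ltW.
  have w0 : cosine x != 0 by rewrite gt_eqF// sqrtr_gt0.
  have dq : is_derive x (1:R) (fun y : R => 1 - y ^+ 2) (- (2 * x)).
    apply: is_derive_eq; rewrite add0r mul1r.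
    have -> : x%:A = x :> R by exact: mulr1.
    by rewrite mulr_natl mulr2n.
  have dw : is_derive x 1 cosine (- x / cosine x).
    have -> : cosine = @Num.sqrt R \o (fun y => 1 - y ^+ 2) by [].
    have ds := is_derive1_sqrt x21.
    apply: is_derive_eq => /=.
    by rewrite (_ : Num.sqrt (1 - x ^+ 2) = cosine x)//; field.
  have dp1 := is_derive_cosine_prim n xm1.
  have dp2 := is_derive_cosine_prim n.+2 xm1.
  have H := is_deriveB (is_deriveB (is_deriveZ n.+3%:R dp2) (is_deriveZ n.+2%:R dp1))
    (is_deriveM (is_derive_id x (1 : R)) (is_deriveX n.+2 dw)).
  have -> : f = n.+3%:R \*: cosine_prim n.+2 - n.+2%:R \*: cosine_prim n - id * cosine ^+ n.+2.
    by apply/funext => y; rewrite !fctE.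
  apply: (is_derive_eq H); rewrite /= exprfctE.
  rewrite /GRing.scale/= mulr1.
  have -> : x * (n.+2%:R * cosine x ^+ n.+1 * (- x / cosine x)) = - n.+2%:R * x ^+ 2 * cosine x ^+ n.
    by rewrite exprS; field.
  have -> : x ^+ 2 = 1 - cosine x ^+ 2 by rewrite sqr_cosine; [ring|lra].
  by rewrite -[n.+3]addn1 natrD !exprS; ring.
(* [cosine] has no derivative at 1, but the mean value theorem only asks for continuity at the end
   points. *)
have [] := @MVT_segment _ f (fun=> 0) t 1 t1 d0.
  apply: continuous_in_subspaceT => x; rewrite inE/= in_itv/= => /andP[tx _].
  have xm1 : -1 < x by rewrite (lt_le_trans _ tx)// (lt_le_trans _ t0)// ltrN10.
  have c1 N : {for x, continuous (cosine_prim N)}.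
    have [h _] := is_derive_cosine_prim N xm1.
    exact/differentiable_continuous/derivable1_diffP.
  rewrite /f; apply: cvgB; first apply: cvgB.
  - by apply: cvgM; [exact: cvg_cst|exact: c1].
  - by apply: cvgM; [exact: cvg_cst|exact: c1].
  - by apply: cvgM; [exact: cvg_id|exact: continuous_cosineX].
by move=> c _; rewrite mul0r.
Qed.

Lemma cosine_prim_le n m (a b : R) : 0 <= a -> a <= b -> (m <= n)%N ->
  cosine_prim n b - cosine_prim n a <= cosine_prim m b - cosine_prim m a.
Proof.
move=> a0 ab mn.
have a1 : -1 < a by rewrite (lt_le_trans _ a0)// ltrN10.
rewrite -lee_fin -!integral_cosineX//.
apply: ge0_le_integral => //=.
- by move=> x _; rewrite lee_fin exprn_ge0// cosine_ge0.
- by apply/measurable_EFinP; apply: measurable_funTS; apply: continuous_measurable_fun; exact: continuous_cosineX.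
- by apply/measurable_EFinP; apply: measurable_funTS; apply: continuous_measurable_fun; exact: continuous_cosineX.
- move=> x _; rewrite lee_fin -(subnK mn) exprD -[leRHS]mul1r ler_wpM2r//.
    by rewrite exprn_ge0// cosine_ge0.
  by rewrite exprn_ile1// ?cosine_ge0// cosine_le1.
Qed.

(** Above [t] the extra factor [cosine x ^+ 2] is at most its value at [t]. Combined with
    [cosine_prim_rec], this gives the Mills-type bound [cap_mills]. *)
Lemma cosine_prim_le2 n (t b : R) : 0 <= t -> t <= b ->
  cosine_prim n.+2 b - cosine_prim n.+2 t <=
  cosine t ^+ 2 * (cosine_prim n b - cosine_prim n t).
Proof.
move=> t0 tb.
have a1 : -1 < t by rewrite (lt_le_trans _ t0)// ltrN10.
rewrite -lee_fin EFinM -!integral_cosineX//.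
have mX N : measurable_fun `[t, b] (fun x => (cosine x ^+ N)%:E).
  by apply/measurable_EFinP; apply: measurable_funTS; apply: continuous_measurable_fun; exact: continuous_cosineX.
have X0 N x : (0 <= (cosine x ^+ N)%:E)%E by rewrite lee_fin exprn_ge0// cosine_ge0.
rewrite -ge0_integralZl ?sqr_ge0//; last exact: mX.
apply: ge0_le_integral => //=.
- exact: mX.
- by apply: measurable_funeM; exact: mX.
- move=> x; rewrite in_itv/= => /andP[tx xb]; rewrite -EFinM lee_fin -[n.+2]add2n exprD ler_wpM2r//.
    by rewrite exprn_ge0// cosine_ge0.
  by rewrite lerXn2r ?nnegrE ?cosine_ge0// cosine_antitone.
Qed.

(** By the substitution [x = sin u], this is the Wallis integral of [cos u ^ (n + 1)] over a quarter
    turn. *)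
Definition half_wallis n : R := cosine_prim n 1 - cosine_prim n 0.

Lemma half_wallis_rec n : n.+3%:R * half_wallis n.+2 = n.+2%:R * half_wallis n.
Proof.
have := @cosine_prim_rec n 0; rewrite lexx ler01 mul0r addr0; exact.
Qed.

Lemma half_wallis_gt0 n : 0 < half_wallis n.
Proof.
have h : cosine_prim n 0 < cosine_prim n 2^-1.
  by apply: cosine_prim_strict => //; rewrite ?invr_gt0// invf_lt1// ltr1n.
rewrite subr_gt0 (lt_le_trans h)// cosine_prim_homo//; last by rewrite invf_le1// ler1n.
by rewrite (lt_trans (ltrN10 _))// invr_gt0.
Qed.

Lemma half_wallis_homo n m : (m <= n)%N -> half_wallis n <= half_wallis m.
Proof. by move=> mn; apply: cosine_prim_le. Qed.

Lemma half_wallis0 : half_wallis 0 = 1.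
Proof.
have [||c _ E] := @cosine_prim_MVT 0 0 1; [exact: ltrN10|exact: ler01|].
by rewrite /half_wallis E expr0 subr0 mulr1.
Qed.

(* [(n + 2) W_n W_(n+1)] does not depend on [n] (Wallis). *)
Lemma half_wallis_prod n : n.+2%:R * (half_wallis n * half_wallis n.+1) <= 2.
Proof.
elim: n => [|n].
  rewrite -[leRHS]mulr1 ler_wpM2l// half_wallis0 mul1r.
  by rewrite -[leRHS]half_wallis0; exact: half_wallis_homo.
apply: le_trans; rewrite le_eqVlt; apply/orP; left; apply/eqP.
transitivity (half_wallis n.+1 * (n.+3%:R * half_wallis n.+2)); first by ring.
by rewrite half_wallis_rec; ring.
Qed.

Lemma half_wallis_ub n : n.+2%:R * half_wallis n.+1 ^+ 2 <= 2.
Proof.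
apply: le_trans (half_wallis_prod n); rewrite ler_wpM2l// expr2.
by rewrite (ler_pM2r (half_wallis_gt0 _)) half_wallis_homo.
Qed.

End cosine_primitive.

(** * The uniform measure on the sphere *)

Section sphere_measure.
Context {R : realType}.
Implicit Types n : nat.

Lemma measurable_le_set d (T : measurableType d) (f g : T -> R) :
  measurable_fun setT f -> measurable_fun setT g -> measurable [set x | f x <= g x].
Proof.
move=> mf mg.
rewrite (_ : mkset _ = (fun x => g x - f x) @^-1` `[0, +oo[); last first.
  by apply/seteqP; split => x /=; rewrite in_itv/= andbT subr_ge0.
rewrite -[X in measurable X]setTI; apply: measurable_funB => //.
Qed.

Lemma measurable_dotl n (e : @vec R n) : measurable_fun setT (fun x : vec n => dot e x).
Proof.
apply: measurable_sum => i; apply: measurable_funM => //.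
exact: measurable_tnth.
Qed.

Definition cone_set n (K : set (@vec R n)) :=
  forall c x, 0 < c -> K x -> K (scalev c x).

Lemma scalevA n a b (x : @vec R n) : scalev a (scalev b x) = scalev (a * b) x.
Proof. by apply: eq_from_tnth => i; rewrite !tnth_scalev mulrA. Qed.

Lemma scalev1 n (x : @vec R n) : scalev 1 x = x.
Proof. by apply: eq_from_tnth => i; rewrite !tnth_scalev mul1r. Qed.

Lemma cone_scalev n (K : set (@vec R n)) c x : cone_set K -> 0 < c ->
  K (scalev c x) = K x.
Proof.
move=> cK c0; apply/propext; split; last exact: cK.
move=> /(cK c^-1); rewrite invr_gt0 => /(_ c0).
by rewrite scalevA mulVf ?gt_eqF// scalev1.
Qed.

Lemma measurable_ball n (r : R) : measurable [set x : @vec R n | enorm x <= r].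
Proof. by apply: measurable_le_set => //; exact: measurable_enorm. Qed.

Lemma measurable_kball n (K : set (@vec R n)) (r : R) : measurable K ->
  measurable [set x : @vec R n | enorm x <= r /\ K x].
Proof. by move=> mK; apply: measurableI => //; exact: measurable_ball. Qed.

Lemma lebesgue_cone_ball n (K : set (@vec R n)) (r : R) : cone_set K -> measurable K ->
  0 < r -> (lebesgue_vec n [set x | (enorm x <= r)%R /\ K x] =
    (r ^+ n)%:E * lebesgue_vec n [set x | (enorm x <= 1)%R /\ K x])%E.
Proof.
move=> cK mK r0.
rewrite -(scalev_set r0 (measurable_kball r mK)); congr (_ * lebesgue_vec n _)%E.
have E x : (enorm (scalev r x) <= r) = (enorm x <= 1).
  by rewrite (enorm_scalev _ (ltW r0)) -{2}[r]mulr1 ler_pM2l.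
by apply/seteqP; split => x /=; rewrite (cone_scalev _ cK r0) E.
Qed.

Lemma enorm_cons n (a : R) (x : @vec R n) :
  enorm (vcons a x) = Num.sqrt (a ^+ 2 + enorm x ^+ 2).
Proof. by rewrite {1}/enorm dot_cons sqr_enorm expr2. Qed.

Lemma measurable_slice n (A : set (@vec R n.+1)) : measurable A ->
  measurable_fun setT (fun a : measurableTypeR R => lebesgue_vec n [set x | A (vcons a x)]).
Proof.
move=> mA.
have mI : measurable_fun setT (fun x : @vec R n.+1 => (\1_A x)%:E : \bar R).
  by apply/measurable_EFinP; exact: measurable_indic.
have I0 x : (0 <= (\1_A x)%:E :> \bar R)%E by rewrite lee_fin.
rewrite [X in measurable_fun _ X](_ : _ = (fun a : measurableTypeR R =>
  \int[lebesgue_vec n]_x (\1_A (vcons a x))%:E)%E).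
  exact: (measurable_int_cons (@lebesgue_measure R) mI I0).
apply/funext => a.
transitivity (\int[lebesgue_vec n]_x (\1_[set x | A (vcons a x)] x)%:E)%E.
  by rewrite integral_indic ?setIT//; exact: measurable_lebS.
by apply: eq_integral => x _; rewrite !indicE; congr (_%:R%:E); apply/idP/idP; rewrite !inE.
Qed.

(** Induction on the dimension: the ball contains the product of [[0, 1/2]] with a ball of radius
    [1/2], and is contained in the product of [[-1, 1]] with a unit ball. This rules out the default
    case of [mnormalize]. *)
Lemma ball_volume_fin_pos n : (0 < lebesgue_vec n (@unit_ball R n) < +oo)%E.
Proof.
elim: n => [|n /andP[IH0 IH1]].
  rewrite /= diracE mem_set ?lte01 ?ltry//.
  by rewrite /unit_ball/= /enorm /dot big_ord0 sqrtr0 ler01.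
apply/andP; split.
- rewrite lebesgue_vecS; last exact: measurable_unit_ball.
  pose b : set (@vec R n) := [set x | enorm x <= 2^-1 /\ setT x].
  have b0 : (0 < lebesgue_vec n b)%E.
    rewrite /b (@lebesgue_cone_ball n setT 2^-1)// ?invr_gt0//.
    rewrite mule_gt0// ?lte_fin ?exprn_gt0 ?invr_gt0//.
    by rewrite (_ : [set x | _] = @unit_ball R n)//; apply/seteqP; split => x // [].
  apply: (@lt_le_trans _ _ (\int[@lebesgue_measure R]_(a in `[0%R, 2^-1%R]) lebesgue_vec n b)%E).
    rewrite integral_cst//= lebesgue_measure_itv/= lte_fin invr_gt0 ltr0n.
    by rewrite mule_gt0// oppr0 adde0 lte_fin invr_gt0.
  rewrite integral_mkcond; apply: ge0_le_integral => //=.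
  + by move=> a _; rewrite patchE; case: ifP.
  + by apply/measurable_restrict => //; rewrite setTI; exact: measurable_cst.
  + by apply: measurable_slice; exact: measurable_unit_ball.
  + move=> a _; rewrite patchE; case: ifPn => [/set_mem/=|_]; last exact: measure_ge0.
    rewrite in_itv/= => /andP[a0 a1].
    apply: le_measure; rewrite ?inE//.
    * by apply: measurable_kball.
    * by apply: measurable_lebS; exact: measurable_unit_ball.
    move=> x [xb _] /=; rewrite /unit_ball/= enorm_cons -(@sqrtr1 R) ler_sqrt//.
    have : enorm x ^+ 2 <= 2^-1 ^+ 2 by rewrite ler_pXn2r ?nnegrE ?enorm_ge0 ?invr_ge0.
    have : a ^+ 2 <= 2^-1 ^+ 2 by rewrite ler_pXn2r ?nnegrE ?invr_ge0.
    by lra.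
- rewrite lebesgue_vecS; last exact: measurable_unit_ball.
  apply: (@le_lt_trans _ _ (\int[@lebesgue_measure R]_(a in `[(-1)%R, 1%R]) lebesgue_vec n (@unit_ball R n))%E).
    rewrite [leRHS]integral_mkcond; apply: ge0_le_integral => //=.
    + by apply: measurable_slice; exact: measurable_unit_ball.
    + by apply/measurable_restrict => //; rewrite setTI; exact: measurable_cst.
    + move=> a _; rewrite patchE; case: ifPn => [_|].
        apply: le_measure; rewrite ?inE//.
        * by apply: measurable_lebS; exact: measurable_unit_ball.
        * exact: measurable_unit_ball.
        move=> x /=; rewrite /unit_ball/= enorm_cons; apply: le_trans.
        by rewrite -{1}(ger0_norm (enorm_ge0 x)) -sqrtr_sqr ler_wsqrtr// lerDr sqr_ge0.
      move=> /negP na; rewrite (_ : [set x | _] = set0) ?measure0//.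
      apply/seteqP; split => x //=; rewrite /unit_ball/= enorm_cons => h; apply: na.
      rewrite inE/= in_itv/= -ler_norml -sqrtr_sqr (le_trans _ h)// ler_wsqrtr//.
      by rewrite lerDl sqr_ge0.
  rewrite integral_cst//= lebesgue_measure_itv/= lte_fin.
  rewrite ifT; last by lra.
have Vfin : lebesgue_vec n (@unit_ball R n) \is a fin_num by rewrite ge0_fin_numE.
by apply: lte_mul_pinfty => //; rewrite -EFinD ltry.
Qed.


Lemma ball_volume_fin_num n : lebesgue_vec n (@unit_ball R n) \is a fin_num.
Proof. by rewrite ge0_fin_numE//; case/andP: (ball_volume_fin_pos n). Qed.

Definition vball n : R := fine (lebesgue_vec n (@unit_ball R n)).

Lemma vball_gt0 n : 0 < vball n.
Proof. by rewrite fine_gt0// ball_volume_fin_pos. Qed.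

Lemma vballE n : lebesgue_vec n (@unit_ball R n) = (vball n)%:E.
Proof. by rewrite fineK// ball_volume_fin_num. Qed.

Lemma lebesgue_sub_ball_fin n (A : set (@vec R n)) : measurable A ->
  A `<=` @unit_ball R n -> lebesgue_vec n A \is a fin_num.
Proof.
move=> mA AB; rewrite ge0_fin_numE// (@le_lt_trans _ _ (vball n)%:E) ?ltry//.
by rewrite -vballE le_measure// inE//; exact: measurable_unit_ball.
Qed.

Lemma set1_zerov n : [set zerov n] = [set x : @vec R n | enorm x <= 0].
Proof.
apply/seteqP; split => x /= => [->|x0]; first by rewrite enorm0.
by apply: enorm_eq0; apply/eqP; rewrite eq_le x0 enorm_ge0.
Qed.

(** Doubling fixes the origin and multiplies volumes by [2 ^ (n + 1)], so the volume of the origin,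
    being finite, is 0. *)
Lemma lebesgue_zerov n : lebesgue_vec n.+1 [set zerov n.+1] = (0 : \bar R)%E.
Proof.
have m0 : measurable [set zerov n.+1 : @vec R n.+1].
  by rewrite set1_zerov; exact: measurable_ball.
have := scalev_set (ltr0n R 2 : 0 < 2%:R) m0.
have -> : scalev 2%:R @^-1` [set zerov n.+1] = [set zerov n.+1 : @vec R n.+1].
  rewrite !set1_zerov; apply/seteqP; split => x /=; rewrite enorm_scalev//;
  by rewrite pmulr_rle0.
have : lebesgue_vec n.+1 [set @zerov R n.+1] \is a fin_num.
  apply: (@lebesgue_sub_ball_fin n.+1 [set zerov n.+1]); first exact: m0.
  by move=> x /= ->; rewrite /unit_ball/= enorm0.
move=> /fineK <-; rewrite -EFinM => -[] /eqP.
rewrite -subr_eq0 -{2}[fine _]mul1r -mulrBl mulf_eq0 => /orP[|/eqP -> //].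
rewrite subr_eq0 => /eqP h.
have : (1 < 2%:R ^+ n.+1 :> R) by rewrite exprn_egt1// ltr1n.
by rewrite h ltxx.
Qed.

(** Statements about [direction] are only meaningful off the origin, which is a null set in positive
    dimension. *)
Lemma lebesgue_eq_off0 n (A B : set (@vec R n.+1)) : measurable A -> measurable B ->
  (forall x, enorm x != 0 -> A x <-> B x) ->
  lebesgue_vec n.+1 A = lebesgue_vec n.+1 B.
Proof.
have key (A' B' : set (@vec R n.+1)) : measurable A' -> measurable B' ->
    (forall x, enorm x != 0 -> A' x -> B' x) ->
    (lebesgue_vec n.+1 A' <= lebesgue_vec n.+1 B')%E.
  move=> mA mB AB.
  have m0 : measurable [set zerov n.+1 : @vec R n.+1].
    by rewrite set1_zerov; exact: measurable_ball.
  apply: (@le_trans _ _ (lebesgue_vec n.+1 (B' `|` [set zerov n.+1]))).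
    apply: le_measure; rewrite ?inE//; first exact: measurableU.
    move=> x Ax; have [x0|x0] := eqVneq (enorm x) 0.
      by right; rewrite /= (enorm_eq0 x0).
    by left; exact: AB.
  apply: (le_trans (measureU2 _ _ _)) => //.
  by rewrite [X in (_ + X)%E](lebesgue_zerov n) adde0.
move=> mA mB AB; apply/eqP; rewrite eq_le; apply/andP; split; apply: key => // x x0;
  by case: (AB x x0).
Qed.

Lemma uniform_sphereE n (A : set (@vec R n)) :
  (uniform_sphere n A = lebesgue_vec n ((@direction R n @^-1` A) `&` @unit_ball R n)
    * ((vball n)^-1)%:E)%E.
Proof.
have E : @cone_measure R n [set: @vec R n] = (vball n)%:E.
  by rewrite /cone_measure /pushforward /mrestr preimage_setT setTI vballE.
pose V := @cone_measure R n [set: @vec R n].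
transitivity ((if (V == 0%E) || (V == +oo%E) then fun U => \d_(zerov n) U
  else fun U => (@cone_measure R n U * ((fine V)^-1)%:E)%E) A); first by [].
rewrite /V E.
by rewrite ifF//=; apply/negbTE; rewrite negb_or eqe gt_eqF ?vball_gt0.
Qed.

Lemma direction_preimage_measurable n (A : set (@vec R n)) : measurable A ->
  measurable (@direction R n @^-1` A).
Proof. by move=> mA; rewrite -[X in measurable X]setTI; exact: measurable_direction. Qed.

Lemma uniform_cone n (A C : set (@vec R n.+1)) : measurable A -> measurable C ->
  (forall x, enorm x != 0 -> A (direction x) <-> C x) ->
  (uniform_sphere n.+1 A = lebesgue_vec n.+1 [set x | (enorm x <= 1)%R /\ C x]
    * ((vball n.+1)^-1)%:E)%E.
Proof.
move=> mA mC AC; rewrite uniform_sphereE; congr (_ * _)%E.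
apply: lebesgue_eq_off0.
- by apply: measurableI; [exact: direction_preimage_measurable|exact: measurable_unit_ball].
- exact: measurable_kball.
move=> x x0 /=; split.
  by move=> [h1 h2]; split => //; exact/AC.
by move=> [h1 h2]; split => //; exact/AC.
Qed.

Lemma uniform_isometric n (phi : @vec R n -> vec n) (A : set (vec n)) : isometric phi ->
  measurable A -> uniform_sphere n (phi @^-1` A) = uniform_sphere n A.
Proof.
move=> iphi mA; rewrite !uniform_sphereE; congr (_ * _)%E.
have pphi : preserving phi by case: iphi.
have mD : measurable ((@direction R n @^-1` A) `&` @unit_ball R n).
  by apply: measurableI; [exact: direction_preimage_measurable|exact: measurable_unit_ball].
rewrite -[RHS](preserving_set pphi mD).
congr (lebesgue_vec n _); apply/seteqP; split => x /=;
  by rewrite (isometric_direction _ iphi) /unit_ball /= (isometric_enorm _ iphi).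
Qed.

(* the radius of the slice at height [a] of the part of the unit ball where
   [t * enorm x <= thd x] *)
Definition slice_radius (t a : R) : R :=
  if a < t then a * cosine t / t else cosine a.

(** The ball requires [r <= cosine a] and the cone requires [r <= a * cosine t / t]; the two bounds
    cross at [a = t]. *)
Lemma slice_radiusP (t a r : R) : 0 <= t < 1 -> 0 <= r ->
  (Num.sqrt (a ^+ 2 + r ^+ 2) <= 1 /\ t * Num.sqrt (a ^+ 2 + r ^+ 2) <= a) <->
  (0 <= a <= 1 /\ r <= slice_radius t a).
Proof.
move=> /andP[t0 t1] r0.
have t21 : t ^+ 2 <= 1 by rewrite expr_le1// ltW.
set q := Num.sqrt _.
have q0 : 0 <= q by exact: sqrtr_ge0.
have q2 : q ^+ 2 = a ^+ 2 + r ^+ 2 by rewrite sqr_sqrtr// addr_ge0// sqr_ge0.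
split.
  move=> [q1 tqa].
  have a0 : 0 <= a by rewrite (le_trans _ tqa)// mulr_ge0.
  have q21 : q ^+ 2 <= 1 by rewrite expr_le1.
  have a21 : a ^+ 2 <= 1 by rewrite (le_trans _ q21)// q2 lerDl sqr_ge0.
  have a1 : a <= 1 by rewrite -(@expr_le1 _ 2).
  split; first by rewrite a0.
  rewrite /slice_radius; case: ifPn => [at_|].
    have t0' : 0 < t by exact: le_lt_trans at_.
    rewrite ler_pdivlMr// -(@ler_pXn2r _ 2) ?nnegrE ?mulr_ge0 ?cosine_ge0//.
    rewrite !exprMn sqr_cosine//.
    have : (t * q) ^+ 2 <= a ^+ 2 by rewrite ler_pXn2r ?nnegrE// mulr_ge0.
    by rewrite exprMn q2; lra.
  rewrite -leNgt => ta.
  rewrite -(@ler_pXn2r _ 2) ?nnegrE ?cosine_ge0//.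
  by rewrite sqr_cosine//; lra.
move=> [/andP[a0 a1]].
have a21 : a ^+ 2 <= 1 by rewrite expr_le1.
rewrite /slice_radius; case: ifPn => [at_|].
  have t0' : 0 < t by exact: le_lt_trans at_.
  rewrite ler_pdivlMr// -(@ler_pXn2r _ 2) ?nnegrE ?mulr_ge0 ?cosine_ge0//.
  rewrite !exprMn sqr_cosine// => h.
  have tq : (t * q) ^+ 2 <= a ^+ 2 by rewrite exprMn q2; lra.
  have tqa : t * q <= a by rewrite -(@ler_pXn2r _ 2) ?nnegrE ?mulr_ge0.
  split => //.
  by have := le_lt_trans tqa at_; rewrite -{2}[t]mulr1 ltr_pM2l// => /ltW.
rewrite -leNgt => ta; rewrite -(@ler_pXn2r _ 2) ?nnegrE ?cosine_ge0// sqr_cosine// => h.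
have q1 : q <= 1 by rewrite -(@expr_le1 _ 2)// q2; lra.
by split => //; rewrite (le_trans _ ta)// -{2}[t]mulr1 ler_wpM2l.
Qed.

Lemma slice_radius_ge0 t a : 0 <= t -> 0 <= a -> 0 <= slice_radius t a.
Proof.
move=> t0 a0; rewrite /slice_radius; case: ifP => _; last exact: cosine_ge0.
by rewrite !mulr_ge0 ?invr_ge0// cosine_ge0.
Qed.

Lemma lebesgue_cone_ball0 n (K : set (@vec R n.+1)) (r : R) : cone_set K -> measurable K ->
  0 <= r -> (lebesgue_vec n.+1 [set x | (enorm x <= r)%R /\ K x] =
    (r ^+ n.+1)%:E * lebesgue_vec n.+1 [set x | (enorm x <= 1)%R /\ K x])%E.
Proof.
move=> cK mK; rewrite le_eqVlt => /orP[/eqP <-|]; last exact: lebesgue_cone_ball.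
rewrite expr0n/= mul0e; apply/eqP; rewrite eq_le measure_ge0 andbT.
rewrite -[X in (_ <= X)%E](lebesgue_zerov n) set1_zerov.
apply: le_measure; rewrite ?inE//; [exact: measurable_kball|exact: measurable_ball|].
by move=> x [].
Qed.

(** At each height the slice is a multiple of the unit part of the same cone [K], so the volume is a
    factor depending on [t] times a factor depending on [K]. *)
Lemma lebesgue_cap_slice n (t : R) (K : set (@vec R n.+1)) : 0 <= t < 1 ->
  cone_set K -> measurable K ->
  (lebesgue_vec n.+2 [set x | (enorm x <= 1)%R /\ (t * enorm x <= thd x /\ K (ttl x))%R] =
   (\int[@lebesgue_measure R]_(a in `[0%R, 1%R]) ((slice_radius t a) ^+ n.+1)%:E) *
    lebesgue_vec n.+1 [set x | (enorm x <= 1)%R /\ K x])%E.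
Proof.
move=> t01 cK mK.
have mA : measurable [set x : @vec R n.+2 | enorm x <= 1 /\ (t * enorm x <= thd x /\ K (ttl x))].
  apply: measurable_kball; apply: measurableI.
    apply: measurable_le_set; last exact: measurable_thd.
    by apply: measurable_funM => //; exact: measurable_enorm.
  by rewrite -[X in measurable X]setTI; exact: measurable_ttl.
rewrite lebesgue_vecS//.
have t0 : 0 <= t by case/andP: t01.
rewrite -ge0_integralZr//=; last 2 first.
- apply/measurable_EFinP; apply: measurable_funX; apply: measurable_funTS.
  apply: measurable_fun_ifT.
  + by apply: measurable_fun_ltr.
  + by apply: measurable_funM => //; apply: measurable_funM.
  + exact: (continuous_measurable_fun continuous_cosine).
- by move=> a /=; rewrite in_itv/= => /andP[a0 a1]; rewrite lee_fin exprn_ge0// slice_radius_ge0.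
rewrite [RHS]integral_mkcond; apply: eq_integral => a _; rewrite patchE; case: ifPn.
  move=> /set_mem/=; rewrite in_itv/= => a01; case/andP: (a01) => a0 a1.
  rewrite -lebesgue_cone_ball0 ?slice_radius_ge0//.
  congr (lebesgue_vec n.+1 _); apply/seteqP; split => x /=;
    rewrite thd_cons ttl_cons enorm_cons.
    move=> [h1 [h2 Kx]]; split => //.
    by have [] := (slice_radiusP a t01 (enorm_ge0 x)).1 (conj h1 h2).
  by move=> [h Kx]; have [] := (slice_radiusP a t01 (enorm_ge0 x)).2 (conj a01 h).
move=> /negP na; rewrite [X in lebesgue_vec _ X](_ : _ = set0) ?measure0//.
apply/seteqP; split => x //=; rewrite thd_cons ttl_cons enorm_cons.
move=> [h1 [h2 Kx]]; apply: na; rewrite inE/= in_itv/=.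
by have [] := (slice_radiusP a t01 (enorm_ge0 x)).1 (conj h1 h2).
Qed.

End sphere_measure.

(** * Probability of spherical caps *)

Section cap_probability.
Context {R : realType}.
Implicit Types (n m : nat) (t : R).

Lemma thd_scalev n c (x : @vec R n.+1) : thd (scalev c x) = c * thd x :> R.
Proof. by rewrite /thd tnth_scalev. Qed.

Lemma ttl_scalev n c (x : @vec R n.+1) : ttl (scalev c x) = scalev c (ttl x).
Proof. by rewrite -{1}(cons_thd_ttl x) scalev_cons ttl_cons. Qed.

Lemma le_thd_direction n (t : R) (x : @vec R n.+1) : enorm x != 0 ->
  (t <= thd (direction x)) = (t * enorm x <= thd x).
Proof.
move=> x0; rewrite directionE thd_scalev mulrC ler_pdivlMr//.
by rewrite lt_neqAle eq_sym x0 enorm_ge0.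
Qed.

Definition capset n (t : R) : set (@vec R n.+1) := [set u | t <= thd u].
Arguments capset : clear implicits.

Lemma measurable_capset n t : measurable (capset n t).
Proof. by apply: measurable_le_set => //; exact: measurable_thd. Qed.

Definition capP n (t : R) : R := fine (uniform_sphere n.+1 (capset n t)).

Lemma uniform_sphere_fin n (A : set (@vec R n)) : measurable A ->
  uniform_sphere n A \is a fin_num.
Proof. by move=> mA; exact: fin_num_measure. Qed.

Lemma capPE n t : uniform_sphere n.+1 (capset n t) = (capP n t)%:E.
Proof. by rewrite fineK// uniform_sphere_fin//; exact: measurable_capset. Qed.

Lemma capP_antitone n s t : s <= t -> capP n t <= capP n s.
Proof.
move=> st; rewrite -lee_fin -!capPE le_measure ?inE//; try exact: measurable_capset.
by move=> u /=; rewrite /capset /=; exact: le_trans.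
Qed.

Lemma capP_ge0 n t : 0 <= capP n t.
Proof. by rewrite fine_ge0. Qed.

Lemma measurable_tail_set n (K : set (@vec R n)) : measurable K ->
  measurable [set x : @vec R n.+1 | K (ttl x)].
Proof. by move=> mK; rewrite -[X in measurable X]setTI; exact: measurable_ttl. Qed.

Lemma measurable_cap_cone n t : measurable [set x : @vec R n.+1 | t * enorm x <= thd x].
Proof.
apply: measurable_le_set; last exact: measurable_thd.
by apply: measurable_funM => //; exact: measurable_enorm.
Qed.

Lemma cap_tail_slice n t (K : set (@vec R n.+1)) : 0 <= t < 1 ->
  cone_set K -> measurable K ->
  (uniform_sphere n.+2 [set u : @vec R n.+2 | (t <= thd u)%R /\ K (ttl u)] =
  (\int[@lebesgue_measure R]_(a in `[0%R, 1%R]) (slice_radius t a ^+ n.+1)%:E) *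
  lebesgue_vec n.+1 [set x | (enorm x <= 1)%R /\ K x] * ((@vball R n.+2)^-1)%:E)%E.
Proof.
move=> t01 cK mK; rewrite -lebesgue_cap_slice//; apply: uniform_cone.
- by apply: measurableI; [exact: measurable_capset|exact: measurable_tail_set].
- by apply: measurableI; [exact: measurable_cap_cone|exact: measurable_tail_set].
- move=> x x0 /=; rewrite le_thd_direction// directionE ttl_scalev.
  by rewrite (cone_scalev _ cK)// invr_gt0 lt_neqAle eq_sym x0 enorm_ge0.
Qed.

Lemma uniform_cone_set n (K : set (@vec R n.+1)) : cone_set K -> measurable K ->
  (uniform_sphere n.+1 K = lebesgue_vec n.+1 [set x | (enorm x <= 1)%R /\ K x] *
    ((@vball R n.+1)^-1)%:E)%E.
Proof.
move=> cK mK; apply: uniform_cone => // x x0.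
by rewrite directionE (cone_scalev _ cK)// invr_gt0 lt_neqAle eq_sym x0 enorm_ge0.
Qed.

(** The first term comes from the cone under the disc at height [t], the second from the part of the
    ball above that height. *)
Definition slice_integral n t : R :=
  n.+2%:R^-1 * (t * cosine t ^+ n.+1) + (cosine_prim n.+1 1 - cosine_prim n.+1 t).

Lemma slice_integralE n t : 0 <= t < 1 ->
  (\int[@lebesgue_measure R]_(a in `[0%R, 1%R]) (slice_radius t a ^+ n.+1)%:E)%E
  = (slice_integral n t)%:E.
Proof.
move=> /andP[t0 t1].
have ms : measurable_fun setT (fun a : measurableTypeR R => (slice_radius t a ^+ n.+1)%:E).
  apply/measurable_EFinP; apply: measurable_funX.
  apply: measurable_fun_ifT.
  + by apply: measurable_fun_ltr.
  + by apply: measurable_funM => //; apply: measurable_funM.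
  + exact: (continuous_measurable_fun continuous_cosine).
have s0 a : a \in `[0, 1] -> (0 <= (slice_radius t a ^+ n.+1)%:E)%E.
  by rewrite in_itv/= => /andP[a0 _]; rewrite lee_fin exprn_ge0// slice_radius_ge0.
have -> : `[0, 1]%classic = `[0, t[ `|` `[t, 1] :> set R.
  by rewrite -itv_bndbnd_setU// bnd_simp// ltW.
rewrite ge0_integral_setU//=; last 3 first.
- exact: measurable_funTS.
- move=> a [|]; rewrite /= !in_itv/= => /andP[h1 h2]; apply: s0; rewrite in_itv/=.
    by rewrite h1 (le_trans (ltW h2))// ltW.
  by rewrite h2 (le_trans t0).
- by apply/disj_setPS => a [] /=; rewrite !in_itv/= => /andP[_ h1] /andP[h2 _]; rewrite leNgt h1 in h2.
rewrite EFinD; congr (_ + _)%E.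
- rewrite integral_itv_bndo_bndc; last exact: measurable_funTS.
  move: t0; rewrite le_eqVlt => /orP[/eqP <-|t0].
    by rewrite set_itv1 integral_set1 mul0r mulr0.
  pose f (a : R) : R := (cosine t / t) ^+ n.+1 * a ^+ n.+1.
  transitivity (\int[@lebesgue_measure R]_(a in `[0%R, t]) (f a)%:E)%E.
    rewrite -[LHS]integral_itv_bndo_bndc; last exact: measurable_funTS.
    rewrite -[RHS]integral_itv_bndo_bndc; last first.
      by apply/measurable_EFinP; apply: measurable_funM => //; apply: measurable_funX.
    apply: eq_integral => a; rewrite inE/= in_itv/= => /andP[_ at_].
    by rewrite /slice_radius at_ /f -exprMn; congr (EFin (_ ^+ _)); rewrite [RHS]mulrC mulrA.
  pose F (a : R) : R := n.+2%:R^-1 * (cosine t / t) ^+ n.+1 * a ^+ n.+2.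
  have dF a : is_derive a (1 : R) F (f a).
    have H := is_deriveZ (n.+2%:R^-1 * (cosine t / t) ^+ n.+1) (is_deriveX n.+2 (is_derive_id a (1 : R))).
    have -> : F = (n.+2%:R^-1 * (cosine t / t) ^+ n.+1) \*: (id ^+ n.+2).
      by apply/funext => y; rewrite /F !fctE.
    apply: (is_derive_eq H); rewrite /f /GRing.scale/= mulr1.
    by field.
  have cF : continuous F.
    by move=> a; apply/differentiable_continuous/derivable1_diffP; have [] := dF a.
  rewrite (@continuous_FTC2 _ f F)//.
  + rewrite -EFinB; congr EFin; rewrite /F expr0n/= mulr0 subr0 exprMn exprVn.
    rewrite [t ^+ n.+2]exprS; field; apply/andP; split; first by rewrite -natrD pnatr_eq0.
    by rewrite expf_neq0// gt_eqF.
  + apply: continuous_subspaceT => a; apply: cvgM; [exact: cvg_cst|exact: exprn_continuous].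
  + split.
    * by move=> a _; have [] := dF a.
    * by apply: cvg_at_right_filter; exact: cF.
    * by apply: cvg_at_left_filter; exact: cF.
  + by move=> a _; rewrite derive1E; have [_] := dF a.
rewrite -integral_cosineX ?ltW//; last by rewrite (lt_le_trans _ t0)// ltrN10.
apply: eq_integral => a; rewrite inE/= in_itv/= => /andP[ta _].
by rewrite /slice_radius ltNge ta.
Qed.

(** The height of a uniform point and its horizontal direction are independent; a cone [K] only sees
    the direction of the tail. The factor that depends on [t] is identified by taking [K] to be the
    whole space. *)
Lemma cap_tail_indep n t (K : set (@vec R n.+1)) : 0 <= t < 1 ->
  cone_set K -> measurable K ->
  (uniform_sphere n.+2 [set u : @vec R n.+2 | (t <= thd u)%R /\ K (ttl u)] =
   (capP n.+1 t)%:E * uniform_sphere n.+1 K)%E.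
Proof.
move=> t01 cK mK; rewrite -capPE.
have := cap_tail_slice t01 (fun c x _ _ => I : [set: @vec R n.+1] _) (@measurableT _ _).
rewrite (_ : [set u | _ /\ _] = capset n.+1 t); last first.
  by apply/seteqP; split => u //= [].
move=> ->; rewrite cap_tail_slice// (uniform_cone_set cK)//.
rewrite (_ : [set x | _ /\ [set: _] _] = @unit_ball R n.+1); last first.
  by apply/seteqP; split => u //= [].
rewrite vballE slice_integralE//.
have : lebesgue_vec n.+1 [set x | enorm x <= 1 /\ K x] \is a fin_num.
  by apply: lebesgue_sub_ball_fin; [exact: measurable_kball|by move=> x []].
move=> /fineK <-; rewrite -!EFinM; congr EFin.
by field; rewrite !gt_eqF// vball_gt0.
Qed.

Lemma uniform_equator n : uniform_sphere n.+1 [set u : @vec R n.+1 | thd u = 0] = 0%E.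
Proof.
have m0 : measurable [set u : @vec R n.+1 | thd u = 0].
  rewrite -[X in measurable X]setTI.
  exact: (@measurable_thd _ (measurableTypeR R) n measurableT [set (0 : R)] (measurable_set1 0)).
rewrite (@uniform_cone_set n [set u : @vec R n.+1 | thd u = 0])//; last first.
  by move=> c x c0 /= x0; rewrite thd_scalev x0 mulr0.
rewrite lebesgue_vecS; last exact: measurable_kball.
rewrite [X in (X * _)%E](_ : _ = 0%E) ?mul0e//.
transitivity (\int[@lebesgue_measure R]_(a in [set 0%R : measurableTypeR R])
   lebesgue_vec n [set x : @vec R n | (enorm (vcons a x) <= 1)%R])%E; last by rewrite integral_set1.
rewrite [RHS]integral_mkcond; apply: eq_integral => a _; rewrite patchE; case: ifPn.
  rewrite inE => /= ->; congr (lebesgue_vec n _).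
  by apply/seteqP; split => x /= => [[]|] //.
move=> /negP na; rewrite (_ : [set x | _] = set0) ?measure0//.
by apply/seteqP; split => x //= -[_]; rewrite thd_cons => a0; apply: na; rewrite inE.
Qed.

Lemma rotN n (u : @vec R n.+2) : thd (rot2 (-1) 0 u) = - thd u :> R.
Proof. by rewrite /rot2 thd_cons mul0r subr0 mulN1r. Qed.

Lemma isometric_rotN n : isometric (@rot2 R (-1) 0 n).
Proof. by apply: isometric_rot2; rewrite expr0n/= addr0 sqrrN expr1n. Qed.

(** A half turn of the first two coordinates reverses the height. The caps being closed, an
    inequality comes for free, without knowing that their boundary is null. *)
Lemma capP_opp n t : 1 - capP n.+1 t <= capP n.+1 (- t).
Proof.
rewrite -lee_fin EFinB -!capPE -probability_setC; last exact: measurable_capset.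
rewrite -(uniform_isometric (isometric_rotN n) (@measurable_capset n.+1 (- t))).
apply: le_measure; rewrite ?inE.
- by apply: measurableC; exact: measurable_capset.
- have [[m _] _ _] := isometric_rotN n.
  by rewrite -[X in measurable X]setTI; exact: (m measurableT _ (@measurable_capset _ _)).
move=> u; rewrite /capset /preimage /setC /mkset rotN lerN2 => /negP; rewrite -ltNge; exact: ltW.
Qed.

Lemma capP0 n : capP n.+1 0 = 2^-1.
Proof.
have h1 := capP_opp n 0; rewrite oppr0 in h1.
have h2 : capP n.+1 0 + capP n.+1 0 <= 1.
  have mL : measurable (@rot2 R (-1) 0 n @^-1` capset n.+1 0).
    have [[m _] _ _] := isometric_rotN n.
    by rewrite -[X in measurable X]setTI; exact: (m measurableT _ (@measurable_capset _ _)).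
  have mE : measurable [set u : @vec R n.+2 | thd u = 0].
    rewrite -[X in measurable X]setTI.
  exact: (@measurable_thd _ (measurableTypeR R) n.+1 measurableT [set (0 : R)] (measurable_set1 0)).
  rewrite -lee_fin EFinD -!capPE.
  rewrite -{2}(uniform_isometric (isometric_rotN n) (@measurable_capset n.+1 0)).
  have mD : measurable (capset n.+1 0 `\` [set u : @vec R n.+2 | thd u = 0]).
    by apply: measurableD => //; exact: measurable_capset.
  have -> : uniform_sphere n.+2 (capset n.+1 0) =
      uniform_sphere n.+2 (capset n.+1 0 `\` [set u : @vec R n.+2 | thd u = 0]).
    rewrite measureD//=; last 2 first.
    - exact: measurable_capset.
    - by rewrite ltey_eq fin_num_measure//; exact: measurable_capset.
    rewrite [X in (_ - X)%E](_ : _ = 0%E) ?sube0//.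
    apply/eqP; rewrite eq_le measure_ge0 andbT -[leRHS](uniform_equator n.+1).
    by apply: le_measure; rewrite ?inE//; apply: measurableI => //; exact: measurable_capset.
  rewrite -measureU//; last first.
    apply/seteqP; split => u //= [[]]; rewrite /capset/= rotN oppr_ge0 => h h' h''.
    by apply: h'; apply/eqP; rewrite eq_le h h''.
  by apply: probability_le1; exact: measurableU.
lra.
Qed.

(** [cosine_prim_rec] turns the slice integral into a multiple of the integral of [cosine ^+ m], the
    density of the height. The multiple is found from the value [1/2] at [t = 0], without computing
    any ball volume. *)
Lemma capP_formula m t : 0 <= t < 1 ->
  capP m.+2 t = (cosine_prim m 1 - cosine_prim m t) / (2 * @half_wallis R m).
Proof.
have key s : 0 <= s < 1 -> capP m.+2 s =
    (m.+3%:R^-1 * m.+2%:R * (@vball R m.+2 / @vball R m.+3)) * (cosine_prim m 1 - cosine_prim m s).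
  move=> s01.
  have := cap_tail_slice s01 (fun c x _ _ => I : [set: @vec R m.+2] _) (@measurableT _ _).
  rewrite (_ : [set u | _ /\ _] = capset m.+2 s); last first.
    by apply/seteqP; split => u //= [].
  rewrite (_ : [set x | _ /\ [set: _] _] = @unit_ball R m.+2); last first.
    by apply/seteqP; split => u //= [].
  rewrite capPE slice_integralE// vballE -!EFinM => -[->].
  rewrite /slice_integral.
  have := @cosine_prim_rec R m s; case/andP: (s01) => s0 s1; rewrite s0 (ltW s1) => /(_ isT) E.
  set I2 := cosine_prim m.+2 1 - _ in E *; set I0 := cosine_prim m 1 - _ in E *.
  have -> : m.+3%:R^-1 * (s * cosine s ^+ m.+2) + I2 = m.+3%:R^-1 * m.+2%:R * I0.
    by rewrite -mulrA -E; field.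
  by ring.
move=> t01; rewrite (key t t01).
have h0 : 0 <= (0 : R) < 1 by rewrite lexx ltr01.
have /esym := key 0 h0; rewrite capP0 -/(@half_wallis R m).
set c := (X in X * _ = _) => h.
have hw := @half_wallis_gt0 R m.
rewrite -/c; have -> : c = 2^-1 / @half_wallis R m by rewrite -h mulfK// gt_eqF.
by field; rewrite gt_eqF.
Qed.

End cap_probability.
Arguments capset {R} n t _.

(** * Expectations of bounded functions *)

Section bounded_measurable.
Context {d : measure_display} {T : measurableType d} {R : realType}.

(** On a probability space this class is integrable and stable under sums, products, sections and
    partial expectations, so Fubini applies without further conditions. *)
Definition bmeas (f : T -> R) :=
  measurable_fun setT f /\ exists M, forall x, `|f x| <= M.

Lemma bmeas_cst c : bmeas (fun=> c).
Proof. by split => //; exists `|c|. Qed.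

Lemma bmeasD f g : bmeas f -> bmeas g -> bmeas (fun x => f x + g x).
Proof.
move=> [mf [M hM]] [mg [N hN]]; split; first exact: measurable_funD.
by exists (M + N) => x; rewrite (le_trans (ler_normD _ _))// lerD.
Qed.

Lemma bmeasM f g : bmeas f -> bmeas g -> bmeas (fun x => f x * g x).
Proof.
move=> [mf [M hM]] [mg [N hN]]; split; first exact: measurable_funM.
by exists (M * N) => x; rewrite normrM ler_pM.
Qed.

Lemma bmeasZ c f : bmeas f -> bmeas (fun x => c * f x).
Proof. by move=> hf; apply: bmeasM => //; exact: bmeas_cst. Qed.

Lemma bmeasN f : bmeas f -> bmeas (fun x => - f x).
Proof.
by move=> hf; rewrite (_ : (fun _ => _) = fun x => -1 * f x);
  [exact: bmeasZ|apply/funext => x; rewrite mulN1r].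
Qed.

Lemma bmeasB f g : bmeas f -> bmeas g -> bmeas (fun x => f x - g x).
Proof. by move=> hf hg; apply: bmeasD => //; exact: bmeasN. Qed.

Lemma bmeasX f n : bmeas f -> bmeas (fun x => f x ^+ n).
Proof.
move=> hf; elim: n => [|n IH]; first exact: bmeas_cst.
by rewrite (_ : (fun _ => _) = fun x => f x * f x ^+ n);
  [exact: bmeasM|apply/funext => x; rewrite exprS].
Qed.

Lemma bmeas_sum (I : Type) (s : seq I) (P : pred I) (f : I -> T -> R) :
  (forall i, bmeas (f i)) -> bmeas (fun x => \sum_(i <- s | P i) f i x).
Proof.
move=> hf; elim: s => [|i s IH].
  rewrite (_ : (fun _ => _) = fun=> 0); first exact: bmeas_cst.
  by apply/funext => x; rewrite big_nil.
rewrite (_ : (fun _ => _) = fun x => (if P i then f i x else 0) + \sum_(i <- s | P i) f i x).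
  by apply: bmeasD => //; case: (P i) => //; exact: bmeas_cst.
by apply/funext => x; rewrite big_cons; case: (P i) => //; rewrite add0r.
Qed.

Lemma bmeas_bool (b : T -> bool) : measurable [set x | b x] ->
  bmeas (fun x => (b x)%:R).
Proof.
move=> mb; split; last by exists 1 => x; case: (b x); rewrite ?normr1 ?normr0.
rewrite (_ : (fun _ => _) = \1_[set x | b x]); first exact: measurable_indic.
by apply/funext => x; rewrite indicE; congr ((nat_of_bool _)%:R); apply/idP/idP; rewrite inE.
Qed.

Variables (mu : {measure set T -> \bar R}) (mu1 : mu setT = 1%E).

Lemma bmeas_integrable f : bmeas f -> mu.-integrable setT (EFin \o f).
Proof.
move=> [mf [M hM]]; apply: measurable_bounded_integrable => //.
  by rewrite mu1 ltry.
by exists M; split; [exact: num_real|move=> N MN x _; exact: le_trans (hM x) (ltW MN)].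
Qed.

Lemma bmeas_fin f : bmeas f -> (\int[mu]_x (f x)%:E)%E \is a fin_num.
Proof. by move=> hf; apply: integrable_fin_num => //; exact: bmeas_integrable. Qed.

Definition Ex (f : T -> R) : R := \int[mu]_x f x.

Lemma ExE f : bmeas f -> (\int[mu]_x (f x)%:E)%E = (Ex f)%:E.
Proof. by move=> hf; rewrite fineK// bmeas_fin. Qed.

Lemma Ex_cst c : Ex (fun=> c) = c.
Proof. by rewrite /Ex Rintegral_cst// mu1 mulr1. Qed.

Lemma ExD f g : bmeas f -> bmeas g -> Ex (fun x => f x + g x) = Ex f + Ex g.
Proof. by move=> hf hg; rewrite /Ex RintegralD//; exact: bmeas_integrable. Qed.

Lemma ExB f g : bmeas f -> bmeas g -> Ex (fun x => f x - g x) = Ex f - Ex g.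
Proof. by move=> hf hg; rewrite /Ex RintegralB//; exact: bmeas_integrable. Qed.

Lemma ExZ c f : bmeas f -> Ex (fun x => c * f x) = c * Ex f.
Proof. by move=> hf; rewrite /Ex RintegralZl//; exact: bmeas_integrable. Qed.

Lemma Ex_ge0 f : (forall x, 0 <= f x) -> 0 <= Ex f.
Proof. by move=> f0; apply: Rintegral_ge0. Qed.

Lemma le_Ex f g : bmeas f -> bmeas g -> (forall x, f x <= g x) -> Ex f <= Ex g.
Proof. by move=> hf hg fg; apply: le_Rintegral => //; exact: bmeas_integrable. Qed.

Lemma Ex_sum (I : Type) (s : seq I) (P : pred I) (f : I -> T -> R) :
  (forall i, bmeas (f i)) ->
  Ex (fun x => \sum_(i <- s | P i) f i x) = \sum_(i <- s | P i) Ex (f i).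
Proof.
move=> hf; elim: s => [|i s IH].
  rewrite big_nil (_ : (fun _ => _) = fun=> 0) ?Ex_cst//.
  by apply/funext => x; rewrite big_nil.
rewrite (_ : (fun _ => _) = fun x => (if P i then f i x else 0) + \sum_(i <- s | P i) f i x).
  rewrite ExD ?IH; last 2 first.
  - by case: (P i) => //; exact: bmeas_cst.
  - exact: bmeas_sum.
  by rewrite big_cons; case: (P i) => //; rewrite Ex_cst add0r.
by apply/funext => x; rewrite big_cons; case: (P i) => //; rewrite add0r.
Qed.

Lemma Ex_norm_le f M : bmeas f -> (forall x, `|f x| <= M) -> `|Ex f| <= M.
Proof.
move=> hf hM; rewrite ler_norml.
by apply/andP; split; [rewrite -[leLHS]Ex_cst|rewrite -[leRHS]Ex_cst]; apply: le_Ex => //; try exact: bmeas_cst;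
  move=> x; have := hM x; rewrite ler_norml => /andP[].
Qed.

Lemma Ex_ae (D : set T) f g : measurable D -> mu (~` D) = 0%E ->
  bmeas f -> bmeas g -> (forall x, D x -> f x = g x) -> Ex f = Ex g.
Proof.
move=> mD D0 hf hg fg; rewrite /Ex /Rintegral; congr fine.
apply: ae_eq_integral => //.
- by apply/measurable_EFinP; case: hf.
- by apply/measurable_EFinP; case: hg.
exists (~` D); split => //; first exact: measurableC.
by move=> x /= h Dx; apply: h => _; rewrite fg.
Qed.

Lemma le_Ex_ae (D : set T) f g : measurable D -> mu (~` D) = 0%E ->
  bmeas f -> bmeas g -> (forall x, D x -> f x <= g x) -> Ex f <= Ex g.
Proof.
move=> mD D0 hf hg fg; pose b x := `[< D x >].
have hb : bmeas (fun x => (b x)%:R).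
  apply: bmeas_bool; rewrite (_ : [set x | b x] = D)//.
  by apply/seteqP; split => x /asboolP.
have bD x : D x -> (b x)%:R = 1 :> R by move=> /asboolP h; rewrite /b h.
rewrite (Ex_ae mD D0 hf (bmeasM hf hb)); last by move=> x Dx; rewrite bD// mulr1.
rewrite (Ex_ae mD D0 hg (bmeasM hg hb)); last by move=> x Dx; rewrite bD// mulr1.
apply: le_Ex; [exact: bmeasM|exact: bmeasM|move=> x].
rewrite /b; case: asboolP => [/fg|_]; first by rewrite !mulr1.
by rewrite !mulr0.
Qed.

Lemma Ex_indic (A : set T) (b : T -> bool) : measurable A -> (forall x, b x <-> A x) ->
  Ex (fun x => (b x)%:R) = fine (mu A).
Proof.
move=> mA bA; rewrite /Ex /Rintegral -[in RHS](setIT A) -integral_indic//.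
congr fine; apply: eq_integral => x _; rewrite indicE; congr ((nat_of_bool _)%:R%:E).
by apply/idP/idP; rewrite inE => /bA.
Qed.

(** Cauchy-Schwarz for equal second moments, where it reduces to [(f - g)^2 >= 0] and
    [(f + g)^2 >= 0]. *)
Lemma Ex_mul_le f g : bmeas f -> bmeas g -> Ex (fun x => f x ^+ 2) = Ex (fun x => g x ^+ 2) ->
  `|Ex (fun x => f x * g x)| <= Ex (fun x => f x ^+ 2).
Proof.
move=> hf hg E.
have hfg := bmeasM hf hg; have hf2 := bmeasX 2 hf; have hg2 := bmeasX 2 hg.
have h1 : 2 * Ex (fun x => f x * g x) <= 2 * Ex (fun x => f x ^+ 2).
  rewrite [leRHS]mulr_natl [leRHS]mulr2n {2}E -ExD// -ExZ//.
  apply: le_Ex; [exact: bmeasZ|exact: bmeasD|move=> x].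
  by rewrite -subr_ge0 (_ : _ - _ = (f x - g x) ^+ 2) ?sqr_ge0//; ring.
have h2 : 2 * - Ex (fun x => f x * g x) <= 2 * Ex (fun x => f x ^+ 2).
  rewrite [leRHS]mulr_natl [leRHS]mulr2n {2}E -ExD// mulrN -mulNr -ExZ//.
  apply: le_Ex; [exact: bmeasZ|exact: bmeasD|move=> x].
  by rewrite -subr_ge0 (_ : _ - _ = (f x + g x) ^+ 2) ?sqr_ge0//; ring.
by rewrite ler_norml; lra.
Qed.

End bounded_measurable.

Lemma bmeas_comp d d' (T : measurableType d) (T' : measurableType d') (R : realType)
    (f : T' -> R) (g : T -> T') :
  bmeas f -> measurable_fun setT g -> bmeas (f \o g).
Proof.
move=> [mf [M hM]] mg; split; first exact: (measurableT_comp mf mg).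
by exists M => x; exact: hM.
Qed.

Section product_expectation.
Context {d d' : measure_display} {T : measurableType d} {T' : measurableType d'} {R : realType}.
Variables (mu : {sigma_finite_measure set T -> \bar R})
  (nu : {sigma_finite_measure set T' -> \bar R})
  (mu1 : mu setT = 1%E) (nu1 : nu setT = 1%E).

Lemma product_setT1 : (mu \x nu)%E [set: T * T'] = 1%E.
Proof.
rewrite -setXTT; transitivity (mu setT * nu setT)%E; first exact: product_measure1E.
by rewrite mu1 nu1 mule1.
Qed.

Lemma bmeas_section1 (f : T * T' -> R) x : bmeas f -> bmeas (fun y => f (x, y)).
Proof. by move=> hf; apply: (bmeas_comp hf (g := pair x)); exact: pair1_measurable. Qed.

Lemma bmeas_section2 (f : T * T' -> R) y : bmeas f -> bmeas (fun x => f (x, y)).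
Proof. by move=> hf; apply: (bmeas_comp hf (g := pair^~ y)); exact: pair2_measurable. Qed.

Lemma bmeas_Ex (f : T * T' -> R) : bmeas f -> bmeas (fun x => Ex nu (fun y => f (x, y))).
Proof.
move=> hf; have [_ [M hM]] := hf; split; last first.
  by exists M => x; apply: Ex_norm_le => //; exact: bmeas_section1.
have := measurable_fubini_F (bmeas_integrable product_setT1 hf).
by move=> /(measurableT_comp (@fine_measurable R setT measurableT)).
Qed.

Lemma Ex_product (f : T * T' -> R) : bmeas f ->
  Ex (mu \x nu)%E f = Ex mu (fun x => Ex nu (fun y => f (x, y))).
Proof.
move=> hf; have ih := bmeas_integrable product_setT1 hf.
rewrite {1 2}/Ex /Rintegral -integral12_prod_meas1//; congr fine.
apply: eq_integral => x _; rewrite /fubini_F -ExE//.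
by apply: bmeas_section1.
Qed.

Lemma Ex_swap (f : T * T' -> R) : bmeas f ->
  Ex mu (fun x => Ex nu (fun y => f (x, y))) = Ex nu (fun y => Ex mu (fun x => f (x, y))).
Proof.
move=> hf; have ih := bmeas_integrable product_setT1 hf.
have E := Fubini ih.
rewrite {1 3}/Ex /Rintegral; congr fine.
transitivity (\int[mu]_x \int[nu]_y (f (x, y))%:E)%E.
  by apply: eq_integral => x _; rewrite -ExE//; exact: bmeas_section1.
rewrite E; apply: eq_integral => y _; rewrite -ExE//; exact: bmeas_section2.
Qed.

End product_expectation.

Section power_expectation.
Context {d : measure_display} {T : measurableType d} {R : realType}.
Variables (mu : {sigma_finite_measure set T -> \bar R}) (mu1 : mu setT = 1%E).

Lemma power_setT1 n : power_measure mu n setT = 1%E.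
Proof.
elim: n => [|n IH] /=; first by rewrite diracT.
rewrite /cons_measure /pushforward preimage_setT.
exact: (product_setT1 mu1 IH).
Qed.

Lemma bmeas_cons n (f : n.+1.-tuple T -> R) : bmeas f -> bmeas (f \o @pair_cons _ T n).
Proof. by move=> hf; apply: bmeas_comp => //; exact: measurable_pair_cons. Qed.

Lemma Ex_powerS n (f : n.+1.-tuple T -> R) : bmeas f ->
  Ex (power_measure mu n.+1) f =
  Ex mu (fun a => Ex (power_measure mu n) (fun x => f (pair_cons (a, x)))).
Proof.
move=> hf; have hc := bmeas_cons hf.
rewrite -(Ex_product mu1 (power_setT1 n) hc) /Ex /Rintegral; congr fine.
transitivity (\int[pushforward (mu \x power_measure mu n) (@pair_cons _ T n)]_x (f x)%:E)%E; first by [].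
rewrite integral_pushforward; last 1 first.
- exact: measurableT.
- by rewrite preimage_setT.
- exact: measurable_pair_cons.
- by apply/measurable_EFinP; case: hf.
- rewrite preimage_setT; exact: (bmeas_integrable (product_setT1 mu1 (power_setT1 n)) hc).
Qed.

Definition upd n (U : n.-tuple T) (i : 'I_n) (u : T) : n.-tuple T :=
  [tuple if j == i then u else tnth U j | j < n].

Lemma tnth_upd n (U : n.-tuple T) i u j :
  tnth (upd U i u) j = if j == i then u else tnth U j.
Proof. by rewrite tnth_mktuple. Qed.

Lemma measurable_upd n (i : 'I_n) :
  measurable_fun setT (fun v : n.-tuple T * T => upd v.1 i v.2).
Proof.
apply/measurable_fun_tnthP => j.
rewrite (_ : _ \o _ = fun v : n.-tuple T * T => if j == i then v.2 else tnth v.1 j).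
  case: (j == i); first exact: measurable_snd.
  exact: (measurableT_comp (@measurable_tnth _ T n j) measurable_fst).
by apply/funext => v /=; rewrite tnth_upd.
Qed.

Lemma upd_cons0 n a (x : n.-tuple T) u : upd (pair_cons (a, x)) ord0 u = pair_cons (u, x).
Proof.
apply: eq_from_tnth => j; rewrite tnth_upd.
by have [k ->|->] := unliftP ord0 j => //; rewrite eq_sym (negbTE (neq_lift _ _)) !tnthS.
Qed.

Lemma upd_consS n a (x : n.-tuple T) (i : 'I_n) u :
  upd (pair_cons (a, x)) (lift ord0 i) u = pair_cons (a, upd x i u).
Proof.
apply: eq_from_tnth => j; rewrite tnth_upd.
have [k ->|->] := unliftP ord0 j.
  by rewrite (inj_eq lift_inj) !tnthS tnth_upd.
by rewrite (negbTE (neq_lift _ _)).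
Qed.

Lemma bmeas_upd n (f : n.-tuple T -> R) (i : 'I_n) : bmeas f ->
  bmeas (fun v : n.-tuple T * T => f (upd v.1 i v.2)).
Proof. by move=> hf; apply: (bmeas_comp hf); exact: measurable_upd. Qed.

Lemma bmeas_Ex_upd n (f : n.-tuple T -> R) (i : 'I_n) : bmeas f ->
  bmeas (fun U => Ex mu (fun u => f (upd U i u))).
Proof.
by move=> hf; exact: (bmeas_Ex (power_setT1 n) mu1 (bmeas_upd i hf)).
Qed.

(** Redrawing one coordinate independently does not change the law. This integrates out a single
    point wherever it sits in the tuple. *)
Lemma Ex_resample n (f : n.-tuple T -> R) (i : 'I_n) : bmeas f ->
  Ex (power_measure mu n) f =
  Ex (power_measure mu n) (fun U => Ex mu (fun u => f (upd U i u))).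
Proof.
elim: n f i => [f [] //|n IH f i hf].
have hc := bmeas_cons hf.
rewrite (Ex_powerS hf) (Ex_powerS (bmeas_Ex_upd i hf)).
have [j ->|->] := unliftP ord0 i.
  congr (Ex mu _); apply/funext => a.
  rewrite (IH _ j); last exact: (bmeas_section1 a hc).
  congr (Ex _ _); apply/funext => x; congr (Ex mu _); apply/funext => u.
  by rewrite upd_consS.
transitivity (Ex mu (fun=> Ex (power_measure mu n) (fun x => Ex mu (fun u => f (pair_cons (u, x)))))).
  rewrite Ex_cst//.
  exact: (Ex_swap mu1 (power_setT1 n) hc).
congr (Ex mu _); apply/funext => a; congr (Ex _ _); apply/funext => x.
by congr (Ex mu _); apply/funext => u; rewrite upd_cons0.
Qed.

End power_expectation.

(** * Probability of a triangle of caps *)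

Section triangle.
Context {R : realType}.
Implicit Types (n m : nat) (t p : R).

(** Two unit vectors with heights [s] and [r] at least [x] and horizontal lengths [ws] and [wr]: if
    the cosine of their horizontal parts is the one that gives inner product [tau] when both heights
    equal [x], then larger heights can only increase the inner product beyond [tau]. *)
Lemma cap_threshold (tau x s r ws wr : R) : 0 <= tau -> tau <= x -> x < 1 ->
  x <= s <= 1 -> x <= r <= 1 -> 0 <= ws -> 0 <= wr ->
  ws ^+ 2 = 1 - s ^+ 2 -> wr ^+ 2 = 1 - r ^+ 2 ->
  tau <= s * r + ws * ((tau - x ^+ 2) / (1 - x ^+ 2) * wr).
Proof.
move=> t0 tx x1 /andP[xs s1] /andP[xr r1] ws0 wr0 hs hr.
have x0 : 0 <= x := le_trans t0 tx.
have x21 : 0 < 1 - x ^+ 2 by rewrite subr_gt0 expr_lt1.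
set theta := _ / _.
have thetaE : theta * (1 - x ^+ 2) = tau - x ^+ 2 by rewrite /theta mulfVK// gt_eqF.
have -> : ws * (theta * wr) = theta * (ws * wr) by ring.
have wsr0 : 0 <= ws * wr by rewrite mulr_ge0.
have [th0|th0] := leP 0 theta.
  (* [X] and [Y] locate the heights affinely between 1 (value 0) and [x] (value 1). By concavity of
     the circle, [ws] is at least [X] times its value at height [x], and similarly for [wr]. *)
  pose X := (1 - s) / (1 - x); pose Y := (1 - r) / (1 - x).
  have x10 : 0 < 1 - x by rewrite subr_gt0.
  have X0 : 0 <= X by rewrite divr_ge0 ?subr_ge0// ltW.
  have Y0 : 0 <= Y by rewrite divr_ge0 ?subr_ge0// ltW.
  have X1 : X <= 1 by rewrite ler_pdivrMr// mul1r lerD2l lerN2.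
  have Y1 : Y <= 1 by rewrite ler_pdivrMr// mul1r lerD2l lerN2.
  have x10' : 0 <= 1 - x by exact: ltW.
  have a1 : 0 <= 1 - X by rewrite subr_ge0.
  have a2 : 0 <= 1 - Y by rewrite subr_ge0.
  have sE : s = 1 - X * (1 - x) by rewrite /X mulfVK ?gt_eqF//; ring.
  have rE : r = 1 - Y * (1 - x) by rewrite /Y mulfVK ?gt_eqF//; ring.
  clearbody X Y.
  have hX : (1 - x ^+ 2) * X ^+ 2 <= ws ^+ 2.
    rewrite hs sE -subr_ge0.
    have -> : 1 - (1 - X * (1 - x)) ^+ 2 - (1 - x ^+ 2) * X ^+ 2 =
      X * (1 - x) * 2 * (1 - X) by ring.
    by rewrite !mulr_ge0.
  have hY : (1 - x ^+ 2) * Y ^+ 2 <= wr ^+ 2.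
    rewrite hr rE -subr_ge0.
    have -> : 1 - (1 - Y * (1 - x)) ^+ 2 - (1 - x ^+ 2) * Y ^+ 2 =
      Y * (1 - x) * 2 * (1 - Y) by ring.
    by rewrite !mulr_ge0.
  have hXY : (1 - x ^+ 2) * (X * Y) <= ws * wr.
    rewrite -(@ler_pXn2r _ 2)// ?nnegrE//; last by rewrite !mulr_ge0// ltW.
    rewrite [leRHS]exprMn (_ : _ ^+ 2 = ((1 - x ^+ 2) * X ^+ 2) * ((1 - x ^+ 2) * Y ^+ 2)).
      by apply: ler_pM => //; rewrite mulr_ge0 ?sqr_ge0// ltW.
    by ring.
  have h1 : (tau - x ^+ 2) * (X * Y) <= theta * (ws * wr).
    by rewrite -thetaE -mulrA ler_wpM2l.
  (* After this replacement the gap is affine in [X] and in [Y], with values [1 - tau], [x - tau],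
     [x - tau] and 0 at the corners of the square. *)
  have h2 : 0 <= (1 - X) * (1 - Y) * (1 - tau) + X * (1 - Y) * (x - tau) + (1 - X) * Y * (x - tau).
    have a3 : 0 <= 1 - tau by rewrite subr_ge0 (le_trans tx)// ltW.
    have a4 : 0 <= x - tau by rewrite subr_ge0.
    by rewrite !addr_ge0// !mulr_ge0.
  have h3 : s * r + (tau - x ^+ 2) * (X * Y) - tau =
     (1 - X) * (1 - Y) * (1 - tau) + X * (1 - Y) * (x - tau) + (1 - X) * Y * (x - tau).
    by rewrite {1}sE {1}rE; ring.
  lra.
(* For a negative [theta], both terms are smallest when the two heights equal [x]. *)
have h1 : ws * wr <= 1 - x ^+ 2.
  have x21' : 0 <= 1 - x ^+ 2 by exact: ltW.
  rewrite -(@ler_pXn2r _ 2) ?nnegrE// exprMn [leRHS]expr2.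
  apply: ler_pM; rewrite ?sqr_ge0// ?hs ?hr lerD2l lerN2 ler_pXn2r ?nnegrE//.
  - exact: le_trans xs.
  - exact: le_trans xr.
have h2 : theta * (1 - x ^+ 2) <= theta * (ws * wr) by rewrite ler_wnM2l// ltW.
have h3 : x ^+ 2 <= s * r by rewrite expr2 ler_pM.
lra.
Qed.

Lemma measurable_dot n : measurable_fun setT (fun v : @vec R n * @vec R n => dot v.1 v.2).
Proof.
apply: measurable_sum => i; apply: measurable_funM.
  exact: (measurableT_comp (@measurable_tnth _ (measurableTypeR R) n i) measurable_fst).
exact: (measurableT_comp (@measurable_tnth _ (measurableTypeR R) n i) measurable_snd).
Qed.

Lemma bmeas_edge n t d' (X : measurableType d') (f g : X -> @vec R n) :
  measurable_fun setT f -> measurable_fun setT g ->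
  bmeas (fun x => ((t <= dot (f x) (g x))%R%:R : R)).
Proof.
move=> mf mg; apply: bmeas_bool; apply: measurable_le_set => //.
have := measurable_fun_pair mf mg.
by move=> /(measurableT_comp (@measurable_dot n)).
Qed.

Definition axis n : @vec R n.+1 := vcons 1 (zerov n).

Lemma dot_axisl n (x : @vec R n.+1) : dot (axis n) x = thd x.
Proof. by rewrite dot_axis mul1r. Qed.

Lemma enorm_axis n : enorm (axis n) = 1.
Proof. by rewrite /enorm dot_axisl /axis thd_cons sqrtr1. Qed.

Lemma uniform_sphere_unit n :
  uniform_sphere n.+1 (~` [set x : @vec R n.+1 | enorm x = 1]) = 0%E.
Proof.
have m1 : measurable [set x : @vec R n.+1 | enorm x = 1].
  rewrite -[X in measurable X]setTI.
  exact: (@measurable_enorm R n.+1 measurableT [set 1] (measurable_set1 1)).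
rewrite (@uniform_cone _ _ _ set0)//.
- rewrite (_ : [set x | _ /\ _] = set0) ?measure0 ?mul0e//.
  by apply/seteqP; split => x // [].
- exact: measurableC.
- by move=> x x0; split => //= h; apply: h; exact: enorm_direction.
Qed.

Lemma uniform_cap_dir n (e : @vec R n.+2) t : enorm e = 1 ->
  uniform_sphere n.+2 [set c | (t <= dot e c)%R] = (capP n.+1 t)%:E.
Proof.
move=> e1; have [phi [iphi phie]] := rotate_to_axis e.
rewrite -capPE -(uniform_isometric iphi (@measurable_capset _ n.+1 t)).
congr (uniform_sphere n.+2 _); apply/seteqP; split => c /=;
  rewrite /capset /= -(dot_axisl (phi c)) /axis -e1 -phie;
  by case: iphi => _ -> _.
Qed.

Lemma uniform_cone_dir n (e : @vec R n.+2) t : enorm e = 1 ->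
  uniform_sphere n.+2 [set c | (t * enorm c <= dot e c)%R] = (capP n.+1 t)%:E.
Proof.
move=> e1; rewrite -(uniform_cap_dir t e1).
have mC : measurable [set c : @vec R n.+2 | t * enorm c <= dot e c].
  apply: measurable_le_set; last exact: measurable_dotl.
  by apply: measurable_funM => //; exact: measurable_enorm.
rewrite (@uniform_cone_set _ n.+1 [set c | t * enorm c <= dot e c])//; last first.
  move=> c x c0 /= h; rewrite (enorm_scalev _ (ltW c0)) dot_scaler.
  by rewrite mulrCA ler_pM2l.
apply/esym; apply: uniform_cone => //.
  by apply: measurable_le_set => //; exact: measurable_dotl.
move=> x x0 /=; rewrite directionE dot_scaler mulrC ler_pdivlMr//.
by rewrite lt_neqAle eq_sym x0 enorm_ge0.
Qed.

Lemma cap_tail_dir n (e : @vec R n.+2) t s : 0 <= t < 1 -> enorm e = 1 ->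
  uniform_sphere n.+3 [set u | t <= thd u /\ s * enorm (ttl u) <= dot e (ttl u)] =
  (capP n.+2 t * capP n.+1 s)%:E.
Proof.
move=> t01 e1; rewrite EFinM -(uniform_cone_dir s e1).
apply: (@cap_tail_indep _ n.+1 t [set c | s * enorm c <= dot e c]) => //.
  move=> c x c0 /= h; rewrite (enorm_scalev _ (ltW c0)) dot_scaler.
  by rewrite mulrCA ler_pM2l.
apply: measurable_le_set; last exact: measurable_dotl.
by apply: measurable_funM => //; exact: measurable_enorm.
Qed.

(** The horizontal direction of a uniform point is uniform on the sphere of one dimension less:
    every slice is a multiple of the same cone, and the common factor [I] is found by taking [K] to
    be the whole space. *)
Lemma uniform_tail_cone n (K : set (@vec R n.+1)) : cone_set K -> measurable K ->
  uniform_sphere n.+2 [set u | K (ttl u)] = uniform_sphere n.+1 K.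
Proof.
pose I := (\int[@lebesgue_measure R]_a (cosine a ^+ n.+1)%:E)%E.
have mc : measurable_fun setT (fun a : measurableTypeR R => (cosine a ^+ n.+1)%:E).
  by apply/measurable_EFinP; apply: measurable_funX; exact: (continuous_measurable_fun continuous_cosine).
have c0 a : (0 <= (cosine a ^+ n.+1)%:E)%E by rewrite lee_fin exprn_ge0// cosine_ge0.
have key (L : set (@vec R n.+1)) : cone_set L -> measurable L ->
    lebesgue_vec n.+2 [set x | enorm x <= 1 /\ L (ttl x)] =
    (I * lebesgue_vec n.+1 [set x | (enorm x <= 1)%R /\ L x])%E.
  move=> cL mL.
  rewrite lebesgue_vecS; last by apply: measurable_kball; exact: measurable_tail_set.
  rewrite -ge0_integralZr//; apply: eq_integral => a _.
  rewrite -(lebesgue_cone_ball0 cL mL (cosine_ge0 a)).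
  have sq0 x : 0 <= a ^+ 2 + @enorm R n.+1 x ^+ 2 by rewrite addr_ge0// sqr_ge0.
  have E1 (x : @vec R n.+1) : (enorm (vcons a x) <= 1) = (a ^+ 2 + enorm x ^+ 2 <= 1).
    by rewrite enorm_cons -{1}(@sqrtr1 R) ler_sqrt.
  have [a1|a1] := leP (a ^+ 2) 1.
    have E2 (x : @vec R n.+1) : (enorm x <= cosine a) = (a ^+ 2 + enorm x ^+ 2 <= 1).
      by rewrite -(@ler_pXn2r _ 2) ?nnegrE ?enorm_ge0 ?cosine_ge0// sqr_cosine// lerBrDl.
    congr (lebesgue_vec n.+1 _); apply/seteqP; split => x /=;
      by rewrite ttl_cons E1 E2.
  have -> : cosine a = 0 by rewrite /cosine ler0_sqrtr// subr_le0 ltW.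
  rewrite (lebesgue_cone_ball0 cL mL (lexx _)) expr0n/= mul0e.
  rewrite (_ : [set x | _] = set0) ?measure0//; apply/seteqP; split => x //=.
  by rewrite E1 => -[h _]; have := sqr_ge0 (enorm x); lra.
have I0 : (0 <= I)%E by apply: integral_ge0 => a _.
have E : ((@vball R n.+2)%:E = I * (@vball R n.+1)%:E)%E.
  have B1 : [set x : @vec R n.+2 | enorm x <= 1 /\ [set: @vec R n.+1] (ttl x)] = @unit_ball R n.+2.
    by apply/seteqP; split => [x []|x].
  have B2 : [set x : @vec R n.+1 | enorm x <= 1 /\ [set: @vec R n.+1] x] = @unit_ball R n.+1.
    by apply/seteqP; split => [x []|x].
  have := key setT (fun _ _ _ _ => Logic.I) measurableT.
  by rewrite B1 B2 !vballE.
have IE : I = (@vball R n.+2 / @vball R n.+1)%:E.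
  move: I0 E; case: I {key} => [r|//|//] _.
    by rewrite -EFinM => -[->]; rewrite mulfK// gt_eqF// vball_gt0.
  by rewrite mulyr gtr0_sg ?vball_gt0// mul1e.
move=> cK mK; rewrite (@uniform_cone _ n.+1 _ [set x | K (ttl x)]); last 3 first.
- exact: measurable_tail_set.
- exact: measurable_tail_set.
- move=> x x0 /=; rewrite directionE ttl_scalev.
  by rewrite (cone_scalev _ cK)// invr_gt0 lt_neqAle eq_sym x0 enorm_ge0.
rewrite key// IE (uniform_cone_set cK)//.
have : lebesgue_vec n.+1 [set x | enorm x <= 1 /\ K x] \is a fin_num.
  by apply: lebesgue_sub_ball_fin; [exact: measurable_kball|by move=> x []].
move=> /fineK <-; rewrite -!EFinM; congr EFin.
by field; rewrite !gt_eqF// vball_gt0.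
Qed.

(** Take the pole [f] orthogonal to the new coordinate. The inner product with [f] only sees the
    tail, and comparing it with the norm of the full vector instead of that of the tail is a
    stronger condition when [t >= 0]. *)
Lemma capP_dim n t : 0 <= t -> @capP R n.+2 t <= @capP R n.+1 t.
Proof.
move=> t0.
pose e : @vec R n.+2 := axis n.+1.
pose f : @vec R n.+3 := vcons 0 e.
have e1 : enorm e = 1 by exact: enorm_axis.
have f1 : enorm f = 1 by rewrite /f enorm_cons e1 expr0n/= add0r expr1n sqrtr1.
have mK : measurable [set c : @vec R n.+2 | t * enorm c <= dot e c].
  apply: measurable_le_set; last exact: measurable_dotl.
  by apply: measurable_funM => //; exact: measurable_enorm.
have cK : cone_set [set c : @vec R n.+2 | t * enorm c <= dot e c].
  move=> c x c0 /= h; rewrite (enorm_scalev _ (ltW c0)) dot_scaler.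
  by rewrite mulrCA ler_pM2l.
rewrite -lee_fin -(uniform_cone_dir t f1) -(uniform_cone_dir t e1).
rewrite -(uniform_tail_cone cK mK); apply: le_measure; rewrite ?inE.
- apply: measurable_le_set; last exact: measurable_dotl.
  by apply: measurable_funM => //; exact: measurable_enorm.
- exact: measurable_tail_set.
move=> u; rewrite -(cons_thd_ttl u) /= /f dot_cons mul0r add0r ttl_cons; apply: le_trans.
rewrite ler_wpM2l// enorm_cons -[leLHS](ger0_norm (enorm_ge0 _)) -sqrtr_sqr.
by rewrite ler_wsqrtr// lerDr sqr_ge0.
Qed.

Lemma edge_measure_unit n t (e : @vec R n.+2) : enorm e = 1 ->
  Ex (uniform_sphere n.+2) (fun c => (t <= dot e c)%R%:R) = capP n.+1 t.
Proof.
move=> e1; transitivity (fine (uniform_sphere n.+2 [set c | (t <= dot e c)%R])).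
  by apply: Ex_indic => //; apply: measurable_le_set => //; exact: measurable_dotl.
by rewrite (uniform_cap_dir t e1).
Qed.

Lemma Ex_isometric n (phi : @vec R n -> vec n) f : isometric phi -> bmeas f ->
  Ex (uniform_sphere n) (f \o phi) = Ex (uniform_sphere n) f.
Proof.
move=> iphi hf; have mphi : measurable_fun setT phi by case: iphi => -[].
have mu1 : uniform_sphere n [set: @vec R n] = 1%E by exact: probability_setT.
rewrite /Ex /Rintegral; congr fine.
transitivity (\int[pushforward (uniform_sphere n) phi]_x (f x)%:E)%E.
  rewrite (integral_pushforward mphi); last exact: measurableT.
  - by rewrite preimage_setT.
  - by apply/measurable_EFinP; case: hf.
  - rewrite preimage_setT; exact: (bmeas_integrable mu1 (bmeas_comp hf mphi)).
apply: eq_measure_integral => A mA _.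
by rewrite /pushforward; exact: uniform_isometric.
Qed.

Lemma measurable_unit n : measurable [set x : @vec R n | enorm x = 1].
Proof.
rewrite -[X in measurable X]setTI.
exact: (@measurable_enorm R n measurableT [set 1] (measurable_set1 1)).
Qed.

Definition edge t n (u v : @vec R n) : R := (t <= dot u v)%R%:R.

Definition codegree t n (u b : @vec R n) : R :=
  Ex (uniform_sphere n) (fun c => edge t b c * edge t u c).

Definition triangle_prob t n (u : @vec R n) : R :=
  Ex (uniform_sphere n) (fun b => edge t u b * codegree t u b).

Lemma sphere1 n : uniform_sphere n [set: @vec R n] = 1%E.
Proof. exact: probability_setT. Qed.

Lemma bmeas_edgel t n (u : @vec R n) : bmeas (edge t u).
Proof. by apply: bmeas_edge. Qed.

Lemma bmeas_codegree t n (u : @vec R n) : bmeas (codegree t u).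
Proof.
apply: (bmeas_Ex (sphere1 n) (sphere1 n)
  (f := fun v : vec n * vec n => edge t v.1 v.2 * edge t u v.2)).
apply: bmeasM; apply: bmeas_edge => //; by [exact: measurable_fst|exact: measurable_snd].
Qed.

(** Given the position of one vertex, the probability of a triangle does not depend on that
    position. This homogeneity is what later makes two triangles with a single common vertex
    uncorrelated. *)
Lemma triangle_prob_axis t n (u : @vec R n.+2) : enorm u = 1 ->
  triangle_prob t u = triangle_prob t (axis n.+1).
Proof.
move=> u1; have [phi [iphi phiu]] := rotate_to_axis u.
have [_ dphi _] := iphi.
rewrite u1 -/(axis n.+1) in phiu.
have eE x y : edge t (phi x) (phi y) = edge t x y by rewrite /edge dphi.
rewrite /triangle_prob -[RHS](Ex_isometric iphi); last first.
  by apply: bmeasM; [exact: bmeas_edgel|exact: bmeas_codegree].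
congr (Ex _ _); apply/funext => b /=; rewrite -phiu eE; congr (_ * _).
rewrite /codegree -[RHS](Ex_isometric iphi); last by apply: bmeasM; exact: bmeas_edgel.
by congr (Ex _ _); apply/funext => c /=; rewrite !eE.
Qed.

Lemma cap_tail_dir_Ex n (e : @vec R n.+2) t s : 0 <= t < 1 -> enorm e = 1 ->
  bmeas (fun u : @vec R n.+3 => (((t <= thd u) && (s * enorm (ttl u) <= dot e (ttl u)))%R%:R : R)) /\
  Ex (uniform_sphere n.+3)
    (fun u => ((t <= thd u) && (s * enorm (ttl u) <= dot e (ttl u)))%R%:R) =
  capP n.+2 t * capP n.+1 s.
Proof.
move=> t01 e1.
have mA : measurable [set u : @vec R n.+3 | t <= thd u /\ s * enorm (ttl u) <= dot e (ttl u)].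
  apply: measurableI; first exact: measurable_capset.
  apply: (@measurable_tail_set _ _ [set c : @vec R n.+2 | s * enorm c <= dot e c]).
  apply: measurable_le_set; last exact: measurable_dotl.
  by apply: measurable_funM => //; exact: measurable_enorm.
split; last first.
  transitivity (fine (uniform_sphere n.+3
      [set u | t <= thd u /\ s * enorm (ttl u) <= dot e (ttl u)])).
    by apply: Ex_indic => // x; split => /andP.
  by rewrite (cap_tail_dir s t01 e1).
apply: bmeas_bool; move: mA; congr measurable.
by apply/seteqP; split => x /= /andP.
Qed.

Lemma dot_split n (b c : @vec R n.+1) :
  dot b c = (thd b : R) * (thd c : R) + dot (ttl b) (ttl c).
Proof. by rewrite -{1}(cons_thd_ttl b) -{1}(cons_thd_ttl c) dot_cons. Qed.

(** The cosine between horizontal directions at which two unit vectors of height exactly [x] have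
    inner product [t]. *)
Definition tilt t x := (t - x ^+ 2) / (1 - x ^+ 2).

Lemma dot_ge_threshold n (tau x : R) (b c : @vec R n.+1) e :
  0 <= tau -> tau <= x -> x < 1 -> enorm b = 1 -> enorm c = 1 ->
  x <= thd b -> x <= thd c -> ttl b = scalev (enorm (ttl b)) e ->
  tilt tau x * enorm (ttl c) <= dot e (ttl c) -> tau <= dot b c.
Proof.
move=> t0 tx x1 b1 c1 xb xc be h.
have sq (v : @vec R n.+1) : enorm v = 1 -> enorm (ttl v) ^+ 2 = 1 - (thd v : R) ^+ 2.
  move=> v1; have : enorm v ^+ 2 = 1 by rewrite v1 expr1n.
  by rewrite !sqr_enorm dot_split -expr2; lra.
have le1 (v : @vec R n.+1) : enorm v = 1 -> x <= thd v -> x <= thd v <= 1.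
  move=> v1 ->; have := sqr_ge0 (enorm (ttl v)); rewrite sq// subr_ge0 => h1.
  by rewrite /= -[leRHS]sqrtr1 (le_trans (ler_norm _))// -sqrtr_sqr ler_sqrt// -subr_ge0.
have := cap_threshold t0 tx x1 (le1 b b1 xb) (le1 c c1 xc) (enorm_ge0 (ttl b))
  (enorm_ge0 (ttl c)) (sq b b1) (sq c c1).
move=> /le_trans; apply.
rewrite dot_split lerD2l.
by rewrite [in leRHS]be dot_scalel ler_wpM2l// enorm_ge0.
Qed.

Lemma tail_direction n (b : @vec R n.+2) :
  exists2 e : @vec R n.+1, enorm e = 1 & ttl b = scalev (enorm (ttl b)) e.
Proof.
have [b0|b0] := eqVneq (enorm (ttl b)) 0.
  exists (axis n); first exact: enorm_axis.
  rewrite b0 (enorm_eq0 b0); apply: eq_from_tnth => i.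
  by rewrite tnth_zerov tnth_scalev mul0r.
exists (direction (ttl b)); first exact: enorm_direction.
by rewrite scalev_enorm_direction.
Qed.

Lemma le_Ex_sphere n (f g : @vec R n.+1 -> R) : bmeas f -> bmeas g ->
  (forall x, enorm x = 1 -> f x <= g x) ->
  Ex (uniform_sphere n.+1) f <= Ex (uniform_sphere n.+1) g.
Proof.
move=> hf hg fg.
exact: (@le_Ex_ae _ _ _ (uniform_sphere n.+1) (sphere1 n.+1) _ f g (@measurable_unit n.+1) (@uniform_sphere_unit n) hf hg fg).
Qed.

Lemma edge_ge0 t n (u v : @vec R n) : 0 <= edge t u v.
Proof. exact: ler0n. Qed.

Lemma edge_le1 t n (u v : @vec R n) : edge t u v <= 1.
Proof. by rewrite /edge; case: (t <= _) => //=; exact: ler01. Qed.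

Section triangle_lower.
Variables (m : nat) (tau M : R).
Hypotheses (t0 : 0 <= tau) (tM : tau <= M) (M1 : M < 1).
Local Notation mu := (@uniform_sphere R m.+4).
Local Notation p := (@capP R m.+3 tau).
Local Notation q := (@capP R m.+3 M).
Local Notation F0 := (@capP R m.+2 (tilt tau M)).
Local Notation e0 := (@axis m.+3).

Let t01 : 0 <= tau < 1. Proof. by rewrite t0 (le_lt_trans tM). Qed.
Let M01 : 0 <= M < 1. Proof. by rewrite M1 (le_trans t0). Qed.

(** [tilt tau tau] is [tau / (1 + tau)], which is at most [tau], and caps grow when a dimension is
    removed. *)
Let F1 : p <= @capP R m.+2 (tilt tau tau).
Proof.
apply: (le_trans (capP_dim m.+1 t0)); apply: capP_antitone.
have [_ t1] := andP t01.
have t21 : 0 < 1 - tau ^+ 2 by rewrite subr_gt0 expr_lt1.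
rewrite /tilt ler_pdivrMr// -subr_ge0.
have -> : tau * (1 - tau ^+ 2) - (tau - tau ^+ 2) = tau ^+ 2 * (1 - tau) by ring.
by rewrite mulr_ge0 ?sqr_ge0// subr_ge0 ltW.
Qed.

Lemma codegree_lower1 (b : vec m.+4) : enorm b = 1 -> tau <= thd b ->
  p ^+ 2 <= codegree tau e0 b.
Proof.
move=> b1 tb; have [e e1 be] := tail_direction b.
have [hb hE] := cap_tail_dir_Ex (tilt tau tau) t01 e1.
apply: (@le_trans _ _ (p * capP m.+2 (tilt tau tau))).
  by rewrite expr2 ler_wpM2l// capP_ge0.
rewrite -hE; apply: le_Ex_sphere => //.
  by apply: bmeasM; exact: bmeas_edgel.
move=> c c1; case: (boolP ((tau <= thd c) && _)) => [/andP[h1 h2]|_] /=; last first.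
  by rewrite mulr_ge0// edge_ge0.
rewrite /edge dot_axisl h1 mulr1.
by rewrite (dot_ge_threshold t0 (lexx _) (andP t01).2 b1 c1 tb h1 be h2).
Qed.

(** Split the possible [c] by height: above [M] the horizontal condition is the cap of [tilt tau M],
    between [tau] and [M] that of [tilt tau tau], whose probability is at least [p]. The middle part
    has weight [p - q] and is written as a difference of two caps. *)
Lemma codegree_lower2 (b : vec m.+4) : enorm b = 1 -> M <= thd b ->
  p ^+ 2 + q * (F0 - p) <= codegree tau e0 b.
Proof.
move=> b1 Mb; have [e e1 be] := tail_direction b.
have tb : tau <= thd b := le_trans tM Mb.
have [hb1 hE1] := cap_tail_dir_Ex (tilt tau M) M01 e1.
have [hb2 hE2] := cap_tail_dir_Ex (tilt tau tau) t01 e1.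
have [hb3 hE3] := cap_tail_dir_Ex (tilt tau tau) M01 e1.
apply: (@le_trans _ _ (q * F0 + p * capP m.+2 (tilt tau tau) - q * capP m.+2 (tilt tau tau))).
  have qp : q <= p by exact: capP_antitone.
  have : 0 <= (p - q) * (capP m.+2 (tilt tau tau) - p) by rewrite mulr_ge0 ?subr_ge0.
  by rewrite expr2; lra.
rewrite -hE1 -hE2 -hE3 -(ExD (sphere1 _))// -(ExB (sphere1 _))//; last exact: bmeasD.
apply: le_Ex_sphere.
- by apply: bmeasB => //; exact: bmeasD.
- by apply: bmeasM; exact: bmeas_edgel.
move=> c c1.
have [_ t1] := andP t01.
have E2 : tau <= thd c -> tilt tau tau * enorm (ttl c) <= dot e (ttl c) ->
    edge tau b c * edge tau e0 c = 1.
  move=> h1 h2; rewrite /edge dot_axisl h1 mulr1.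
  by rewrite (dot_ge_threshold t0 (lexx _) t1 b1 c1 tb h1 be h2).
have E1 : M <= thd c -> tilt tau M * enorm (ttl c) <= dot e (ttl c) ->
    edge tau b c * edge tau e0 c = 1.
  move=> h1 h2; rewrite /edge dot_axisl (le_trans tM h1) mulr1.
  by rewrite (dot_ge_threshold t0 tM M1 b1 c1 Mb h1 be h2).
have E0 : 0 <= edge tau b c * edge tau e0 c.
  by rewrite mulr_ge0// edge_ge0.
have [Mc|Mc] := boolP (M <= thd c).
  rewrite (le_trans tM Mc) /= addrK.
  have [k1|_] := boolP (tilt tau M * enorm (ttl c) <= dot e (ttl c)); last exact: E0.
  by rewrite (E1 Mc k1).
rewrite /= add0r subr0; case: (boolP ((tau <= thd c) && _)) => [/andP[h1 h2]|_] /=; last exact: E0.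
by rewrite (E2 h1 h2).
Qed.

(** The gain over independent edges comes from the pairs of neighbors both higher than [M]. For
    [M = tau] the bound is [p ^+ 2 * F0]; a larger [M] serves when [tau] is close to 0. *)
Lemma triangle_prob_lower :
  p ^+ 3 + q ^+ 2 * (F0 - p) <= triangle_prob tau e0.
Proof.
have hc x : bmeas (fun b : vec m.+4 => ((x <= dot e0 b)%R%:R : R)).
  by apply: bmeas_edge.
have Ec x : Ex mu (fun b => ((x <= dot e0 b)%R%:R : R)) = capP m.+3 x.
  by apply: edge_measure_unit; exact: enorm_axis.
apply: (@le_trans _ _ (p ^+ 2 * p + q * (F0 - p) * q)); first by rewrite exprSr; lra.
have -> : p ^+ 2 * p + q * (F0 - p) * q = Ex mu (fun b =>
    p ^+ 2 * (tau <= dot e0 b)%R%:R + q * (F0 - p) * (M <= dot e0 b)%R%:R).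
  rewrite (ExD (sphere1 _)); [|exact: bmeasZ|exact: bmeasZ].
  by rewrite !(ExZ (sphere1 _))// !Ec.
apply: le_Ex_sphere.
- by apply: bmeasD; exact: bmeasZ.
- by apply: bmeasM; [exact: bmeas_edgel|exact: bmeas_codegree].
move=> b b1; rewrite /edge !dot_axisl.
have [Mb|Mb] := boolP (M <= thd b).
  by rewrite (le_trans tM Mb) !mulr1 mul1r codegree_lower2.
have [tb|tb] := boolP (tau <= thd b); last by rewrite !mulr0 mul0r addr0.
by rewrite mulr1 mulr0 addr0 mul1r codegree_lower1.
Qed.

End triangle_lower.

End triangle.

(** * The threshold and the mean of a signed triangle *)

Section threshold.
Context {R : realType}.
Implicit Types (n m : nat) (p : R).

Lemma joint_edge n (t : R) :
  (uniform_sphere n.+2 \x uniform_sphere n.+2)%E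
    [set u : @vec R n.+2 * @vec R n.+2 | t <= dot u.1 u.2] = (capP n.+1 t)%:E.
Proof.
set A := [set u | _].
have mA : measurable A by apply: measurable_le_set => //; exact: measurable_dot.
have hf : bmeas (fun u : @vec R n.+2 * @vec R n.+2 => ((t <= dot u.1 u.2)%R%:R : R)).
  by apply: bmeas_bool.
have h1 := Ex_product (sphere1 n.+2) (sphere1 n.+2) hf.
have Afin : (uniform_sphere n.+2 \x uniform_sphere n.+2)%E A \is a fin_num.
  rewrite ge0_fin_numE// (@le_lt_trans _ _ 1%E) ?ltry//.
  rewrite -(product_setT1 (sphere1 n.+2) (sphere1 n.+2)).
  by apply: le_measure; rewrite ?inE.
rewrite -(fineK Afin); congr EFin.
transitivity (Ex (uniform_sphere n.+2 \x uniform_sphere n.+2)%E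
    (fun u : @vec R n.+2 * @vec R n.+2 => ((t <= dot u.1 u.2)%R%:R : R))).
  by apply/esym/Ex_indic.
rewrite h1 -[RHS](Ex_cst (sphere1 n.+2)).
apply: (@Ex_ae _ _ _ (uniform_sphere n.+2) _ _ _ (@measurable_unit R n.+2) (@uniform_sphere_unit R n.+1)).
- exact: (bmeas_Ex (sphere1 n.+2) (sphere1 n.+2) hf).
- exact: bmeas_cst.
- by move=> x x1; exact: edge_measure_unit.
Qed.

Lemma capP_exists m p : 0 < p <= 2^-1 -> exists2 t : R, 0 <= t < 1 & capP m.+2 t = p.
Proof.
move=> /andP[p0 p1].
have hw := @half_wallis_gt0 R m.
pose v := cosine_prim m 1 - 2 * @half_wallis R m * p.
have v1 : v < cosine_prim m 1 by rewrite ltrBlDr ltrDl !mulr_gt0.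
have v0 : cosine_prim m 0 <= v.
  have : 2 * half_wallis m * p <= half_wallis m.
    by rewrite mulrAC -[leRHS]mul1r ler_pM2r//; lra.
  by rewrite /v {2}/half_wallis; lra.
have [||t t01 tv] := @IVT R (cosine_prim m) 0 1 v ler01.
- by apply: continuous_cosine_prim; exact: ltrN10.
- by rewrite ge_min v0/= le_max (ltW v1) orbT.
have t1 : t < 1.
  move: t01; rewrite in_itv/= => /andP[_]; rewrite le_eqVlt => /orP[/eqP t1|//].
  by move: v1; rewrite -tv t1 ltxx.
have t01' : 0 <= t < 1 by rewrite t1 andbT; move: t01; rewrite in_itv/= => /andP[].
exists t => //; rewrite capP_formula// tv /v.
by field; rewrite gt_eqF.
Qed.

(** [tau] is chosen among the solutions of an equation: the intermediate value theorem provides one,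
    and the strict monotonicity of the cap probability on [[0, 1[] then locates the chosen one. *)
Lemma tau_spec m p : 0 < p <= 2^-1 ->
  0 <= tau p m.+3 < 1 /\ capP m.+2 (tau p m.+3) = p.
Proof.
move=> p01; have [t t01 tp] := capP_exists m p01.
have E : capP m.+2 (tau p m.+3) = p.
  apply: EFin_inj; rewrite -joint_edge.
  apply: (getPex (P := [set t : R | (uniform_sphere m.+3 \x uniform_sphere m.+3)%E
    [set u | (t <= dot u.1 u.2)%R] = p%:E])).
  by exists t => /=; rewrite joint_edge tp.
split => //.
have [p0 p1] := andP p01; have [t0 t1] := andP t01.
have hw := @half_wallis_gt0 R m.
apply/andP; split; last first.
  rewrite ltNge; apply/negP => tau1.
  (* a threshold close to [1] already has a smaller cap *)
  pose s := (t + 1) / 2.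
  have s01 : 0 <= s < 1 by rewrite /s; apply/andP; split; lra.
  have ts : t < s by rewrite /s; lra.
  have : capP m.+2 (tau p m.+3) <= capP m.+2 s.
    by apply: capP_antitone; rewrite (le_trans _ tau1)// ltW; case/andP: s01.
  rewrite E -tp !capP_formula// ler_pM2r ?invr_gt0 ?mulr_gt0// lerD2l lerN2 leNgt.
  by rewrite cosine_prim_strict//; case/andP: s01.
rewrite leNgt; apply/negP => tau0.
(* A negative threshold would give a cap of probability above [1/2]. The minimum keeps [s] below 1,
   where the formula for the cap is available. *)
pose s := Num.min (- tau p m.+3) 2^-1.
have s0 : 0 < s by rewrite lt_min oppr_gt0 tau0 invr_gt0 ltr0n.
have s1 : s < 1 by rewrite gt_min invf_lt1 ?ltr1n// orbT.
have h1 : capP m.+2 (- s) <= p.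
  by rewrite -[leRHS]E; apply: capP_antitone; rewrite lerNr ge_min lexx.
have h2 := capP_opp m.+1 s.
have s01 : 0 <= s < 1 by rewrite (ltW s0).
have h3 : capP m.+2 s < capP m.+2 0.
  rewrite !capP_formula ?lexx ?ltr01// ltr_pM2r ?invr_gt0 ?mulr_gt0// ltrD2l ltrN2.
  by rewrite cosine_prim_strict.
by rewrite capP0 in h3; lra.
Qed.

Lemma one_minus_ge_expR (z : R) : 0 <= z -> z <= 2^-1 -> expR (- (2 * z)) <= 1 - z.
Proof.
move=> z0 z1; have z2 : 0 < 1 - z by lra.
rewrite expRN -[leRHS]invrK lef_pV2 ?posrE ?expR_gt0 ?invr_gt0//.
rewrite -[leLHS]mul1r ler_pdivrMr//.
apply: (@le_trans _ _ ((1 + 2 * z) * (1 - z))); first by nra.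
by rewrite ler_pM2r// expR_ge1Dx.
Qed.

Lemma cosineX_ge_expR (x : R) n : 0 <= x -> x ^+ 2 <= 2^-1 ->
  expR (- (n%:R * x ^+ 2)) <= cosine x ^+ n.
Proof.
move=> x0 x1.
have x11 : x ^+ 2 <= 1 by lra.
have h : expR (- (x ^+ 2)) <= cosine x.
  rewrite -(@ler_pXn2r _ 2) ?nnegrE ?expR_ge0 ?cosine_ge0// sqr_cosine//.
  rewrite -expRM_natl mulr_natl; apply: le_trans (one_minus_ge_expR (sqr_ge0 x) x1).
  by rewrite ler_expR; lra.
by rewrite -mulrN expRM_natl lerXn2r ?nnegrE ?expR_ge0 ?cosine_ge0.
Qed.

Lemma half_wallis_le m : (2 <= m)%N ->
  @half_wallis R m * Num.sqrt m.+4%:R <= 2.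
Proof.
move=> m2; have hw := @half_wallis_gt0 R m.
rewrite -(@ler_pXn2r _ 2) ?nnegrE//; last by rewrite mulr_ge0 ?sqrtr_ge0// ltW.
rewrite exprMn sqr_sqrtr ?ler0n//.
case: m m2 hw => // m m2 hw; have := @half_wallis_ub R m.
have : m.+1.+4%:R <= 2 * m.+2%:R :> R by rewrite -natrM ler_nat; lia.
have := sqr_ge0 (@half_wallis R m.+1).
set W2 := _ ^+ 2; move=> W0 h1 h2.
by apply: (@le_trans _ _ (W2 * (2 * m.+2%:R))); [rewrite ler_wpM2l|lra].
Qed.

(** The last factor is the density of the height at [B], the smallest on [[- B, B]]. For a negative
    [theta] the part below the equator is reflected with [capP_opp]. *)
Lemma capP_gap m (theta tau B : R) : theta <= tau -> - B <= theta -> 0 <= tau -> tau <= B -> B < 1 ->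
  (tau - theta) * (cosine B ^+ m / (2 * @half_wallis R m)) <= capP m.+2 theta - capP m.+2 tau.
Proof.
move=> tht Bth t0 tB B1.
have hw := @half_wallis_gt0 R m.
have key (a b : R) : 0 <= a -> a <= b -> b <= B ->
    (b - a) * (cosine B ^+ m / (2 * @half_wallis R m)) <= capP m.+2 a - capP m.+2 b.
  move=> a0 ab bB.
  have a1 : 0 <= a < 1 by rewrite a0 (le_lt_trans ab)// (le_lt_trans bB).
  have b1 : 0 <= b < 1 by rewrite (le_trans a0)//= (le_lt_trans bB).
  rewrite !capP_formula// -mulrBl mulrA ler_pM2r ?invr_gt0 ?mulr_gt0//.
  apply: (@le_trans _ _ (cosine b ^+ m * (b - a))).
    rewrite mulrC ler_wpM2r ?subr_ge0// lerXn2r ?nnegrE ?cosine_ge0// cosine_antitone//.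
    exact: le_trans ab.
  by apply: (le_trans (cosine_prim_gap m a0 ab)); lra.
have [th0|th0] := leP 0 theta; first exact: key.
have h1 := key 0 tau (lexx _) t0 tB.
have h2 := key 0 (- theta).
have h3 := capP_opp m.+1 (- theta); rewrite opprK in h3.
have h4 := capP0 m.+1 (R := R).
have := h2 (lexx _) _ _; rewrite oppr_ge0 (ltW th0) lerNl Bth => /(_ isT isT) h5.
lra.
Qed.

(** Keep only the heights between [x] and [2 * x], where the density is at least its value at
    [2 * x]. *)
Lemma capP_lower m (x : R) : (2 <= m)%N -> 0 <= x -> 4 * x ^+ 2 <= 2^-1 ->
  x * expR (- (4 * x ^+ 2 * m.+1%:R)) * Num.sqrt m.+4%:R / 4 <= capP m.+3 x.
Proof.
move=> m2 x0 x2.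
have hw := @half_wallis_gt0 R m.+1.
have x1 : x < 1 by rewrite -(@expr_lt1 _ 2)//; lra.
have xx1 : 2 * x <= 1 by rewrite -(@expr_le1 _ 2) ?mulr_ge0// exprMn; lra.
rewrite capP_formula ?x0//.
have h1 : x * expR (- (4 * x ^+ 2 * m.+1%:R)) <= cosine_prim m.+1 1 - cosine_prim m.+1 x.
  have := @cosine_prim_gap R m.+1 x (2 * x) x0; have -> : 2 * x - x = x by ring.
  have h : x <= 2 * x by lra.
  move=> /(_ h) g; apply: (@le_trans _ _ (cosine_prim m.+1 (2 * x) - cosine_prim m.+1 x)).
    apply: le_trans g; rewrite mulrC ler_wpM2r//.
    have := @cosineX_ge_expR (2 * x) m.+1; rewrite exprMn mulr_ge0// (_ : 2 ^+ 2 = 4 :> R); last by ring.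
    by move=> /(_ isT x2); rewrite [_ * (4 * _)]mulrC.
  by rewrite lerD2r cosine_prim_homo// (lt_le_trans (ltrN10 _))// mulr_ge0.
rewrite ler_pdivlMr ?mulr_gt0//.
apply: le_trans h1.
set E := x * _; have E0 : 0 <= E by rewrite mulr_ge0// expR_ge0.
clearbody E.
rewrite -[leRHS]mulr1 -!mulrA ler_wpM2l//.
have := @half_wallis_le m.+1 (leqW m2).
have : @half_wallis R m.+1 * Num.sqrt m.+4%:R <= @half_wallis R m.+1 * Num.sqrt m.+1.+4%:R.
  by rewrite ler_pM2l// ler_wsqrtr// ler_nat.
by lra.
Qed.

(** A Mills ratio, used as a lower bound on the density at [t]. Bounding the integral of
    [cosine ^+ m.+2] by [(1 - t ^+ 2)] times that of [cosine ^+ m] in the Wallis recurrence leaves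
    the factor [m.+3%:R * t ^+ 2 - 1], and the hypothesis absorbs the 1 into half of the first
    term. *)
Lemma cap_mills m (t : R) : 0 <= t < 1 -> 2 <= m.+3%:R * t ^+ 2 ->
  capP m.+2 t * (m.+3%:R * t / 2) <= cosine t ^+ m / (2 * @half_wallis R m).
Proof.
move=> /andP[t0 t1] ht.
have hw := @half_wallis_gt0 R m.
have t21 : t ^+ 2 <= 1 by rewrite expr_le1// ltW.
rewrite capP_formula ?t0// mulrAC ler_pM2r ?invr_gt0 ?mulr_gt0//.
have := @cosine_prim_rec R m t; rewrite t0 ltW// => /(_ isT).
have := @cosine_prim_le2 R m t 1 t0 (ltW t1); rewrite sqr_cosine//.
set I2 := cosine_prim m.+2 1 - _; set I0 := cosine_prim m 1 - _ => h1 h2.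
have I00 : 0 <= I0 by rewrite subr_ge0 cosine_prim_homo ?ltW// (lt_le_trans (ltrN10 _)).
have tp : 0 < t.
  by rewrite lt_neqAle t0 andbT; apply/eqP => t0'; move: ht; rewrite -t0' expr0n/= mulr0; lra.
have m0 : 0 <= m.+3%:R :> R by rewrite ler0n.
have h3 : m.+3%:R * I2 <= m.+3%:R * ((1 - t ^+ 2) * I0) by rewrite ler_wpM2l.
have mE : m.+3%:R = m.+2%:R + 1 :> R by rewrite -[m.+3]addn1 natrD.
have h4 : I0 * (m.+3%:R * t ^+ 2 - 1) <= t * cosine t ^+ m.+2.
  have -> : I0 * (m.+3%:R * t ^+ 2 - 1) = (m.+3%:R - 1) * I0 - m.+3%:R * ((1 - t ^+ 2) * I0) by ring.
  by rewrite mE addrK -mE; lra.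
have h5 : I0 * (m.+3%:R * t ^+ 2 / 2) <= t * cosine t ^+ m.+2.
  by apply: le_trans h4; rewrite ler_wpM2l//; lra.
have h6 : t * cosine t ^+ m.+2 <= t * cosine t ^+ m.
  rewrite ler_pM2l// -[m.+2]addn2 exprD -[leRHS]mulr1 ler_wpM2l ?exprn_ge0 ?cosine_ge0//.
  by rewrite sqr_cosine//; have := sqr_ge0 t; lra.
rewrite -(ler_pM2l tp); apply: le_trans h6; apply: le_trans h5.
by rewrite le_eqVlt; apply/orP; left; apply/eqP; field.
Qed.

Lemma ln_inv_gt0 p : 0 < p <= 2^-1 -> 0 < ln p^-1.
Proof.
move=> /andP[p0 p1]; rewrite ln_gt0// invf_gt1//; lra.
Qed.

Lemma mul_ln_inv_le1 p : 0 < p <= 2^-1 -> p * ln p^-1 <= 1.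
Proof.
move=> /andP[p0 p1].
have h : ln p^-1 < p^-1 by apply: ln_sublinear; rewrite invr_gt0.
by rewrite -[leRHS](@divff _ p) ?gt_eqF// ler_pM2l// ltW.
Qed.

Lemma expR_half_ln p : 0 < p -> expR (- (ln p^-1 / 2)) ^+ 2 = p.
Proof.
move=> p0; rewrite -expRM_natl mulrN mulrC mulfVK ?pnatr_eq0//.
by rewrite expRN lnK ?posrE ?invr_gt0// invrK.
Qed.

(** The two regimes below yield the constants [1 / 512] and [expR (- 36) / 8]; [c0] is below
    both. *)
Let c0 : R := expR (- 36) / 512.

Lemma triangle_lower m p : 0 < p <= 2^-1 -> (28 <= m)%N -> ln p^-1 <= m.+4%:R ->
  c0 * (p ^+ 3 * Num.sqrt (ln p^-1) ^+ 3) / Num.sqrt m.+4%:R <=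
  triangle_prob (tau p m.+4) (@axis R m.+3) - p ^+ 3.
Proof.
move=> p01 m28 LD.
have m2 : (2 <= m)%N by exact: leq_trans m28.
have hm1 : m.+1%:R <= m.+4%:R :> R by rewrite ler_nat -addn3 leq_addr.
have hmm : m%:R <= m.+4%:R :> R by rewrite ler_nat -addn4 leq_addr.
have D32 : 32 <= m.+4%:R :> R by rewrite ler_nat.
have hm : m.+4%:R <= 2 * m.+3%:R :> R by rewrite -natrM ler_nat mul2n -addnn -addn1 leq_add2l.
have [p0 p1] := andP p01.
have [/andP[t0 t1] tp] := tau_spec m.+1 p01.
set t := tau p m.+4 in t0 t1 tp *.
set L := ln p^-1 in LD *.
have L0 : 0 < L by exact: ln_inv_gt0.
set s := Num.sqrt m.+4%:R.
have s2 : s ^+ 2 = m.+4%:R by rewrite sqr_sqrtr// ler0n.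
have D0 : m.+4%:R != 0 :> R by rewrite pnatr_eq0.
have s0 : 0 < s by rewrite sqrtr_gt0 ltr0n.
set l := Num.sqrt L.
have l0 : 0 < l by rewrite sqrtr_gt0.
have l2 : l ^+ 2 = L by rewrite sqr_sqrtr// ltW.
have e36 : expR (- 36) <= 1 :> R by rewrite -[leRHS]expR0 ler_expR oppr_le0.
have e36p : 0 < expR (- 36) :> R by exact: expR_gt0.
have hw := @half_wallis_gt0 R m.
have hW : @half_wallis R m * s <= 2 by exact: half_wallis_le.
have [ht|ht] := leP (2 / s) t.
(* Far from the median, take [M = t]. The gap [t - tilt t t] is of order [t ^+ 2] and the density of
   order [p * d * t], so the gain is of order [p ^+ 3 * t ^+ 3 * d]. *)
- have tD : 4 <= m.+4%:R * t ^+ 2.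
    have : (2 / s) ^+ 2 <= t ^+ 2 by rewrite ler_pXn2r ?nnegrE// divr_ge0// ltW.
    by rewrite expr_div_n s2 ler_pdivrMr ?ltr0n// mulrC; lra.
  have h0 := triangle_prob_lower m t0 (lexx t) t1.
  rewrite tp in h0.
  have t21 : t ^+ 2 < 1 by rewrite expr_lt1.
  have tp0 : 0 < t by apply: lt_le_trans ht; rewrite divr_gt0.
  have tiltE : tilt t t = t / (1 + t).
    by rewrite /tilt; field; apply/andP; split; rewrite gt_eqF//; lra.
  have tlt : tilt t t <= t.
    by rewrite tiltE ler_pdivrMr; [have := sqr_ge0 t; lra|lra].
  have tge : - t <= tilt t t.
    by rewrite tiltE (@le_trans _ _ 0)// ?oppr_le0// divr_ge0//; lra.
  have h1 := capP_gap m tlt tge t0 (lexx t) t1.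
  have m3 : m.+4%:R = m.+3%:R + 1 :> R by rewrite -[m.+4]addn1 natrD.
  have t01 : 0 <= t < 1 by rewrite t0.
  have h2 := cap_mills t01; have h2' : 2 <= m.+3%:R * t ^+ 2 by rewrite m3 in tD; nra.
  have {}h2 := h2 m h2'.
  have h3 : p <= capP m.+2 t by rewrite -tp; exact: capP_dim.
  have h4 : p * t ^+ 3 * m.+4%:R / 8 <= capP m.+2 (tilt t t) - p.
    set F := capP m.+2 (tilt t t) in h1 *; set q := capP m.+2 t in h1 h2 h3 *.
    set cc := cosine t ^+ m / _ in h1 h2.
    have g1 : t - tilt t t = t ^+ 2 / (1 + t) by rewrite tiltE; field; apply/eqP => h; lra.
    have g2 : t ^+ 2 / 2 <= t - tilt t t.
      rewrite g1 ler_pM2l; last by rewrite exprn_gt0.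
      by rewrite lef_pV2 ?posrE//; lra.
    have g3 : 0 <= cc by rewrite divr_ge0 ?exprn_ge0 ?cosine_ge0// mulr_ge0// ltW.
    have g4 : t ^+ 2 / 2 * cc <= F - q by apply: le_trans h1; rewrite ler_wpM2r.
    have g5 : p * (m.+3%:R * t / 2) <= cc.
      apply: le_trans h2; rewrite ler_wpM2r//.
      by rewrite divr_ge0// mulr_ge0// ler0n.
    have g6 : t ^+ 2 / 2 * (p * (m.+3%:R * t / 2)) <= t ^+ 2 / 2 * cc.
      by rewrite ler_wpM2l// divr_ge0// sqr_ge0.
    have g7 : p * t ^+ 3 * m.+4%:R / 8 <= t ^+ 2 / 2 * (p * (m.+3%:R * t / 2)).
      have -> : t ^+ 2 / 2 * (p * (m.+3%:R * t / 2)) = p * t ^+ 3 * (2 * m.+3%:R) / 8 by field.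
      have hx : 0 <= p * t ^+ 3 by rewrite mulr_ge0 ?exprn_ge0// ltW.
      by rewrite ler_pM2r//; exact: (ler_wpM2l hx hm).
    lra.
  have h5 : p ^+ 3 * t ^+ 3 * m.+4%:R / 8 <= triangle_prob t (axis m.+3) - p ^+ 3.
    have : p ^+ 2 * (p * t ^+ 3 * m.+4%:R / 8) <= p ^+ 2 * (capP m.+2 (tilt t t) - p).
      by rewrite ler_wpM2l// sqr_ge0.
    by lra.
  apply: le_trans h5.
  (* [t] is at least of order [sqrt (L / d)] *)
  have ht2 : l / (4 * s) <= t.
    pose e := expR (- (L / 2)).
    have e0 : 0 < e by exact: expR_gt0.
    have e2 : e ^+ 2 = p by exact: expR_half_ln.
    pose x := l / (4 * s).
    have x0 : 0 <= x by rewrite divr_ge0// ?mulr_ge0// ltW.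
    have x2 : x ^+ 2 = L / (16 * m.+4%:R) by rewrite expr_div_n exprMn s2 l2; congr (_ / (_ * _)); ring.
    have x2' : 4 * x ^+ 2 * m.+4%:R = L / 4 by rewrite x2; move: D0; set D := m.+4%:R; clearbody D; move=> D0; field.
    have x2'' : 4 * x ^+ 2 <= 2^-1.
      by rewrite -(@ler_pM2r _ m.+4%:R) ?ltr0n// x2'; lra.
    have := capP_lower m2 x0 x2''.
    rewrite -/s => h6.
    have h7 : x * e * s / 4 <= capP m.+3 x.
      apply: le_trans h6; rewrite ler_pM2r// ler_pM2r// ler_wpM2l// /e ler_expR lerN2.
      apply: (@le_trans _ _ (L / 4)); last by lra.
      by rewrite -x2'; apply: ler_wpM2l => //; rewrite mulr_ge0// sqr_ge0.
    rewrite -/x leNgt; apply/negP => tx.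
    have h8 : capP m.+3 x <= p by rewrite -tp; apply: capP_antitone; exact: ltW.
    have h9 : x * e * s / 4 = l / 16 * e by rewrite /x; field; rewrite gt_eqF.
    have h10 : l / 16 <= e.
      by rewrite -(ler_pM2r e0) -[e * e]expr2 e2; lra.
    (* [p L <= 1] reads [e l <= 1], so that [l <= 16 e] forces [l <= 4] *)
    have h11 : e * l <= 1.
      rewrite -(@expr_le1 _ 2)//; last by rewrite mulr_ge0// ltW.
      by rewrite exprMn e2 l2; exact: mul_ln_inv_le1.
    have h12 : l / 16 * l <= 1 by apply: le_trans h11; rewrite ler_pM2r.
    have h13 : x < 2 / s.
      rewrite /x invfM mulrA ltr_pM2r ?invr_gt0// ltr_pdivrMr//.
      by rewrite ltNge; apply/negP => l8; nra.
    by lra.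
  have h6 : (l / (4 * s)) ^+ 3 <= t ^+ 3.
    by rewrite lerXn2r ?nnegrE// divr_ge0 ?mulr_ge0// ltW.
  have h7 : p ^+ 3 * (l / (4 * s)) ^+ 3 * m.+4%:R / 8 <= p ^+ 3 * t ^+ 3 * m.+4%:R / 8.
    by rewrite ler_pM2r// ler_wpM2r ?ler0n// ler_wpM2l// exprn_ge0// ltW.
  apply: le_trans h7.
  have -> : p ^+ 3 * (l / (4 * s)) ^+ 3 * m.+4%:R / 8 = 512^-1 * (p ^+ 3 * l ^+ 3) / s.
    by rewrite -s2; field; rewrite gt_eqF.
  rewrite ler_pM2r ?invr_gt0// ler_pM2r ?mulr_gt0 ?exprn_gt0// /c0.
  by move: e36; set E := expR (- 36); clearbody E; lra.
(* Near the median, [M] is a constant number of standard deviations: its cap has constant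
   probability, the gap is of order [1 / d] and the density of order [sqrt d]. The gain [1 / sqrt d]
   is enough because [p ^+ 3 * l ^+ 3 <= 1]. *)
pose M := 2 / s.
have M0 : 0 <= M by rewrite divr_ge0// ltW.
have M2 : M ^+ 2 = 4 / m.+4%:R by rewrite expr_div_n s2; congr (_ / _); ring.
have M2' : M ^+ 2 <= 8^-1.
  rewrite M2 ler_pdivrMr ?ltr0n//; lra.
have M1 : M < 1 by rewrite -(@expr_lt1 _ 2)//; lra.
have h0 := triangle_prob_lower m t0 (ltW ht) M1.
rewrite tp -/M in h0.
have Ms : M * s = 2 by rewrite mulfVK// gt_eqF.
have hq : expR (- 16) / 2 <= capP m.+3 M.
  have h4 : 4 * M ^+ 2 <= 2^-1 by lra.
  apply: le_trans (capP_lower m2 M0 h4); rewrite -/s.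
  have -> : M * expR (- (4 * M ^+ 2 * m.+1%:R)) * s / 4 = expR (- (4 * M ^+ 2 * m.+1%:R)) / 2.
    by set E := expR _; rewrite (_ : M * E * s / 4 = (M * s) * E / 4); [rewrite Ms; field|ring].
  rewrite ler_pM2r// ler_expR lerN2 M2.
  have -> : 4 * (4 / m.+4%:R) * m.+1%:R = 16 * (m.+1%:R / m.+4%:R) :> R by move: D0; set D := m.+4%:R; clearbody D; move=> D0; field.
  by rewrite -[leRHS]mulr1 ler_pM2l// ler_pdivrMr ?ltr0n// mul1r.
have h3 : p <= capP m.+2 t by rewrite -tp; exact: capP_dim.
have t12 : t <= 2^-1.
  have g : t ^+ 2 <= M ^+ 2 by rewrite lerXn2r ?nnegrE// ltW.
  by rewrite -(@ler_pXn2r _ 2) ?nnegrE ?invr_ge0//; lra.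
have M21 : 0 < 1 - M ^+ 2 by lra.
have tE : t - tilt t M = M ^+ 2 * (1 - t) / (1 - M ^+ 2).
  by rewrite /tilt; field; rewrite gt_eqF.
have hg : M ^+ 2 / 2 <= t - tilt t M.
  by rewrite tE ler_pdivlMr//; have := sqr_ge0 M; nra.
have tlt : tilt t M <= t by have := sqr_ge0 M; lra.
have tge : - M <= tilt t M.
  by rewrite /tilt ler_pdivlMr//; have := sqr_ge0 M; nra.
have h1 := capP_gap m tlt tge t0 (ltW ht) M1.
have hc : expR (- 4) * s / 4 <= cosine M ^+ m / (2 * @half_wallis R m).
  have g1 : expR (- 4) <= cosine M ^+ m.
    have M22 : M ^+ 2 <= 2^-1 by lra.
    apply: le_trans (cosineX_ge_expR m M0 M22); rewrite ler_expR lerN2 M2 mulrCA.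
    by rewrite -[leRHS]mulr1 ler_pM2l// ler_pdivrMr ?ltr0n// mul1r.
  have g2 : s / 4 <= (2 * @half_wallis R m)^-1.
    by rewrite -[leRHS]mul1r ler_pdivlMr ?mulr_gt0//; lra.
  have g3 : 0 <= s / 4 by rewrite divr_ge0// ltW.
  by rewrite -mulrA; exact: (ler_pM (expR_ge0 _) g3 g1 g2).
have hF : expR (- 4) / (2 * s) <= capP m.+2 (tilt t M) - p.
  have g0 : 0 <= expR (- 4) * s / 4 by rewrite !mulr_ge0 ?expR_ge0// ltW.
  have g1 : M ^+ 2 / 2 * (expR (- 4) * s / 4) <=
      (t - tilt t M) * (cosine M ^+ m / (2 * @half_wallis R m)).
    by apply: ler_pM => //; rewrite divr_ge0// sqr_ge0.
  have g2 : expR (- 4) / (2 * s) = M ^+ 2 / 2 * (expR (- 4) * s / 4).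
    by rewrite M2 -s2; field; rewrite gt_eqF.
  lra.
have hp : p ^+ 3 * l ^+ 3 <= 1.
  rewrite -exprMn exprn_ile1//; first by rewrite mulr_ge0// ltW.
  rewrite -(@expr_le1 _ 2)//; last by rewrite mulr_ge0// ltW.
  rewrite exprMn l2 expr2 -mulrA.
  have := mul_ln_inv_le1 p01; rewrite -/L => g.
  by rewrite -[leRHS]mulr1; apply: ler_pM => //; [exact: ltW|rewrite mulr_ge0// ltW|lra].
have hT : (expR (- 16) / 2) ^+ 2 * (expR (- 4) / (2 * s)) <=
    triangle_prob t (axis m.+3) - p ^+ 3.
  have g1 : (expR (- 16) / 2) ^+ 2 * (expR (- 4) / (2 * s)) <=
     capP m.+3 M ^+ 2 * (capP m.+2 (tilt t M) - p).
    have a2 : 0 <= expR (- 4) / (2 * s) by rewrite divr_ge0 ?expR_ge0// mulr_ge0// ltW.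
    have a3 : (expR (- 16) / 2) ^+ 2 <= capP m.+3 M ^+ 2.
      by rewrite lerXn2r ?nnegrE ?divr_ge0 ?expR_ge0// capP_ge0.
    exact: (ler_pM (sqr_ge0 _) a2 a3 hF).
  lra.
apply: le_trans hT.
have -> : (expR (- 16) / 2) ^+ 2 * (expR (- 4) / (2 * s)) = expR (- 36) / 8 / s.
  have -> : expR (- 36) = expR (- 16) ^+ 2 * expR (- 4) :> R.
    by rewrite -expRM_natl -expRD; congr expR; ring.
  by field; rewrite gt_eqF.
rewrite ler_pM2r ?invr_gt0// /c0.
move: hp e36p; set X := _ * l ^+ 3; set E := expR (- 36).
by clearbody X E; nra.
Qed.

End threshold.

(** * Sub-Gaussian linear and quadratic forms *)

Section gaussian.
Context {R : realType}.
Implicit Types (t s v b : R).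

(** Completing the square turns the integrand into a multiple of the normal density of mean
    [t / (1 - b)] and variance [1 / (1 - b)]. *)
Lemma gaussian_integral b t : b < 1 ->
  (\int[@lebesgue_measure R]_x (expR (b * x ^+ 2 / 2 + t * x) * normal_pdf 0 1 x)%:E)%E =
  ((Num.sqrt (1 - b))^-1 * expR (t ^+ 2 / (2 * (1 - b))))%:E.
Proof.
move=> b1; have c0 : 0 < 1 - b by rewrite subr_gt0.
pose sg := (Num.sqrt (1 - b))^-1.
have r0 : 0 < Num.sqrt (1 - b) by rewrite sqrtr_gt0.
have sg0 : 0 < sg by rewrite invr_gt0.
have sg2 : sg ^+ 2 = (1 - b)^-1 by rewrite exprVn sqr_sqrtr// ltW.
pose K := sg * expR (t ^+ 2 / (2 * (1 - b))).
have K0 : 0 <= K by rewrite mulr_ge0 ?expR_ge0// ltW.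
transitivity (\int[@lebesgue_measure R]_x (K%:E * (normal_pdf (t / (1 - b)) sg x)%:E))%E.
  apply: eq_integral => x _; rewrite -EFinM; congr EFin.
  rewrite !normal_pdfE ?oner_eq0 ?gt_eqF//.
  have pk : normal_peak sg = sg^-1 * normal_peak 1.
    rewrite /normal_peak expr1n mul1r -(mulrnAr (sg ^+ 2)) sqrtrM ?sqr_ge0//.
    by rewrite sqrtr_sqr ger0_norm ?invfM// ltW.
  have hE : expR (b * x ^+ 2 / 2 + t * x) * normal_fun 0 1 x =
      expR (t ^+ 2 / (2 * (1 - b))) * normal_fun (t / (1 - b)) sg x.
    rewrite /normal_fun -!expRD; congr expR; rewrite sg2 expr1n -[1 *+ 2]mulr_natl -[_^-1 *+ 2]mulr_natl.
    by field; rewrite gt_eqF.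
  rewrite pk /K mulrCA hE.
  by field; rewrite gt_eqF.
rewrite ge0_integralZl//=; last 2 first.
- by apply/measurable_EFinP; exact: measurable_normal_pdf.
- by move=> x _; rewrite lee_fin normal_pdf_ge0.
by rewrite integral_normal_pdf mule1.
Qed.

Lemma measurable_exp_quad b t :
  measurable_fun setT (fun x : R => (expR (b * x ^+ 2 / 2 + t * x) * normal_pdf 0 1 x)%:E).
Proof.
apply/measurable_EFinP; apply: measurable_funM; last exact: measurable_normal_pdf.
apply: measurableT_comp => //; apply: measurable_funD.
  by apply: measurable_funM => //; apply: measurable_funM => //; exact: measurable_funX.
exact: measurable_funM.
Qed.

(* Linearize the square with an independent Gaussian variable. *)
Lemma subgaussian_square (w y : bool -> R) v (a s : R) :
  (forall c, 0 <= w c) -> 0 <= v -> 0 <= a -> 2 * a * v < 1 ->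
  (forall t, \sum_(c : bool) w c * expR (t * y c) <= expR (v * t ^+ 2 / 2)) ->
  \sum_(c : bool) w c * expR (a * y c ^+ 2 + s * y c) <=
  (Num.sqrt (1 - 2 * a * v))^-1 * expR (v * s ^+ 2 / (2 * (1 - 2 * a * v))).
Proof.
move=> w0 v0 a0 av hy.
pose k := Num.sqrt (2 * a).
have k2 : k ^+ 2 = 2 * a by rewrite sqr_sqrtr// mulr_ge0.
have phi0 (x : R) : 0 <= normal_pdf 0 1 x by exact: normal_pdf_ge0.
have e1 c : (\int[@lebesgue_measure R]_x (w c * expR (s * y c) * (expR (0 * x ^+ 2 / 2 + k * y c * x) * normal_pdf 0 1 x))%:E)%E
    = (w c * expR (a * y c ^+ 2 + s * y c))%:E.
  under eq_integral do rewrite EFinM.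
  rewrite ge0_integralZl//; last 3 first.
  - exact: measurable_exp_quad.
  - by move=> x _; rewrite lee_fin mulr_ge0// expR_ge0.
  - by rewrite lee_fin mulr_ge0// expR_ge0.
  rewrite gaussian_integral// subr0 sqrtr1 invr1 mul1r mulr1 -EFinM -mulrA -expRD.
  by congr (_ * expR _)%:E; rewrite exprMn k2; field.
have e2 : (\int[@lebesgue_measure R]_x (expR (v * s ^+ 2 / 2) *
    (expR ((2 * a * v) * x ^+ 2 / 2 + v * k * s * x) * normal_pdf 0 1 x))%:E)%E =
    ((Num.sqrt (1 - 2 * a * v))^-1 * expR (v * s ^+ 2 / (2 * (1 - 2 * a * v))))%:E.
  under eq_integral do rewrite EFinM.
  rewrite ge0_integralZl//; last 2 first.
  - exact: measurable_exp_quad.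
  - by move=> x _; rewrite lee_fin mulr_ge0// expR_ge0.
  rewrite gaussian_integral// -EFinM mulrCA -expRD; congr (_ * expR _)%:E.
  rewrite !exprMn k2; field.
  by rewrite subr_eq0 gt_eqF.
rewrite -lee_fin -e2 big_bool/= EFinD -!e1 -ge0_integralD//; last 4 first.
- by move=> x _; rewrite lee_fin !mulr_ge0// expR_ge0.
- by under eq_fun do rewrite EFinM; apply: measurable_funeM; exact: measurable_exp_quad.
- by move=> x _; rewrite lee_fin !mulr_ge0// expR_ge0.
- by under eq_fun do rewrite EFinM; apply: measurable_funeM; exact: measurable_exp_quad.
apply: ge0_le_integral => //.
- by move=> x _; rewrite -EFinD lee_fin addr_ge0// !mulr_ge0// expR_ge0.
- by apply: emeasurable_funD; under eq_fun do rewrite EFinM; apply: measurable_funeM; exact: measurable_exp_quad.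
- by under eq_fun do rewrite EFinM; apply: measurable_funeM; exact: measurable_exp_quad.
move=> x _; rewrite -EFinD lee_fin !mul0r !add0r.
have := hy (k * x + s); rewrite big_bool/= => h.
have E c : w c * expR (s * y c) * (expR (k * y c * x) * normal_pdf 0 1 x) =
  w c * expR ((k * x + s) * y c) * normal_pdf 0 1 x.
  rewrite !mulrA; congr (_ * _); rewrite -!mulrA -expRD; congr (_ * expR _); ring.
rewrite !E -mulrDl mulrA; apply: ler_wpM2r => //.
apply: (le_trans h); rewrite -expRD ler_expR le_eqVlt; apply/orP; left; apply/eqP.
have -> : v * (k * x + s) ^+ 2 / 2 = v * s ^+ 2 / 2 + (k ^+ 2 * v * x ^+ 2 / 2 + v * k * s * x) by field.
by rewrite k2.
Qed.

End gaussian.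

(** * Quadratic forms under product laws on Boolean functions *)

Section product_law.
Context {R : realType} {I : finType}.
Variable w : I -> bool -> R.
Hypotheses (w0 : forall e c, 0 <= w e c) (w1 : forall e, \sum_(c : bool) w e c = 1).
Implicit Types (om : {ffun I -> bool}) (D : {set I}).

Definition Pw om : R := \prod_e w e (om e).

Lemma Pw_ge0 om : 0 <= Pw om.
Proof. by apply: prodr_ge0. Qed.

Lemma Pw_sum1 : \sum_om Pw om = 1.
Proof.
rewrite /Pw -(bigA_distr_bigA (fun e c => w e c)) big1// => e _; exact: w1.
Qed.

Definition Ew (f : {ffun I -> bool} -> R) : R := \sum_om Pw om * f om.

Lemma Ew_cst c : Ew (fun=> c) = c.
Proof. by rewrite /Ew -mulr_suml Pw_sum1 mul1r. Qed.

Lemma Ew_le f g : (forall om, f om <= g om) -> Ew f <= Ew g.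
Proof. by move=> fg; apply: ler_sum => om _; rewrite ler_wpM2l// Pw_ge0. Qed.

Lemma Ew_ge0 f : (forall om, 0 <= f om) -> 0 <= Ew f.
Proof. by move=> f0; apply: sumr_ge0 => om _; rewrite mulr_ge0// Pw_ge0. Qed.

Lemma EwZ c f : Ew (fun om => c * f om) = c * Ew f.
Proof. by rewrite /Ew mulr_sumr; apply: eq_bigr => om _; rewrite mulrCA. Qed.

Lemma EwD f g : Ew (fun om => f om + g om) = Ew f + Ew g.
Proof. by rewrite /Ew -big_split; apply: eq_bigr => om _; rewrite mulrDr. Qed.

Lemma Ew_sum (J : finType) (P : pred J) (f : J -> {ffun I -> bool} -> R) :
  Ew (fun om => \sum_(j | P j) f j om) = \sum_(j | P j) Ew (f j).
Proof. by rewrite /Ew exchange_big; apply: eq_bigr => om _; rewrite mulr_sumr. Qed.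

Lemma eq_Ew f g : f =1 g -> Ew f = Ew g.
Proof. by move=> fg; apply: eq_bigr => om _; rewrite fg. Qed.

Definition mrg D om' om : {ffun I -> bool} := [ffun e => if e \in D then om' e else om e].

(** Exchanging the coordinates in [D] of two independent copies preserves their joint law. The inner
    expectation plays the part of the conditional expectation given the coordinates outside [D]. *)
Lemma Ew_merge D f : Ew f = Ew (fun om => Ew (fun om' => f (mrg D om' om))).
Proof.
pose h (u : {ffun I -> bool} * {ffun I -> bool}) := (mrg D u.2 u.1, mrg D u.1 u.2).
have hK : involutive h.
  move=> [a b]; rewrite /h/=; congr pair; apply/ffunP => e; by rewrite !ffunE; case: (e \in D).
transitivity (\sum_(u : {ffun I -> bool} * {ffun I -> bool}) Pw u.1 * Pw u.2 * f u.1).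
  rewrite -(pair_big xpredT xpredT (fun a b => Pw a * Pw b * f a))/=.
  apply: eq_bigr => a _; under eq_bigr do rewrite mulrAC.
  by rewrite -mulr_sumr Pw_sum1 mulr1.
rewrite (reindex_inj (inv_inj hK))/=.
transitivity (\sum_(u : {ffun I -> bool} * {ffun I -> bool}) Pw u.1 * Pw u.2 * f (mrg D u.2 u.1)).
  apply: eq_bigr => u _; congr (_ * _); rewrite /Pw -!big_split/=.
  by apply: eq_bigr => e _; rewrite !ffunE; case: (e \in D) => //; rewrite mulrC.
rewrite -(pair_big xpredT xpredT (fun a b => Pw a * Pw b * f (mrg D b a)))/=.
by apply: eq_bigr => a _; rewrite /Ew mulr_sumr; apply: eq_bigr => b _; rewrite mulrA.
Qed.

Lemma Ew_prod (f : I -> bool -> R) :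
  Ew (fun om => \prod_e f e (om e)) = \prod_e \sum_(c : bool) w e c * f e c.
Proof.
rewrite /Ew bigA_distr_bigA; apply: eq_bigr => om _.
by rewrite /Pw -big_split.
Qed.

Lemma Ew_merge1 e0 f : Ew f =
  Ew (fun om => \sum_(c : bool) w e0 c * f [ffun e => if e == e0 then c else om e]).
Proof.
rewrite (Ew_merge [set e0] f); apply: eq_Ew => om.
pose g c := f [ffun e => if e == e0 then c else om e].
transitivity (Ew (fun om' => g (om' e0))).
  apply: eq_Ew => om'; congr f; apply/ffunP => e; rewrite !ffunE inE.
  by case: eqP => [->|].
have gE om' : g (om' e0) = \sum_(c : bool) g c * \prod_e (if e == e0 then (om' e == c)%:R else 1 : R).
  rewrite (bigD1 (om' e0))//= [X in _ + X]big1 ?addr0; last first.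
    move=> c cn; rewrite (bigD1 e0)//= eqxx.
    by rewrite (_ : (om' e0 == c) = false) ?mul0r ?mulr0// eq_sym; exact/negbTE.
  rewrite (bigD1 e0)//= !eqxx mul1r big1 ?mulr1// => e /negbTE ->//.
rewrite (eq_Ew gE) (Ew_sum xpredT); apply: eq_bigr => c _.
rewrite EwZ (Ew_prod (fun e b => if e == e0 then (b == c)%:R else 1)) mulrC; congr (_ * _).
rewrite (bigD1 e0)//= eqxx [X in _ * X]big1 ?mulr1; last first.
  by move=> e /negbTE ->; under eq_bigr do rewrite mulr1; exact: w1.
rewrite (bigD1 c)//= eqxx mulr1 big1 ?addr0// => b /negbTE ->; by rewrite mulr0.
Qed.

Lemma subgaussian_linear (y : I -> bool -> R) (v : R) D (c : I -> R) :
  (forall e t, e \in D -> \sum_(b : bool) w e b * expR (t * y e b) <= expR (v * t ^+ 2 / 2)) ->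
  Ew (fun om => expR (\sum_(e in D) c e * y e (om e))) <= expR (v * (\sum_(e in D) c e ^+ 2) / 2).
Proof.
move=> hy.
rewrite (_ : Ew _ = Ew (fun om => \prod_e (if e \in D then expR (c e * y e (om e)) else 1))); last first.
  by apply: eq_Ew => om; rewrite expR_sum -big_mkcond.
rewrite (Ew_prod (fun e b => if e \in D then expR (c e * y e b) else 1)).
rewrite mulr_sumr mulr_suml expR_sum [leRHS]big_mkcond/=.
apply: ler_prod => e _; case: ifPn => eD; last first.
  by under eq_bigr do rewrite mulr1; rewrite w1 ler01 lexx.
rewrite hy// andbT; apply: sumr_ge0 => b _; by rewrite mulr_ge0// expR_ge0.
Qed.

Section quadratic_form.
Implicit Types (B : I -> I -> R) (u : I -> R).

Definition qform D B u : R := \sum_(e in D) \sum_(f in D) B e f * u e * u f.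

Definition lform D (b : I -> R) u : R := \sum_(e in D) b e * u e.

Lemma qform_split D B u e0 : (forall e f, B e f = B f e) -> e0 \in D ->
  qform D B u = B e0 e0 * u e0 ^+ 2 + 2 * u e0 * lform (D :\ e0) (B e0) u
    + qform (D :\ e0) B u.
Proof.
move=> symB e0D; rewrite /qform (big_setD1 e0)//= (big_setD1 e0)//=.
have -> : \sum_(e in D :\ e0) \sum_(f in D) B e f * u e * u f =
  \sum_(e in D :\ e0) (B e0 e * u e * u e0) + qform (D :\ e0) B u.
  rewrite /qform -big_split/=; apply: eq_bigr => e _.
  by rewrite (big_setD1 e0)//= [B e e0]symB; ring.
rewrite -mulr_suml -/(lform _ _ _).
have -> : \sum_(f in D :\ e0) B e0 f * u e0 * u f = u e0 * lform (D :\ e0) (B e0) u.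
  by rewrite /lform mulr_sumr; apply: eq_bigr => f _; ring.
by rewrite /qform; ring.
Qed.

Lemma qform_rank1 D B (b : I -> R) k u :
  qform D (fun e f => B e f + k * (b e * b f)) u = qform D B u + k * lform D b u ^+ 2.
Proof.
rewrite expr2 /lform big_distrlr mulr_sumr /qform -big_split/=.
apply: eq_bigr => e _; rewrite mulr_sumr -big_split/=.
by apply: eq_bigr => f _; ring.
Qed.

Definition upd1 u e0 t : I -> R := fun e => if e == e0 then t else u e.

Lemma qform_upd1 D B u e0 t : qform (D :\ e0) B (upd1 u e0 t) = qform (D :\ e0) B u.
Proof.
apply: eq_bigr => e; rewrite !inE => /andP[/negbTE ee _].
apply: eq_bigr => f; rewrite !inE => /andP[/negbTE fe _].
by rewrite /upd1 ee fe.
Qed.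

Lemma lform_upd1 D b u e0 t : lform (D :\ e0) b (upd1 u e0 t) = lform (D :\ e0) b u.
Proof.
apply: eq_bigr => e; rewrite !inE => /andP[/negbTE ee _].
by rewrite /upd1 ee.
Qed.

Lemma sqr_sum_upd1 D u e0 t : e0 \in D ->
  \sum_(e in D) upd1 u e0 t e ^+ 2 = t ^+ 2 + \sum_(e in D :\ e0) u e ^+ 2.
Proof.
move=> e0D; rewrite (big_setD1 e0)//= /upd1 eqxx; congr (_ + _).
by apply: eq_bigr => e; rewrite !inE => /andP[/negbTE -> _].
Qed.

(** The constant [2 / 3] leaves [1 / 3] for the change of trace in [subgaussian_quadratic]; together
    they make exactly one diagonal entry. *)
Lemma inv_sqrt_le_expR (x : R) : 0 <= x -> x <= 4^-1 ->
  (Num.sqrt (1 - x))^-1 <= expR (2 / 3 * x).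
Proof.
move=> x0 x1; have h : 0 < 1 - x by lra.
have h' : 0 <= 1 - x by exact: ltW.
rewrite -[leRHS]invrK lef_pV2 ?posrE ?invr_gt0 ?expR_gt0 ?sqrtr_gt0//.
rewrite -(@ler_pXn2r _ 2) ?nnegrE ?invr_ge0 ?expR_ge0 ?sqrtr_ge0// sqr_sqrtr//.
rewrite exprVn -[leLHS]mul1r ler_pdivrMr ?exprn_gt0 ?expR_gt0// -expRM_natl.
apply: (@le_trans _ _ ((1 - x) * (1 + 2 * (2 / 3 * x)))); first by nra.
by rewrite ler_pM2l// expR_ge1Dx.
Qed.

(* One coordinate is integrated out at a time: the form left on the others is
   a Schur complement, which keeps the bound [M], and the trace absorbs the
   normalizing factor. *)
Lemma subgaussian_quadratic (y : I -> bool -> R) (v a M : R) D B :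
  0 <= v -> 0 <= a -> 0 < M -> 8 * a * v * M <= 1 ->
  (forall e t, \sum_(b : bool) w e b * expR (t * y e b) <= expR (v * t ^+ 2 / 2)) ->
  (forall e f, B e f = B f e) ->
  (forall u, 0 <= qform D B u) ->
  (forall u, qform D B u <= M * \sum_(e in D) u e ^+ 2) ->
  Ew (fun om => expR (a * qform D B (fun e => y e (om e)))) <=
  expR (2 * a * v * \sum_(e in D) B e e).
Proof.
move=> v0 a0 M0 aM hy; have [k] := ubnP #|D|; elim: k D B => // k IH D B.
rewrite ltnS => Dk symB psd ub.
have [D0|[e0 e0D]] := set_0Vmem D.
  rewrite /qform D0; under eq_Ew do rewrite big_set0 mulr0 expR0.
  by rewrite Ew_cst big_set0 mulr0 expR0.
pose D' := D :\ e0.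
have D'k : (#|D'| < k)%N by move: Dk; rewrite (cardsD1 e0 D) e0D.
pose b := B e0; pose b00 := B e0 e0.
have b00_ge0 : 0 <= b00.
  have := psd (upd1 (fun=> 0) e0 1); rewrite (qform_split _ symB e0D) qform_upd1 lform_upd1.
  rewrite /upd1 eqxx expr1n mulr1 /lform big1 ?mulr0 ?addr0; last by move=> e _; rewrite mulr0.
  by rewrite /qform big1 ?addr0// => e _; rewrite big1// => f _; rewrite mulr0.
have b00_leM : b00 <= M.
  have := ub (upd1 (fun=> 0) e0 1); rewrite (sqr_sum_upd1 _ _ e0D) (qform_split _ symB e0D) qform_upd1 lform_upd1.
  rewrite /upd1 eqxx expr1n mulr1 /lform big1 ?mulr0 ?addr0; last by move=> e _; rewrite mulr0.
  rewrite /qform big1 ?addr0; last by move=> e _; rewrite big1// => f _; rewrite mulr0.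
  by rewrite [X in _ + X]big1 ?addr0 ?mulr1// => e _; rewrite expr0n.
pose bb := \sum_(e in D') b e ^+ 2.
(* A diagonal entry of [B ^ 2 <= M * B]: test positivity on the vector with entry [- M] at [e0] and
   [b] elsewhere, and the upper bound on the one with entry 0 at [e0]. *)
have bbM : bb <= M * b00.
  have h1 := psd (upd1 b e0 (- M)); have h2 := ub (upd1 b e0 0).
  rewrite (qform_split _ symB e0D) qform_upd1 lform_upd1 /upd1 eqxx in h1.
  rewrite (sqr_sum_upd1 _ _ e0D) (qform_split _ symB e0D) qform_upd1 lform_upd1 /upd1 eqxx in h2.
  have lb : lform D' b b = bb by apply: eq_bigr => e _; rewrite expr2.
  rewrite -/D' -/b lb -/b00 in h1; rewrite -/D' -/b -/bb lb in h2.
  rewrite expr0n/= !mulr0 !mul0r !add0r in h2.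
  have : M * bb <= M * (M * b00) by rewrite sqrrN -[b e0]/b00 in h1; lra.
  by rewrite ler_pM2l.
have av0 : 0 <= a * v by rewrite mulr_ge0.
have den : 0 < 1 - 2 * a * v * b00.
  have : 2 * a * v * b00 <= 2 * a * v * M by rewrite ler_wpM2l// -mulrA mulr_ge0.
  lra.
(* Integrating the coordinate [e0] leaves the square of [lform D' b] with this weight; it is added
   to the form as a rank-one term. *)
pose kap := 2 * a * v / (1 - 2 * a * v * b00).
have av2 : 0 <= 2 * a * v by rewrite -mulrA mulr_ge0.
have kap0 : 0 <= kap by rewrite divr_ge0// ltW.
have kapE : kap * (1 - 2 * a * v * b00) = 2 * a * v by rewrite mulfVK// gt_eqF.
have kapM : kap * (M - b00) <= 1.
  rewrite mulrC mulrA ler_pdivrMr// mul1r; lra.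
have kapM3 : kap * M <= 3^-1.
  rewrite mulrAC ler_pdivrMr//.
  have : 2 * a * v * b00 <= 2 * a * v * M by rewrite ler_wpM2l// -mulrA mulr_ge0.
  lra.
pose B' e f := B e f + kap * (b e * b f).
have symB' e f : B' e f = B' f e by rewrite /B' symB [b e * _]mulrC.
have psd' u : 0 <= qform D' B' u.
  rewrite qform_rank1; apply: addr_ge0; last by rewrite mulr_ge0 ?sqr_ge0.
  have := psd (upd1 u e0 0); rewrite (qform_split _ symB e0D) qform_upd1 lform_upd1 /upd1 eqxx.
  by rewrite expr0n/= !mulr0 mul0r !add0r.
have ub' u : qform D' B' u <= M * \sum_(e in D') u e ^+ 2.
  rewrite qform_rank1.
  (* This value of the coordinate [e0] makes the bound on [B] imply the same bound [M] on the
     corrected form, because [kap * (M - b00) <= 1]. *)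
  have := ub (upd1 u e0 (kap * lform D' b u)).
  rewrite (sqr_sum_upd1 _ _ e0D) (qform_split _ symB e0D) qform_upd1 lform_upd1 /upd1 eqxx -/D' -/b -[b e0]/b00.
  set l := lform D' b u; set Q := qform D' B u; set S := \sum_(e in D') _ => h.
  have : 0 <= kap * l ^+ 2 * (1 - kap * (M - b00)).
    have g : 0 <= 1 - kap * (M - b00) by rewrite subr_ge0.
    exact: (mulr_ge0 (mulr_ge0 kap0 (sqr_ge0 l)) g).
  by lra.
have IH' := IH D' B' D'k symB' psd' ub'.
rewrite (Ew_merge1 e0).
pose C := (Num.sqrt (1 - 2 * (a * b00) * v))^-1.
apply: (@le_trans _ _ (Ew (fun om => C * expR (a * qform D' B' (fun e => y e (om e)))))).
  apply: Ew_le => om.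
  pose u e := y e (om e).
  have -> : \sum_(c : bool) w e0 c * expR (a * qform D B (fun e => y e ([ffun e1 => if e1 == e0 then c else om e1] e))) =
     expR (a * qform D' B u) * \sum_(c : bool) w e0 c * expR (a * b00 * y e0 c ^+ 2 + 2 * a * lform D' b u * y e0 c).
    rewrite mulr_sumr; apply: eq_bigr => c _; rewrite [RHS]mulrCA -expRD; congr (_ * expR _).
    have uE : (fun e => y e ([ffun e1 => if e1 == e0 then c else om e1] e)) = upd1 u e0 (y e0 c).
      by apply/funext => e; rewrite /upd1 /u ffunE; case: eqP => [->|].
    rewrite uE (qform_split _ symB e0D) qform_upd1 lform_upd1 /upd1 eqxx -/D' -/b -[b e0]/b00.
    by ring.
  have hav : 2 * (a * b00) * v < 1 by lra.
  apply: (@le_trans _ _ (expR (a * qform D' B u) * (C *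
     expR (v * (2 * a * lform D' b u) ^+ 2 / (2 * (1 - 2 * (a * b00) * v)))))).
    by rewrite ler_wpM2l ?expR_ge0//; apply: subgaussian_square => //; exact: mulr_ge0.
  rewrite mulrCA -expRD ler_wpM2l ?invr_ge0 ?sqrtr_ge0// ler_expR qform_rank1.
  rewrite le_eqVlt; apply/orP; left; apply/eqP; rewrite [RHS]mulrDr; congr (_ + _).
  have -> : 2 * (a * b00) * v = 2 * a * v * b00 by ring.
  rewrite /kap; field; rewrite gt_eqF//.
rewrite EwZ.
have CE : C <= expR (2 / 3 * (2 * a * v * b00)).
  rewrite /C (_ : 2 * (a * b00) * v = 2 * a * v * b00); last by ring.
  apply: inv_sqrt_le_expR; first by rewrite mulr_ge0// -mulrA mulr_ge0.
  have : 2 * a * v * b00 <= 2 * a * v * M by rewrite ler_wpM2l// -mulrA mulr_ge0.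
  lra.
apply: (@le_trans _ _ (expR (2 / 3 * (2 * a * v * b00)) * expR (2 * a * v * \sum_(e in D') B' e e))).
  by apply: ler_pM => //; [rewrite invr_ge0 sqrtr_ge0|apply: Ew_ge0 => om; exact: expR_ge0].
rewrite -expRD ler_expR [X in _ <= _ * X](big_setD1 e0)//=.
have -> : \sum_(e in D') B' e e = \sum_(e in D :\ e0) B e e + kap * bb.
  by rewrite big_split/= mulr_sumr; congr (_ + _); apply: eq_bigr => e _; rewrite expr2.
rewrite -/b00.
have : 2 * a * v * (kap * bb) <= 2 * a * v * (3^-1 * b00).
  apply: (ler_wpM2l av2); apply: (@le_trans _ _ (kap * (M * b00))); first exact: (ler_wpM2l kap0).
  by rewrite mulrA; exact: (ler_wpM2r b00_ge0).
lra.
Qed.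

Lemma subgaussian_sum_squares (J : finType) (A : J -> I -> R) (y : I -> bool -> R) (v a M : R) D :
  0 <= v -> 0 <= a -> 0 < M -> 8 * a * v * M <= 1 ->
  (forall e t, \sum_(b : bool) w e b * expR (t * y e b) <= expR (v * t ^+ 2 / 2)) ->
  (forall u, \sum_j lform D (A j) u ^+ 2 <= M * \sum_(e in D) u e ^+ 2) ->
  Ew (fun om => expR (a * \sum_j lform D (A j) (fun e => y e (om e)) ^+ 2)) <=
  expR (2 * a * v * \sum_(e in D) \sum_j A j e ^+ 2).
Proof.
move=> v0 a0 M0 aM hy hA.
pose B e f := \sum_j A j e * A j f.
have QE u : qform D B u = \sum_j lform D (A j) u ^+ 2.
  transitivity (\sum_(e in D) \sum_(f in D) \sum_j (A j e * u e) * (A j f * u f)).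
    apply: eq_bigr => e _; apply: eq_bigr => f _.
    by rewrite /B !mulr_suml; apply: eq_bigr => j _; ring.
  under eq_bigr do rewrite exchange_big.
  rewrite exchange_big; apply: eq_bigr => j _.
  by rewrite expr2 /lform big_distrlr.
rewrite (_ : Ew _ = Ew (fun om => expR (a * qform D B (fun e => y e (om e))))); last first.
  by apply: eq_Ew => om; rewrite QE.
have -> : \sum_(e in D) \sum_j A j e ^+ 2 = \sum_(e in D) B e e.
  by apply: eq_bigr => e _; apply: eq_bigr => j _; rewrite expr2.
apply: (@subgaussian_quadratic y v a M) => //.
- by move=> e f; apply: eq_bigr => j _; rewrite mulrC.
- by move=> u; rewrite QE; apply: sumr_ge0 => j _; exact: sqr_ge0.
- by move=> u; rewrite QE.
Qed.

End quadratic_form.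

End product_law.

Lemma sum_pair (V : nmodType) (I J : finType) (F : I * J -> V) :
  \sum_q F q = \sum_i \sum_j F (i, j).
Proof. by rewrite (pair_bigA _ (fun i j => F (i, j))); apply: eq_bigr => -[]. Qed.

(** * Triangle counts of independent edges *)

Section colored_triangles.
Context {R : realType} {n : nat}.
Variable p : R.
Hypotheses (p0 : 0 <= p) (p1 : p <= 1).
Local Notation I := ('I_n * 'I_n)%type.
Implicit Types (om : {ffun I -> bool}) (A : {set 'I_n}) (c : {ffun 'I_n -> 'I_3}).

Definition cval (b : bool) : R := b%:R - p.
Local Notation E := (@Ew R I (fun _ => bern p)).

Let w0 (e : I) b : 0 <= bern p b. Proof. by case: b => //=; rewrite subr_ge0. Qed.
Let w1 (e : I) : \sum_(b : bool) bern p b = 1. Proof. by rewrite big_bool/= addrC subrK. Qed.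

Definition upper_pairs A : {set I} := [set e | [&& e.1 \in A, e.2 \in A & (e.1 < e.2)%N]].

Definition color_pairs A c (a b : 'I_3) : {set I} :=
  [set e | [&& e.1 \in A, e.2 \in A, (e.1 < e.2)%N, c e.1 == a & c e.2 == b]].

Definition hue0 : 'I_3 := @Ordinal 3 0 isT.
Definition hue1 : 'I_3 := @Ordinal 3 1 isT.
Definition hue2 : 'I_3 := @Ordinal 3 2 isT.

Definition triangle_sum A om : R :=
  \sum_(i in A) \sum_(j in A | (i < j)%N) \sum_(l in A | (j < l)%N)
    cval (om (i, j)) * cval (om (j, l)) * cval (om (i, l)).

(** Rows are the pairs [(i, l)], columns the pairs [(j, l')], and the entry is the signed edge
    [(i, j)] if [l = l']. The matrix is thus block diagonal with one copy of the edge matrix per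
    [l]: the operator norm does not grow, and the squared Frobenius norm is multiplied by at most
    [#|A|]. *)
Definition path_coef A c om (q e : I) : R :=
  if (e.2 == q.2) && ((q.1, e.1) \in color_pairs A c hue0 hue1)
  then cval (om (q.1, e.1)) else 0.

Definition colored_sum A c om : R :=
  \sum_(q in color_pairs A c hue0 hue2)
    lform (color_pairs A c hue1 hue2) (path_coef A c om q) (fun e => cval (om e))
    * cval (om q).

Lemma colored_sumE A c om : colored_sum A c om =
  \sum_(i in A) \sum_(j in A | (i < j)%N) \sum_(l in A | (j < l)%N)
    ([&& c i == hue0, c j == hue1 & c l == hue2])%:R *
    (cval (om (i, j)) * cval (om (j, l)) * cval (om (i, l))).
Proof.
pose F i j l : R := cval (om (i, j)) * cval (om (j, l)) * cval (om (i, l)).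
transitivity (\sum_(i : 'I_n) \sum_(j : 'I_n) \sum_(l : 'I_n)
   ([&& i \in A, j \in A, l \in A, (i < j)%N, (j < l)%N, c i == hue0, c j == hue1 & c l == hue2])%:R
   * F i j l); last first.
  rewrite [RHS]big_mkcond/=; apply: eq_bigr => i _.
  case: (boolP (i \in A)) => iA /=; last by rewrite big1// => j _; rewrite big1// => l _; rewrite mul0r.
  rewrite [RHS]big_mkcond/=; apply: eq_bigr => j _.
  case: (boolP (j \in A)) => jA /=; last by rewrite big1// => l _; rewrite mul0r.
  case: (boolP (i < j)%N) => ij /=; last by rewrite big1// => l _; rewrite andbF mul0r.
  rewrite [RHS]big_mkcond/=; apply: eq_bigr => l _.
  case: (boolP (l \in A)) => lA /=; last by rewrite mul0r.
  by case: (boolP (j < l)%N) => jl /=; [|rewrite mul0r].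
rewrite /colored_sum big_mkcond/=.
rewrite sum_pair/=.
apply: eq_bigr => i _; rewrite [RHS]exchange_big; apply: eq_bigr => l _.
rewrite /lform big_mkcond/= sum_pair/=.
transitivity (\sum_(j : 'I_n) (if (i, l) \in color_pairs A c hue0 hue2 then
  (if (j, l) \in color_pairs A c hue1 hue2 then path_coef A c om (i, l) (j, l) * cval (om (j, l)) else 0) * cval (om (i, l)) else 0)).
  case: ifP => _; last by rewrite big1.
  rewrite mulr_suml; apply: eq_bigr => j _; congr (_ * _).
  rewrite (bigD1 l)//= [X in _ + X]big1 ?addr0// => l' /negbTE l'l.
  by rewrite /path_coef /= l'l/= mul0r if_same.
apply: eq_bigr => j _; rewrite /path_coef !inE/= eqxx/=.
have [ij|ij] := boolP (i < j)%N; last first.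
  by rewrite !andbF/= mul0r; do ! case: ifP; rewrite ?mul0r.
have [jl|jl] := boolP (j < l)%N; last first.
  by rewrite !andbF/= mul0r; do ! case: ifP; rewrite ?mul0r.
rewrite (ltn_trans ij jl).
by case: (i \in A); case: (j \in A); case: (l \in A); case: (c i == hue0);
  case: (c j == hue1); case: (c l == hue2); rewrite /= ?mul0r ?mul1r//.
Qed.

(** A fixed increasing triple receives the hues 0, 1, 2 in this order with probability [1 / 27], so
    each triangle is counted with the same weight. *)
Lemma color_average (i j l : 'I_n) : (i < j)%N -> (j < l)%N ->
  \sum_(c : {ffun 'I_n -> 'I_3}) (\prod_(e : 'I_n) 3^-1) *
    ([&& c i == hue0, c j == hue1 & c l == hue2])%:R = 27^-1 :> R.
Proof.
move=> ij jl.
have ji : j != i by rewrite neq_ltn ij orbT.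
have li : l != i by rewrite neq_ltn (ltn_trans ij jl) orbT.
have lj : l != j by rewrite neq_ltn jl orbT.
pose g (e : 'I_n) (a : 'I_3) : R := 3^-1 * (if e == i then (a == hue0)%:R
  else if e == j then (a == hue1)%:R else if e == l then (a == hue2)%:R else 1).
transitivity (\sum_(c : {ffun 'I_n -> 'I_3}) \prod_e g e (c e)).
  apply: eq_bigr => c _; rewrite /g big_split/=; congr (_ * _).
  rewrite (bigD1 i)//= eqxx (bigD1 j)//= (negbTE ji) eqxx (bigD1 l) ?li ?lj//= (negbTE li) (negbTE lj) eqxx.
  rewrite big1 ?mulr1; last by move=> e /andP[/andP[/negbTE -> /negbTE ->] /negbTE ->].
  by rewrite -!natrM !mulnb.
rewrite -(bigA_distr_bigA g).
have gs (a0 : 'I_3) : \sum_(a : 'I_3) 3^-1 * (a == a0)%:R = 3^-1 :> R.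
  by rewrite (bigD1 a0)//= eqxx mulr1 big1 ?addr0// => a /negbTE ->; rewrite mulr0.
rewrite (bigD1 i)//= /g eqxx gs (bigD1 j)//= (negbTE ji) eqxx gs (bigD1 l) ?li ?lj//= (negbTE li) (negbTE lj) eqxx gs.
rewrite big1 ?mulr1; last first.
  move=> e /andP[/andP[/negbTE -> /negbTE ->] /negbTE ->].
  by under eq_bigr do rewrite mulr1; rewrite sumr_const card_ord -(mulr_natl (3^-1)) mulfV// pnatr_eq0.
by field.
Qed.

Lemma triangle_sum_average A om :
  \sum_c (\prod_(e : 'I_n) 3^-1) * colored_sum A c om = triangle_sum A om / 27.
Proof.
under eq_bigr do rewrite colored_sumE mulr_sumr.
rewrite exchange_big/= /triangle_sum mulr_suml; apply: eq_bigr => i _.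
under eq_bigr do rewrite mulr_sumr.
rewrite exchange_big/= mulr_suml; apply: eq_bigr => j /andP[_ ij].
under eq_bigr do rewrite mulr_sumr.
rewrite exchange_big/= mulr_suml; apply: eq_bigr => l /andP[_ jl].
under eq_bigr do rewrite (mulrA (\prod_(e < n) 3^-1)).
by rewrite -mulr_suml color_average// mulrC.
Qed.

Lemma color_weight_sum1 : \sum_(c : {ffun 'I_n -> 'I_3}) (\prod_(e : 'I_n) 3^-1) = 1 :> R.
Proof.
rewrite -(bigA_distr_bigA (fun (e : 'I_n) (a : 'I_3) => 3^-1 : R)) big1// => e _.
by rewrite sumr_const card_ord -(mulr_natl (3^-1)) mulfV// pnatr_eq0.
Qed.

Lemma expR_jensen (T : finType) (u x : T -> R) : (forall t, 0 <= u t) -> \sum_t u t = 1 ->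
  expR (\sum_t u t * x t) <= \sum_t u t * expR (x t).
Proof.
move=> u0 u1; set m := \sum_t _.
apply: (@le_trans _ _ (\sum_t u t * (expR m * (1 + (x t - m))))); last first.
  apply: ler_sum => t _; rewrite ler_wpM2l//.
  have -> : expR (x t) = expR m * expR (x t - m) by rewrite -expRD addrC subrK.
  by rewrite ler_pM2l ?expR_gt0// expR_ge1Dx.
have -> : \sum_t u t * (expR m * (1 + (x t - m))) = expR m * (\sum_t u t * (1 - m) + \sum_t u t * x t).
  by rewrite -big_split mulr_sumr; apply: eq_bigr => t _ /=; ring.
by rewrite -mulr_suml u1 mul1r -/m subrK mulr1.
Qed.

Lemma expR_triangle_sum A om (lam : R) :
  expR (lam * (triangle_sum A om / 27)) <=
  \sum_c (\prod_(e : 'I_n) 3^-1) * expR (lam * colored_sum A c om).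
Proof.
rewrite -triangle_sum_average mulr_sumr.
have -> : \sum_c lam * ((\prod_(e : 'I_n) 3^-1) * colored_sum A c om) =
  \sum_c (\prod_(e : 'I_n) 3^-1) * (lam * colored_sum A c om).
  by apply: eq_bigr => c _; rewrite mulrCA.
apply: expR_jensen; last exact: color_weight_sum1.
by move=> c; rewrite prodr_ge0// => e _; rewrite invr_ge0.
Qed.

Section fixed_set.
Variables (A : {set 'I_n}) (k : nat) (v : R).
Hypotheses (Ak : (#|A| <= k)%N) (v0 : 0 < v).
Hypothesis (hy : forall t, \sum_(b : bool) bern p b * expR (t * cval b) <= expR (v * t ^+ 2 / 2)).

Definition row_form (D : {set I}) om (u : 'I_n -> R) (i : 'I_n) : R :=
  \sum_(j | (i, j) \in D) cval (om (i, j)) * u j.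

(* [M] bounds the squared operator norm and [Fb] the squared Frobenius norm. *)
Definition tame (D : {set I}) (M Fb : R) om :=
  (forall u : 'I_n -> R, \sum_i row_form D om u i ^+ 2 <= M * \sum_(j in A) u j ^+ 2) /\
  \sum_(e in D) cval (om e) ^+ 2 <= Fb.

(** Passing to the submatrix of rows of hue 0 and columns of hue 1 increases neither norm; on
    vectors, this means setting the other coordinates to 0. *)
Lemma tame_color c M Fb om : 0 <= M -> tame (upper_pairs A) M Fb om ->
  tame (color_pairs A c hue0 hue1) M Fb om.
Proof.
move=> M0 [h1 h2]; split.
  move=> u; pose u' j := (c j == hue1)%:R * u j.
  apply: (@le_trans _ _ (\sum_i row_form (upper_pairs A) om u' i ^+ 2)).
    apply: ler_sum => i _.
    have [ci|ci] := boolP (c i == hue0); last first.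
      rewrite /row_form big1 ?expr0n ?sqr_ge0// => j; by rewrite inE/= (negbTE ci) !andbF.
    rewrite le_eqVlt; apply/orP; left; apply/eqP; congr (_ ^+ 2).
    rewrite /row_form [LHS]big_mkcond [RHS]big_mkcond; apply: eq_bigr => j _.
    rewrite !inE/= ci /u'; case: (c j == hue1); rewrite ?andbT ?andbF/= ?mul1r//.
    by rewrite mul0r mulr0 if_same.
  apply: (le_trans (h1 u')); rewrite ler_wpM2l//; apply: ler_sum => j _.
  rewrite exprMn /u'; case: (c j == hue1); rewrite ?expr1n ?mul1r//.
  by rewrite expr0n/= mul0r sqr_ge0.
apply: le_trans h2; rewrite [leRHS]big_mkcond [leLHS]big_mkcond; apply: ler_sum => e _.
rewrite !inE; case: (e.1 \in A) => //=; case: (e.2 \in A) => //=; case: (e.1 < e.2)%N => //=.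
by case: ifP => // _; exact: sqr_ge0.
Qed.

(** Tameness only depends on the pairs of hues 0 and 1, so it is constant while the other two
    classes are integrated out. *)
Lemma tame_mrg c (D : {set I}) M Fb om om' : [disjoint D & color_pairs A c hue0 hue1]%B ->
  tame (color_pairs A c hue0 hue1) M Fb (mrg D om' om) <->
  tame (color_pairs A c hue0 hue1) M Fb om.
Proof.
move=> dis.
have E0 e : e \in color_pairs A c hue0 hue1 -> mrg D om' om e = om e.
  move=> eX; rewrite ffunE ifF//; exact: (fintype.disjointFl dis eX).
have E1 u i : row_form (color_pairs A c hue0 hue1) (mrg D om' om) u i =
   row_form (color_pairs A c hue0 hue1) om u i.
  by apply: eq_bigr => j jX; rewrite E0.
have E2 : \sum_(e in color_pairs A c hue0 hue1) cval (mrg D om' om e) ^+ 2 =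
  \sum_(e in color_pairs A c hue0 hue1) cval (om e) ^+ 2.
  by apply: eq_bigr => e eX; rewrite E0.
have E3 u : \sum_i row_form (color_pairs A c hue0 hue1) (mrg D om' om) u i ^+ 2 =
  \sum_i row_form (color_pairs A c hue0 hue1) om u i ^+ 2.
  by apply: eq_bigr => i _; rewrite E1.
by rewrite /tame E2; split => -[h1 h2]; split => // u; have := h1 u; rewrite E3.
Qed.

Lemma color_disjoint c (a b a' b' : 'I_3) : (a, b) != (a', b') ->
  [disjoint color_pairs A c a b & color_pairs A c a' b']%B.
Proof.
move=> ab; apply/pred0P => e /=; apply/negbTE; rewrite !inE; apply/negP.
move=> /andP[/and5P[_ _ _ /eqP h1 /eqP h2] /and5P[_ _ _ /eqP h3 /eqP h4]].
by rewrite -h1 -h2 -h3 -h4 eqxx in ab.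
Qed.

Lemma colored_mgf c (M Fb lam : R) : 0 < M -> 4 * lam ^+ 2 * v ^+ 2 * M <= 1 ->
  E (fun om => (`[< tame (color_pairs A c hue0 hue1) M Fb om >])%:R * expR (lam * colored_sum A c om))
  <= expR (lam ^+ 2 * v ^+ 2 * (k%:R * Fb)).
Proof.
move=> M0 hM.
set DX := color_pairs A c hue0 hue1; set DY := color_pairs A c hue1 hue2.
set DZ := color_pairs A c hue0 hue2.
have dYX : [disjoint DY & DX]%B by exact: color_disjoint.
have dZX : [disjoint DZ & DX]%B by exact: color_disjoint.
have dZY : [disjoint DZ & DY]%B by exact: color_disjoint.
have offD (D D' : {set I}) (om om' : {ffun I -> bool}) e : [disjoint D & D']%B -> e \in D' -> mrg D om' om e = om e.
  by move=> dis eD; rewrite ffunE ifF//; exact: (fintype.disjointFl dis eD).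
have onD (D : {set I}) (om om' : {ffun I -> bool}) e : e \in D -> mrg D om' om e = om' e.
  by move=> eD; rewrite ffunE eD.
pose gd om : R := (`[< tame DX M Fb om >])%:R.
have gd0 om : 0 <= gd om by rewrite ler0n.
have gdm (D : {set I}) om om' : [disjoint D & DX]%B -> gd (mrg D om' om) = gd om.
  by move=> dis; congr ((nat_of_bool _)%:R); apply: asbool_equiv_eq; exact: tame_mrg.
have pcm (D : {set I}) om om' q e : [disjoint D & DX]%B -> path_coef A c (mrg D om' om) q e = path_coef A c om q e.
  by move=> dis; rewrite /path_coef; case: ifP => // /andP[_ h]; rewrite (offD D DX).
pose L om q := lform DY (path_coef A c om q) (fun e => cval (om e)).
(* The coefficient left by the linear step; the hypothesis on [lam] is then the condition
   [8 * a * v * M <= 1] of the quadratic step. *)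
pose a := lam ^+ 2 * v / 2.
have a0 : 0 <= a by rewrite divr_ge0// mulr_ge0 ?sqr_ge0// ltW.
(* Given the other pairs, the sum is linear in the pairs of colors 0 and 2... *)
apply: (@le_trans _ _ (E (fun om => gd om * expR (a * \sum_q L om q ^+ 2)))).
  rewrite (Ew_merge w1 DZ); apply: Ew_le => // om.
  have -> : E (fun om' => gd (mrg DZ om' om) * expR (lam * colored_sum A c (mrg DZ om' om))) =
    gd om * E (fun om' => expR (\sum_(q in DZ) (lam * L om q) * cval (om' q))).
    rewrite -EwZ; apply: eq_Ew => om'; rewrite gdm//; congr (_ * expR _).
    rewrite /colored_sum mulr_sumr; apply: eq_bigr => q qZ.
    rewrite (onD DZ)// -mulrA; congr (_ * (_ * _)).
    by apply: eq_bigr => e eY; rewrite pcm// (offD DZ DY).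
  rewrite ler_wpM2l//.
  apply: (le_trans (subgaussian_linear w0 w1 (y := fun _ => cval) (v := v) (lam \*o L om) (fun _ t _ => hy t))).
  rewrite ler_expR /a.
  have -> : \sum_(e in DZ) (lam * L om e) ^+ 2 = lam ^+ 2 * \sum_(e in DZ) L om e ^+ 2.
    by rewrite mulr_sumr; apply: eq_bigr => e _; rewrite exprMn.
  have h : \sum_(e in DZ) L om e ^+ 2 <= \sum_e L om e ^+ 2.
    by rewrite big_mkcond; apply: ler_sum => e _; case: ifP => // _; exact: sqr_ge0.
  have := ler_wpM2l a0 h; rewrite /a; lra.
(* ... which leaves a sum of squares of linear forms in those of colors 1 and 2. *)
rewrite (Ew_merge w1 DY) -[leRHS](Ew_cst w1); apply: Ew_le => // om.
have -> : E (fun om' => gd (mrg DY om' om) * expR (a * \sum_q L (mrg DY om' om) q ^+ 2)) =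
    gd om * E (fun om' => expR (a * \sum_q lform DY (path_coef A c om q) (fun e => cval (om' e)) ^+ 2)).
  rewrite -EwZ; apply: eq_Ew => om'; rewrite gdm//; congr (_ * expR (_ * _)).
  apply: eq_bigr => q _; congr (_ ^+ 2); apply: eq_bigr => e eY.
  by rewrite pcm// (onD DY).
rewrite /gd; case: asboolP => [[g1 g2]|_]; last by rewrite mul0r expR_ge0.
rewrite mul1r.
have k0 : 0 <= k%:R :> R by rewrite ler0n.
apply: (le_trans (@subgaussian_sum_squares _ _ _ w0 w1 I (path_coef A c om) (fun _ => cval) v a M DY _ _ _ _ _ _)) => //.
- exact: ltW.
- by rewrite /a; apply: le_trans hM; rewrite le_eqVlt; apply/orP; left; apply/eqP; field.
- move=> u.
  (* The vector [u] is cut into one piece per common end [l]; each meets its own copy of the edge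
     matrix. *)
  pose ul l j : R := if (j, l) \in DY then u (j, l) else 0.
  rewrite sum_pair/= exchange_big/=.
  have El i l : lform DY (path_coef A c om (i, l)) u = row_form DX om (ul l) i.
    rewrite /lform big_mkcond/= sum_pair/= /row_form [RHS]big_mkcond/=.
    apply: eq_bigr => j _; rewrite (bigD1 l)//= big1 ?addr0; last first.
      by move=> l' /negbTE l'l; rewrite /path_coef /= l'l/= mul0r if_same.
    rewrite /path_coef/= eqxx/= -/DX /ul.
    by case: ifP => _; case: ifP => _; rewrite ?mul0r ?mulr0.
  under eq_bigr do under eq_bigr do rewrite El.
  apply: (@le_trans _ _ (\sum_l M * \sum_(j in A) ul l j ^+ 2)); first by apply: ler_sum => l _; exact: g1.
  rewrite -mulr_sumr ler_pM2l// [leRHS]big_mkcond/=.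
  rewrite sum_pair/=.
  rewrite exchange_big/= [leLHS]big_mkcond/=; apply: ler_sum => j _.
  case: ifP => _.
    by apply: ler_sum => l _; rewrite /ul; case: ifP => // _; rewrite expr0n.
  by apply: sumr_ge0 => l _; case: ifP => // _; exact: sqr_ge0.
rewrite ler_expR /a.
have h : \sum_(e in DY) \sum_q path_coef A c om q e ^+ 2 <= k%:R * Fb.
  apply: (@le_trans _ _ (\sum_(l in A) \sum_(e in DX) cval (om e) ^+ 2)); last first.
    rewrite sumr_const -[leLHS]mulr_natl; apply: ler_pM => //.
    - by apply: sumr_ge0 => e _; exact: sqr_ge0.
    - by rewrite ler_nat.
  rewrite big_mkcond/= sum_pair/= exchange_big/= [leRHS]big_mkcond/=.
  apply: ler_sum => l _; case: ifPn => lA; last first.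
    by rewrite big1// => j _; rewrite !inE/= (negbTE lA)/= andbF.
  rewrite [leRHS]big_mkcond/= sum_pair/=.
  rewrite exchange_big/=; apply: ler_sum => j _; case: ifP => _; last first.
    by apply: sumr_ge0 => i _; case: ifP => // _; exact: sqr_ge0.
  rewrite sum_pair/=.
  apply: ler_sum => i _; rewrite (bigD1 l)//= big1 ?addr0; last first.
    by move=> l' /negbTE l'l; rewrite /path_coef/= eq_sym l'l/= expr0n.
  rewrite /path_coef/= eqxx/=; case: ifP => // _; by rewrite expr0n.
have := ler_wpM2l (mulr_ge0 (sqr_ge0 lam) (sqr_ge0 v)) h; lra.
Qed.

End fixed_set.
End colored_triangles.

Lemma sum_cauchy_schwarz (R : realDomainType) (I : finType) (P : pred I) (x y : I -> R) :
  (\sum_(i | P i) x i * y i) ^+ 2 <= (\sum_(i | P i) x i ^+ 2) * (\sum_(i | P i) y i ^+ 2).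
Proof.
have : 0 <= \sum_(i | P i) \sum_(j | P j) (x i * y j - x j * y i) ^+ 2.
  by apply: sumr_ge0 => i _; apply: sumr_ge0 => j _; exact: sqr_ge0.
have -> : \sum_(i | P i) \sum_(j | P j) (x i * y j - x j * y i) ^+ 2 =
  (\sum_(i | P i) x i ^+ 2) * (\sum_(i | P i) y i ^+ 2) *+ 2 - (\sum_(i | P i) x i * y i) ^+ 2 *+ 2.
  have e1 : (\sum_(i | P i) x i ^+ 2) * (\sum_(i | P i) y i ^+ 2) =
    \sum_(i | P i) \sum_(j | P j) x i ^+ 2 * y j ^+ 2.
    by rewrite mulr_suml; apply: eq_bigr => i _; rewrite mulr_sumr.
  have e2 : (\sum_(i | P i) x i ^+ 2) * (\sum_(i | P i) y i ^+ 2) =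
    \sum_(i | P i) \sum_(j | P j) x j ^+ 2 * y i ^+ 2 by rewrite e1 exchange_big.
  have e3 : (\sum_(i | P i) x i * y i) ^+ 2 =
    \sum_(i | P i) \sum_(j | P j) (x i * y i) * (x j * y j).
    by rewrite expr2 mulr_suml; apply: eq_bigr => i _; rewrite mulr_sumr.
  rewrite mulr2n {1}e1 e2 e3 -sumrMnl -big_split -sumrB; apply: eq_bigr => i _ /=.
  rewrite -sumrMnl -big_split -sumrB; apply: eq_bigr => j _ /=; ring.
by rewrite -mulrnBl pmulrn_lge0// subr_ge0.
Qed.

Lemma sqrrD_le (R : realDomainType) (x y : R) : (x + y) ^+ 2 <= 2 * x ^+ 2 + 2 * y ^+ 2.
Proof. have := sqr_ge0 (x - y); lra. Qed.

(** * Norms of the matrix of signed edges and the tail of the triangle count *)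

Section triangle_tail.
Context {R : realType} {n : nat}.
Variable p : R.
Hypotheses (p0 : 0 <= p) (p1 : p <= 1).
Local Notation I := ('I_n * 'I_n)%type.
Implicit Types (om : {ffun I -> bool}) (c : {ffun 'I_n -> 'I_3}).
Local Notation cvalp := (cval p).
Local Notation E := (@Ew R I (fun _ => bern p)).

Let w0 (e : I) b : 0 <= bern p b. Proof. by case: b => //=; rewrite subr_ge0. Qed.
Let w1 (e : I) : \sum_(b : bool) bern p b = 1. Proof. by rewrite big_bool/= addrC subrK. Qed.

Variables (A : {set 'I_n}) (k : nat) (v : R).
Hypotheses (Ak : (#|A| <= k)%N) (v0 : 0 < v).
Hypothesis (hy : forall t, \sum_(b : bool) bern p b * expR (t * cvalp b) <= expR (v * t ^+ 2 / 2)).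
Local Notation U := (upper_pairs A).

Lemma norm_cval_le1 b : `|cvalp b| <= 1.
Proof. rewrite ler_norml; case: b; rewrite /cval ?mulr1n ?mulr0n; apply/andP; split; move: p0 p1; lra. Qed.

Lemma markov_expR (x a : R) (X : {ffun I -> bool} -> R) (B : R) : 0 <= a ->
  E (fun om => expR (a * X om)) <= expR B ->
  E (fun om => (x < X om)%R%:R) <= expR (B - a * x).
Proof.
move=> a0 h; rewrite expRD mulrC; apply: le_trans (ler_wpM2l (expR_ge0 _) h).
rewrite -EwZ; apply: Ew_le => // om; case: ltP => h1; last by rewrite mulr_ge0 ?expR_ge0.
rewrite -expRD -expR0 ler_expR addrC -mulrBr; apply: mulr_ge0 => //; lra.
Qed.

Lemma card_upper_pairs : (#|U| <= k ^ 2)%N.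
Proof.
apply: leq_trans (_ : #|finset.setX A A| <= _)%N.
  by apply/subset_leq_card/fintype.subsetP => e; rewrite !inE => /and3P[-> ->].
by rewrite cardsX expnS expn1 leq_mul.
Qed.

(** The sum of squares is the quadratic form of the identity, so [M = 1] and the largest admissible
    coefficient is [1 / (8 * v)]; the trace is at most [k ^ 2]. *)
Lemma frobenius_tail (Fb : R) : E (fun om => (Fb < \sum_(e in U) cvalp (om e) ^+ 2)%R%:R) <=
  expR (k%:R ^+ 2 / 4 - Fb / (8 * v)).
Proof.
have v0' := ltW v0.
have a0 : 0 <= (8 * v)^-1 by rewrite invr_ge0 mulr_ge0.
rewrite (mulrC Fb); apply: markov_expR => //.
pose B (j e : I) : R := (e == j)%:R.
have lE (u : I -> R) : \sum_j lform U (B j) u ^+ 2 = \sum_(e in U) u e ^+ 2.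
  rewrite [RHS]big_mkcond; apply: eq_bigr => j _; rewrite /lform.
  case: ifP => jU.
    rewrite (bigD1 j)//= /B eqxx mul1r big1 ?addr0// => e /andP[_ /negbTE ->]; exact: mul0r.
  rewrite big1 ?expr0n// => e eU; rewrite /B; case: eqP => [ej|_]; last exact: mul0r.
  by rewrite -ej eU in jU.
have h8 : 8 * (8 * v)^-1 * v * 1 <= 1.
  by rewrite le_eqVlt; apply/orP; left; apply/eqP; field; rewrite gt_eqF.
have lE1 (u : I -> R) : \sum_j lform U (B j) u ^+ 2 <= 1 * \sum_(e in U) u e ^+ 2.
  by rewrite lE mul1r.
have h := @subgaussian_sum_squares _ _ _ w0 w1 I B (fun _ => cvalp) v (8 * v)^-1 1 U v0' a0 ltr01 h8
  (fun _ => hy) lE1.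
apply: le_trans (le_trans h _).
  by apply: Ew_le => // om; rewrite lE.
rewrite ler_expR.
have -> : \sum_(e in U) \sum_j B j e ^+ 2 = #|U|%:R.
  rewrite -sum1_card natr_sum; apply: eq_bigr => e _.
  rewrite (bigD1 e)//= /B eqxx expr1n big1 ?addr0// => j; rewrite eq_sym => /negbTE ->.
  by rewrite expr0n.
have -> : 2 * (8 * v)^-1 * v = 4^-1 by field; rewrite gt_eqF.
by rewrite mulrC ler_wpM2r ?invr_ge0// -natrX ler_nat card_upper_pairs.
Qed.

(** For a fixed vector the rows involve disjoint pairs, so the operator norm of the form is at most
    [q] by Cauchy-Schwarz and its trace at most [k * q]. *)
Lemma row_form_tail (w : 'I_n -> R) (s : R) :
  E (fun om => (s * (\sum_(j in A) w j ^+ 2) < \sum_i row_form p U om w i ^+ 2)%R%:R) <=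
  expR (k%:R / 4 - s / (8 * v)).
Proof.
set q := \sum_(j in A) w j ^+ 2.
have q0 : 0 <= q by apply: sumr_ge0 => j _; exact: sqr_ge0.
have CS om i : row_form p U om w i ^+ 2 <= (\sum_(j | (i, j) \in U) cvalp (om (i, j)) ^+ 2) * q.
  apply: le_trans (sum_cauchy_schwarz _ _ _) _; rewrite ler_wpM2l//.
    by apply: sumr_ge0 => j _; exact: sqr_ge0.
  rewrite [leLHS]big_mkcond /q [leRHS]big_mkcond; apply: ler_sum => j _.
  rewrite !inE/=; case: (j \in A); rewrite ?andbF//=; case: ifP => _ //; exact: sqr_ge0.
(* If [w] vanishes on [A] the event is empty; this case is set apart because the exponent divides by
   [q]. *)
have [q1|q1] := leP q 0.
  rewrite -[leLHS](_ : 0 = _) ?expR_ge0//.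
  rewrite -[LHS](Ew_cst w1); apply: eq_Ew => om.
  have q00 : q = 0 by apply/eqP; rewrite eq_le q1 q0.
  rewrite q00 mulr0 ltNge (_ : _ <= _)//; apply: sumr_le0 => i _.
  by apply: le_trans (CS _ _) _; rewrite q00 mulr0.
have v0' := ltW v0.
have a0 : 0 <= (8 * v * q)^-1 by rewrite invr_ge0 !mulr_ge0.
have -> : s / (8 * v) = (8 * v * q)^-1 * (s * q) by field; rewrite !gt_eqF.
apply: markov_expR => //.
pose B (i : 'I_n) (e : I) : R := (e.1 == i)%:R * w e.2.
have lE (u : I -> R) i : lform U (B i) u = \sum_(j | (i, j) \in U) u (i, j) * w j.
  rewrite /lform big_mkcond/= sum_pair/= (bigD1 i)//= [X in _ + X]big1 ?addr0; last first.
    by move=> i' /negbTE h; rewrite big1// => j _; rewrite /B/= h !mul0r if_same.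
  rewrite [RHS]big_mkcond; apply: eq_bigr => j _; rewrite /B/= eqxx mul1r.
  by rewrite (mulrC (w j)).
have h8 : 8 * (8 * v * q)^-1 * v * q <= 1.
  by rewrite le_eqVlt; apply/orP; left; apply/eqP; field; rewrite !gt_eqF.
have hB (u : I -> R) : \sum_i lform U (B i) u ^+ 2 <= q * \sum_(e in U) u e ^+ 2.
  rewrite [in leRHS]big_mkcond/= sum_pair mulr_sumr; apply: ler_sum => i _.
  rewrite lE; apply: le_trans (sum_cauchy_schwarz _ _ _) _; rewrite mulrC -big_mkcond/=.
  rewrite ler_wpM2r//; first by apply: sumr_ge0 => j _; exact: sqr_ge0.
  rewrite [leLHS]big_mkcond /q [leRHS]big_mkcond; apply: ler_sum => j _.
  rewrite !inE/=; case: (j \in A); rewrite ?andbF//=; case: ifP => _ //; exact: sqr_ge0.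
have h := @subgaussian_sum_squares _ _ _ w0 w1 'I_n B (fun _ => cvalp) v _ q U v0' a0 q1 h8
  (fun _ => hy) hB.
apply: le_trans (le_trans h _).
  by apply: Ew_le => // om; rewrite ler_expR ler_wpM2l//; apply: ler_sum => i _; rewrite lE.
rewrite ler_expR.
have h2 : \sum_(e in U) \sum_j B j e ^+ 2 <= k%:R * q.
  apply: (@le_trans _ _ (\sum_(i in A) \sum_(j in A) w j ^+ 2)).
    rewrite [leLHS]big_mkcond/= sum_pair [leRHS]big_mkcond/=; apply: ler_sum => i _.
    case: ifP => iA; last by rewrite big1// => j _; rewrite !inE/= iA.
    rewrite [leRHS]big_mkcond/=; apply: ler_sum => j _; rewrite !inE/= iA/=.
    case: ifP => [/andP[jA _]|_]; last by case: ifP => // _; exact: sqr_ge0.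
    rewrite ?jA.
    rewrite (bigD1 i)//= /B/= eqxx mul1r big1 ?addr0// => i' i'i.
    by rewrite eq_sym (negbTE i'i) mul0r expr0n.
  by rewrite sumr_const -[leLHS]mulr_natl ler_wpM2r// ler_nat.
have a1 : 0 <= 2 * (8 * v * q)^-1 * v by rewrite !mulr_ge0.
apply: le_trans (ler_wpM2l a1 h2) _.
by rewrite le_eqVlt; apply/orP; left; apply/eqP; field; rewrite !gt_eqF.
Qed.

End triangle_tail.

Section triangle_tail_net.
Context {R : realType} {n : nat}.
Variable p : R.
Hypotheses (p0 : 0 <= p) (p1 : p <= 1).
Local Notation I := ('I_n * 'I_n)%type.
Implicit Types (om : {ffun I -> bool}) (c : {ffun 'I_n -> 'I_3}).
Local Notation cvalp := (cval p).
Local Notation E := (@Ew R I (fun _ => bern p)).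

Let w0 (e : I) b : 0 <= bern p b. Proof. by case: b => //=; rewrite subr_ge0. Qed.
Let w1 (e : I) : \sum_(b : bool) bern p b = 1. Proof. by rewrite big_bool/= addrC subrK. Qed.

Variables (A : {set 'I_n}) (k : nat) (v : R).
Hypotheses (Ak : (#|A| <= k)%N) (v0 : 0 < v).
Hypothesis (hy : forall t, \sum_(b : bool) bern p b * expR (t * cvalp b) <= expR (v * t ^+ 2 / 2)).
Local Notation U := (upper_pairs A).
Local Notation net := {ffun 'I_n -> 'I_(2 * k ^ 2).+1}.

(** The net is an integer grid: values in [[- k ^ 2, k ^ 2]], coded by shifting them by [k ^ 2]. *)
Definition net_val (g : net) (j : 'I_n) : R := (g j)%:R - (k ^ 2)%:R.

(** The code of the value 0. Net functions equal it outside [A], so at most [(2 k ^ 2 + 1) ^ k] of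
    them are needed. *)
Let mid : 'I_(2 * k ^ 2).+1 := inord (k ^ 2).

Lemma row_form_sqr_le om (r : 'I_n -> R) : {in A, forall j, `|r j| <= 1} ->
  \sum_i row_form p U om r i ^+ 2 <= k%:R ^+ 3.
Proof.
move=> r1.
have kA : #|A|%:R <= k%:R :> R by rewrite ler_nat.
apply: (@le_trans _ _ (\sum_(i in A) k%:R ^+ 2)); last first.
  by rewrite sumr_const -[leLHS]mulr_natl exprS ler_wpM2r// sqr_ge0.
rewrite [leRHS]big_mkcond/=; apply: ler_sum => i _; case: ifP => iA; last first.
  by rewrite /row_form big1 ?expr0n// => j; rewrite inE/= iA.
rewrite -real_normK ?num_real// lerXn2r ?nnegrE//.
apply: le_trans (ler_norm_sum _ _ _) _; rewrite big_mkcond/=.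
apply: (@le_trans _ _ (\sum_(j in A) 1)); last by rewrite sumr_const.
rewrite [leRHS]big_mkcond/=; apply: ler_sum => j _.
rewrite inE/= iA/=; case: ifP => [/andP[jA _]|_]; last by case: ifP.
by rewrite ?jA normrM mulr_ile1// ?norm_cval_le1// r1.
Qed.

(** Scale the vector so that its largest entry on [A] is [k ^ 2] in absolute value, and round it to
    integers. The remainder has entries at most 1, and the trivial bound [k ^ 3] on its image is
    below the squared norm, which is at least [k ^ 4]: the grid is so fine that no approximation
    argument for the operator norm is required. *)
Lemma tame_net om (s Fb : R) : 0 <= s -> (0 < k)%N ->
  (forall g : net, g \in pffun_on mid (mem A) predT ->
     \sum_i row_form p U om (net_val g) i ^+ 2 <= s * \sum_(j in A) net_val g j ^+ 2) ->
  \sum_(e in U) cvalp (om e) ^+ 2 <= Fb ->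
  tame p A U (8 * s + 2) Fb om.
Proof.
move=> s0 k0 hg hF; split => // u.
have [/forall_inP h0|] := boolP [forall j in A, u j == 0].
  rewrite !big1 ?mulr0// => [j jA|i _]; first by rewrite (eqP (h0 j jA)) expr0n.
  rewrite /row_form big1 ?expr0n// => j; rewrite inE/= => /and3P[_ jA _].
  by rewrite (eqP (h0 j jA)) mulr0.
rewrite negb_forall_in => /existsP[j1 /andP[j1A uj1]].
pose j0 := [arg max_(j > j1 in A) `|u j|]%O.
have [j0A j0max] : j0 \in A /\ forall j, j \in A -> `|u j| <= `|u j0|.
  by rewrite /j0; case: Order.TotalTheory.arg_maxP => // j jA h; split.
set m := `|u j0| in j0max.
have m0 : 0 < m by apply: lt_le_trans (j0max _ j1A); rewrite normr_gt0.
pose N : R := k%:R ^+ 2.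
have k1 : 1 <= k%:R :> R by rewrite ler1n.
have N1 : 1 <= N by rewrite exprn_ege1.
have N0 := lt_le_trans ltr01 N1.
pose x j := N * (u j / m).
have xN j : j \in A -> `|x j| <= N.
  move=> jA; rewrite normrM (ger0_norm (ltW N0)); apply: ler_piMr; first exact: ltW.
  rewrite normrM normfV.
  by rewrite (ger0_norm (ltW m0)) ler_pdivrMr// mul1r j0max.
have NE : N = (k ^ 2)%:R by rewrite /N natrX.
(* The shift by [N] makes the truncated number nonnegative; [net_val] shifts back. *)
pose fl j := Num.truncn (x j + N).
pose g : net := [ffun j => if j \in A then inord (fl j) else mid].
have flb j : j \in A -> 0 <= x j + N <= 2 * N.
  by move=> jA; have := xN j jA; rewrite ler_norml => /andP[h1 h2]; apply/andP; split; lra.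
have gE j : j \in A -> net_val g j = (fl j)%:R - N.
  move=> jA; rewrite /net_val ffunE jA NE; congr (_ - _).
  have /andP[h1 h2] := flb j jA.
  rewrite inordK// ltnS -(ler_nat R) natrM -NE; apply: le_trans h2.
  by have /andP[] := truncn_itv h1.
have gA : g \in pffun_on mid (mem A) predT.
  apply/pffun_onP; split => //; apply/fintype.subsetP => j.
  by rewrite inE /g ffunE; case: ifP => //; rewrite eqxx.
pose r j := x j - net_val g j.
have r1 : {in A, forall j, `|r j| <= 1}.
  move=> j jA; rewrite /r gE// ger0_norm; have /andP[/truncn_itv/andP[]] := flb j jA; rewrite -/(fl j) -natr1; lra.
have lin i : row_form p U om x i = row_form p U om (net_val g) i + row_form p U om r i.
  by rewrite -big_split; apply: eq_bigr => j _; rewrite /= -mulrDr /r addrC subrK.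
have k0' : 0 <= k%:R :> R by rewrite ler0n.
have S1 : \sum_i row_form p U om x i ^+ 2 <= (8 * s + 2) * \sum_(j in A) x j ^+ 2.
  have X1 : N ^+ 2 <= \sum_(j in A) x j ^+ 2.
    rewrite (bigD1 j0)//= -[leLHS]addr0 lerD//; last by apply: sumr_ge0 => j _; exact: sqr_ge0.
    have um : `|u j0 / m| = 1.
      by rewrite normrM normfV (ger0_norm (ltW m0)) -/m divff ?gt_eqF.
    have -> : x j0 ^+ 2 = N ^+ 2 * `|u j0 / m| ^+ 2 by rewrite real_normK ?num_real// -exprMn.
    by rewrite um expr1n mulr1.
  have X2 : \sum_(j in A) net_val g j ^+ 2 <= 2 * \sum_(j in A) x j ^+ 2 + 2 * k%:R.
    have h : \sum_(j in A) 1 <= k%:R :> R by rewrite sumr_const ler_nat.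
    apply: (@le_trans _ _ (2 * \sum_(j in A) x j ^+ 2 + 2 * \sum_(j in A) 1)); last lra.
    rewrite !mulr_sumr -big_split; apply: ler_sum => j jA /=.
    have -> : net_val g j = x j + (- r j) by rewrite /r opprB addrC subrK.
    apply: le_trans (sqrrD_le _ _) _; rewrite sqrrN lerD2l ler_wpM2l//.
    by rewrite -real_normK ?num_real// expr_le1// r1.
  have X3 := hg g gA.
  have X4 := row_form_sqr_le om r1.
  apply: (@le_trans _ _ (2 * \sum_i row_form p U om (net_val g) i ^+ 2 + 2 * \sum_i row_form p U om r i ^+ 2)).
    by rewrite !mulr_sumr -big_split; apply: ler_sum => i _; rewrite lin sqrrD_le.
  have K1 : k%:R <= N ^+ 2 by rewrite /N -exprM -[leLHS]expr1 ler_weXn2l.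
  have K2 : k%:R ^+ 3 <= N ^+ 2 by rewrite /N -exprM ler_weXn2l.
  have := ler_wpM2l s0 X2; have := ler_wpM2l s0 (le_trans K1 X1); lra.
have rs i : row_form p U om x i = N / m * row_form p U om u i.
  by rewrite /row_form mulr_sumr; apply: eq_bigr => j _; rewrite /x; ring.
have Nm0 : 0 < (N / m) ^+ 2 by rewrite exprn_gt0// divr_gt0.
rewrite -(ler_pM2l Nm0).
have -> : (N / m) ^+ 2 * \sum_i row_form p U om u i ^+ 2 = \sum_i row_form p U om x i ^+ 2.
  by rewrite mulr_sumr; apply: eq_bigr => i _; rewrite rs [RHS]exprMn.
have -> : (N / m) ^+ 2 * ((8 * s + 2) * \sum_(j in A) u j ^+ 2) = (8 * s + 2) * \sum_(j in A) x j ^+ 2.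
  by rewrite mulrCA; congr (_ * _); rewrite mulr_sumr; apply: eq_bigr => j _; rewrite /x; ring.
exact: S1.
Qed.

(** The three terms bound the failure of the Frobenius bound, the failure of the row bound at some
    vector of the net, and the exponential Markov inequality on the remaining event. *)
Theorem triangle_sum_tail (Fb s lam t : R) : (0 < k)%N -> 0 <= s -> 0 <= lam ->
  4 * lam ^+ 2 * v ^+ 2 * (8 * s + 2) <= 1 ->
  E (fun om => (t < triangle_sum p A om)%R%:R) <=
    expR (k%:R ^+ 2 / 4 - Fb / (8 * v)) +
    (2 * k ^ 2).+1%:R ^+ k * expR (k%:R / 4 - s / (8 * v)) +
    expR (lam ^+ 2 * v ^+ 2 * (k%:R * Fb) - lam * (t / 27)).
Proof.
move=> k0 s0 l0 hl.
pose bF om : R := (Fb < \sum_(e in U) cvalp (om e) ^+ 2)%R%:R.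
pose bW (g : net) om : R := (s * (\sum_(j in A) net_val g j ^+ 2) <
  \sum_i row_form p U om (net_val g) i ^+ 2)%R%:R.
pose M := 8 * s + 2.
have M0 : 0 < M by rewrite /M; lra.
pose bL c om : R := (`[< tame p A (color_pairs A c hue0 hue1) M Fb om >])%:R *
  expR (lam * colored_sum p A c om).
apply: (@le_trans _ _ (E (fun om => bF om + \sum_(g in pffun_on mid (mem A) predT) bW g om +
   expR (- (lam * (t / 27))) * \sum_c (\prod_(e : 'I_n) 3^-1) * bL c om))).
  apply: Ew_le => // om.
  have c0 c : 0 <= \prod_(e : 'I_n) 3^-1 :> R by apply: prodr_ge0 => e _; rewrite invr_ge0.
  have bL0 c : 0 <= bL c om by apply: mulr_ge0; [exact: ler0n|exact: expR_ge0].
  have sW0 : 0 <= \sum_(g in pffun_on mid (mem A) predT) bW g om.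
    by apply: sumr_ge0 => g _; rewrite ler0n.
  have sL0 : 0 <= expR (- (lam * (t / 27))) * \sum_c (\prod_(e : 'I_n) 3^-1) * bL c om.
    apply: mulr_ge0; first exact: expR_ge0.
    by apply: sumr_ge0 => c _; apply: mulr_ge0; [exact: c0|exact: bL0].
  have bF0 : 0 <= bF om by rewrite ler0n.
  case: ltP => [ht|_]; last by rewrite !addr_ge0.
  have [hF|hF] := ltP Fb (\sum_(e in U) cvalp (om e) ^+ 2).
    rewrite {1}/bF hF -addrA lerDl addr_ge0//.
  have [/exists_inP[g gA hg]|] := boolP [exists g in pffun_on mid (mem A) predT,
     s * (\sum_(j in A) net_val g j ^+ 2) < \sum_i row_form p U om (net_val g) i ^+ 2].
    have h1 : 1 <= \sum_(g in pffun_on mid (mem A) predT) bW g om.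
      by rewrite (bigD1 g)//= {1}/bW hg lerDl; apply: sumr_ge0 => g' _; rewrite ler0n.
    by apply: le_trans h1 _; rewrite addrAC lerDr addr_ge0.
  rewrite negb_exists_in => /forall_inP hW.
  have tm : tame p A U M Fb om.
    by apply: tame_net => // g gA; rewrite leNgt hW.
  suff h1 : 1 <= expR (- (lam * (t / 27))) * \sum_c (\prod_(e : 'I_n) 3^-1) * bL c om 
    by apply: le_trans h1 _; rewrite lerDr addr_ge0.
  have := expR_triangle_sum p A om lam.
  have -> : \sum_c (\prod_(e : 'I_n) 3^-1) * expR (lam * colored_sum p A c om) =
     \sum_c (\prod_(e : 'I_n) 3^-1) * bL c om.
    apply: eq_bigr => c _; congr (_ * _); rewrite /bL asboolT ?mul1r//.
    by apply: tame_color => //; exact: ltW.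
  move=> h; apply: le_trans (ler_wpM2l (expR_ge0 _) h).
  rewrite -expRD -expR0 ler_expR addrC -mulrBr; apply: mulr_ge0 => //.
  by rewrite subr_ge0 ler_wpM2r// ltW.
rewrite !EwD; apply: lerD; first apply: lerD.
- exact: frobenius_tail.
- rewrite Ew_sum.
  apply: (@le_trans _ _ (\sum_(g in pffun_on mid (mem A) predT) expR (k%:R / 4 - s / (8 * v)))).
    by apply: ler_sum => g _; exact: row_form_tail.
  rewrite sumr_const -[leLHS]mulr_natl card_pffun_on ler_wpM2r ?expR_ge0//.
  rewrite -natrX ler_nat (_ : #|_| = (2 * k ^ 2).+1); last by rewrite -[RHS]card_ord; apply: eq_card.
  by rewrite leq_pexp2l.
rewrite EwZ Ew_sum addrC expRD mulrC (mulrC (expR (- _))).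
rewrite ler_wpM2r ?expR_ge0//.
under eq_bigr do rewrite EwZ.
apply: (@le_trans _ _ (\sum_(c : {ffun 'I_n -> 'I_3}) (\prod_(e : 'I_n) 3^-1) * expR (lam ^+ 2 * v ^+ 2 * (k%:R * Fb)))).
  apply: ler_sum => c _; rewrite ler_wpM2l//; last exact: (colored_mgf p0 p1 Ak v0 hy).
  by apply: prodr_ge0 => e _; rewrite invr_ge0.
by rewrite -mulr_suml color_weight_sum1 mul1r.
Qed.

End triangle_tail_net.

(** * Sub-Gaussian bound for a centered Bernoulli variable *)

Section bernoulli.
Context {R : realType}.
Implicit Types p t x : R.

Lemma expR_sub_le_sqr x : x <= 0 -> expR x - 1 - x <= x ^+ 2.
Proof.
move=> x0; have h := expR_ge1Dx (- x); rewrite expRN in h.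
have e0 := expR_gt0 x.
have h2 : (1 - x) * expR x <= 1.
  by have := ler_wpM2r (ltW e0) h; rewrite mulVf ?gt_eqF.
have h3 : 1 <= (1 + x + x ^+ 2) * (1 - x).
  have -> : (1 + x + x ^+ 2) * (1 - x) = 1 + (- x) * x ^+ 2 by ring.
  by rewrite lerDl mulr_ge0 ?sqr_ge0// oppr_ge0.
have h4 : expR x <= 1 + x + x ^+ 2.
  have x1 : 0 < 1 - x by lra.
  by rewrite -(ler_pM2r x1) mulrC; apply: le_trans h2 h3.
lra.
Qed.

Lemma expR_sub_le_sqr_expR t : 0 <= t -> expR t - 1 - t <= t ^+ 2 * expR t.
Proof.
move=> t0; have h := expR_ge1Dx (- t); rewrite expRN in h.
have e0 := expR_gt0 t.
have h2 : (1 - t) * expR t <= 1.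
  by have := ler_wpM2r (ltW e0) h; rewrite mulVf ?gt_eqF.
have h3 : expR t - 1 <= t * expR t by move: h2; rewrite mulrBl mul1r; lra.
have := ler_wpM2l t0 h3; move: h3; rewrite expr2 -mulrA; lra.
Qed.

(** Three ranges, with [L = ln (1/p)]. For [t >= L / 2] the variable is at most 1 and
    [t <= 2 * t ^+ 2 / L]. For [t <= 0] the second-order remainder is at most [p * t ^+ 2], and
    [p * L <= 1]. In between, [expR t] is at most [1 / sqrt p], and [sqrt p * L <= 2]. *)
Lemma bernoulli_subgaussian p t : 0 < p -> p <= 2^-1 ->
  \sum_(b : bool) bern p b * expR (t * cval p b) <= expR (4 / ln p^-1 * t ^+ 2 / 2).
Proof.
move=> p0 p1; set L := ln p^-1.
have hp : 0 < p <= 2^-1 by rewrite p0.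
have L0 : 0 < L by exact: ln_inv_gt0.
have pi1 : 1 <= p^-1 by rewrite invf_ge1//; lra.
have -> : 4 / L * t ^+ 2 / 2 = 2 * t ^+ 2 / L by field; rewrite gt_eqF.
rewrite big_bool /= /cval/= mulr1n mulr0n sub0r.
have [tL|tL] := leP (L / 2) t.
  have t0 : 0 <= t by apply: le_trans tL; rewrite divr_ge0// ltW.
  have h : t <= 2 * t ^+ 2 / L.
    rewrite ler_pdivlMr// expr2 mulrCA; apply: ler_wpM2l => //; lra.
  have e1 : t * (1 - p) <= 2 * t ^+ 2 / L by apply: le_trans h; rewrite ler_piMr//; lra.
  have e2 : t * - p <= 2 * t ^+ 2 / L.
    by apply: le_trans h; apply: (@le_trans _ _ 0) => //; rewrite mulrN oppr_le0 mulr_ge0// ltW.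
  have q0 : 0 <= 1 - p by lra.
  have := ler_wpM2l q0 (etrans (ler_expR _ _) e2).
  have := ler_wpM2l (ltW p0) (etrans (ler_expR _ _) e1); lra.
have -> : p * expR (t * (1 - p)) + (1 - p) * expR (t * - p) = expR (- (t * p)) * (1 + p * (expR t - 1)).
  by rewrite mulrBr mulr1 expRD mulrN; ring.
apply: (@le_trans _ _ (expR (- (t * p)) * expR (p * (expR t - 1)))).
  by rewrite ler_wpM2l ?expR_ge0// expR_ge1Dx.
rewrite -expRD ler_expR.
have -> : - (t * p) + p * (expR t - 1) = p * (expR t - 1 - t) by ring.
have t2 := sqr_ge0 t.
have pL : p * L <= 1 by exact: mul_ln_inv_le1.
have [t0|t0] := leP t 0.
  rewrite ler_pdivlMr//.
  apply: (@le_trans _ _ (t ^+ 2 * (p * L))); last first.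
    by have := ler_wpM2l t2 pL; lra.
  have -> : p * (expR t - 1 - t) * L = (expR t - 1 - t) * (p * L) by ring.
  apply: ler_wpM2r; last exact: expR_sub_le_sqr.
  by apply: mulr_ge0; exact: ltW.
have h := expR_sub_le_sqr_expR (ltW t0).
have [sp0 spp spL] : [/\ 0 < Num.sqrt p, Num.sqrt p * Num.sqrt p = p & Num.sqrt p * L <= 2].
  have s0 : 0 < Num.sqrt p by rewrite sqrtr_gt0.
  have ss : Num.sqrt p * Num.sqrt p = p by rewrite -expr2 sqr_sqrtr// ltW.
  split => //.
  have -> : L = 2 * ln (Num.sqrt p)^-1.
    by rewrite /L -{1}ss invfM lnM ?posrE ?invr_gt0//; ring.
  have h2 : ln (Num.sqrt p)^-1 < (Num.sqrt p)^-1 by apply: ln_sublinear; rewrite invr_gt0.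
  have h3 := ler_wpM2l (ltW s0) (ltW h2).
  by rewrite mulfV ?gt_eqF// in h3; lra.
have et : expR t * Num.sqrt p <= 1.
  have -> : Num.sqrt p = expR (- (L / 2)).
    by rewrite -[in LHS](expR_half_ln p0) sqrtr_sqr ger0_norm ?expR_ge0.
  by rewrite -expRD -[leRHS]expR0 ler_expR; lra.
rewrite ler_pdivlMr//.
apply: (@le_trans _ _ (p * (t ^+ 2 * expR t) * L)).
  by apply: ler_wpM2r; [exact: ltW|apply: ler_wpM2l => //; exact: ltW].
have -> : p * (t ^+ 2 * expR t) * L = t ^+ 2 * ((expR t * Num.sqrt p) * (Num.sqrt p * L)).
  by rewrite -{1}spp; ring.
rewrite (mulrC 2); apply: ler_wpM2l => //.
apply: le_trans (ler_wpM2r _ et) _; last by rewrite mul1r.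
by rewrite mulr_ge0 ?ltW.
Qed.

End bernoulli.

(** * The scan statistic under the null model *)

Section scan_tail.
Context {R : realType}.
Variables (n k : nat) (p g : R).
Hypotheses (n1 : (1 < n)%N) (k0 : (0 < k)%N) (kn : (k <= n)%N) (p0 : 0 < p) (p1 : p <= 2^-1).
Local Notation l := (ln (n%:R : R)).
Local Notation L := (ln p^-1).
Hypotheses (l1 : 1 <= l) (Ll : L <= l) (kl : 512 * l ^+ 2 <= k%:R) (g0 : 0 <= g).
Hypothesis gk : 2 ^+ 25 * k%:R ^+ 4 * l <= g ^+ 2 * L ^+ 3.
Local Notation E := (@Ew R ('I_n * 'I_n)%type (fun _ => bern p)).

Let L0 : 0 < L. Proof. by apply: ln_inv_gt0; rewrite p0 p1. Qed.
Let k1 : 1 <= k%:R :> R. Proof. by rewrite ler1n. Qed.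
Let ple1 : p <= 1. Proof. by apply: le_trans p1 _; rewrite invf_le1// ler1n. Qed.

Lemma triangle_sum_tail_ln (A : {set 'I_n}) : (#|A| <= k)%N ->
  E (fun om => (g < triangle_sum p A om)%R%:R) <= 3 * expR (- (3 * (k%:R * l))).
Proof.
move=> Ak.
have l0 : 0 < l := lt_le_trans ltr01 l1.
have K0 : 0 < k%:R :> R := lt_le_trans ltr01 k1.
have v0 : 0 < 4 / L by rewrite divr_gt0.
(* With [v = 4 / L] and Frobenius bound [128 k^2 / L], this [lam] makes the quadratic term of the
   exponent equal to [4 k l], while [s = 64 v k l] keeps the condition on [lam] within
   [512 l^2 <= k]. *)
pose lam := Num.sqrt (l * L ^+ 3 / (512 * k%:R ^+ 2)).
have lamE : lam ^+ 2 = l * L ^+ 3 / (512 * k%:R ^+ 2).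
  rewrite sqr_sqrtr; first exact: erefl.
  apply: divr_ge0; apply: mulr_ge0; [exact: ltW|exact: exprn_ge0 (ltW L0)|exact: ler0n|exact: sqr_ge0].
have lam0 : 0 <= lam by exact: sqrtr_ge0.
clearbody lam.
move: K0 (k1) (kl) (gk) lamE; set kk : R := k%:R => K0 k1' kl'' gk' lamE.
have kl0 : 0 <= kk * l by apply: mulr_ge0; exact: ltW.
have s0 : 0 <= 64 * (4 / L) * (kk * l).
  by apply: mulr_ge0 => //; apply: mulr_ge0; [exact: ler0n|exact: ltW].
have kl' : kk * l <= kk * kk.
  rewrite (ler_pM2l K0); apply: le_trans kl''; rewrite expr2; have := ler_wpM2l (ltW l0) l1; move: l1; lra.
have llkk : l * L <= l ^+ 2 by rewrite expr2 (ler_pM2l l0).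
have hlam : 4 * lam ^+ 2 * (4 / L) ^+ 2 * (8 * (64 * (4 / L) * (kk * l)) + 2) <= 1.
  rewrite lamE.
  have -> : 4 * (l * L ^+ 3 / (512 * kk ^+ 2)) * (4 / L) ^+ 2 * (8 * (64 * (4 / L) * (kk * l)) + 2) =
    (256 * l ^+ 2 * kk + l * L / 4) / kk ^+ 2 by field; rewrite !gt_eqF.
  rewrite ler_pdivrMr ?exprn_gt0// mul1r.
  have := ler_wpM2r (ltW K0) kl''; rewrite -expr2.
  have := ler_wpM2l (sqr_ge0 l) k1'; have := sqr_ge0 l; move: llkk; lra.
have := triangle_sum_tail (ltW p0) ple1 Ak v0 (fun t => bernoulli_subgaussian t p0 p1)
  (128 * kk ^+ 2 / L) g k0 s0 lam0 hlam.
move=> h; apply: (le_trans h); rewrite -/kk.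
(* Here [2 ^ 25] is [512 * 256 ^ 2]. Since [256 / 27 > 7], the linear term exceeds the quadratic
   term [4 k l] by more than [3 k l]. *)
have gl : 256 * (kk * l) <= lam * g.
  have gl0 := mulr_ge0 lam0 g0.
  have kl1 : 0 <= 256 * (kk * l) by apply: mulr_ge0; first exact: ler0n.
  rewrite -ler_sqr; [|exact: kl1|exact: gl0].
  rewrite exprMn [in leRHS]exprMn lamE.
  have -> : l * L ^+ 3 / (512 * kk ^+ 2) * g ^+ 2 = (g ^+ 2 * L ^+ 3) * (l / (512 * kk ^+ 2)) by field; rewrite gt_eqF.
  have c0 : 0 <= l / (512 * kk ^+ 2) by apply: divr_ge0; [exact: ltW|apply: mulr_ge0; [exact: ler0n|exact: sqr_ge0]].
  apply: le_trans (ler_wpM2r c0 gk').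
  by rewrite le_eqVlt; apply/orP; left; apply/eqP; field; rewrite gt_eqF.
have -> : 3 * expR (- (3 * (kk * l))) = expR (- (3 * (kk * l))) + expR (- (3 * (kk * l))) + expR (- (3 * (kk * l))) by ring.
apply: lerD; first apply: lerD.
- rewrite ler_expR.
  have -> : kk ^+ 2 / 4 - 128 * kk ^+ 2 / L / (8 * (4 / L)) = - (15 / 4 * (kk * kk)) by field; rewrite gt_eqF.
  by rewrite lerN2; move: kl' kl0; lra.
- have -> : 64 * (4 / L) * (kk * l) / (8 * (4 / L)) = 8 * (kk * l) by field; rewrite gt_eqF.
  (* The net costs at most [n ^ (4 k)], half of the exponent [8 k l] obtained for each of its
     vectors. *)
  have hn : (2 * k ^ 2).+1%:R ^+ k <= expR (4 * (kk * l)).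
    have nE : expR l = n%:R by rewrite lnK// posrE ltr0n (ltn_trans _ n1).
    have -> : 4 * (kk * l) = (k * 4)%:R * l by rewrite natrM /kk; ring.
    rewrite [in leRHS]expRM_natl nE -natrX -natrX ler_nat (mulnC k) expnM leq_exp2r//.
    apply: (@leq_trans (2 * n ^ 2).+1); first by rewrite ltnS leq_mul2l leq_exp2r.
    have q4 : (4 <= n ^ 2)%N by rewrite (leq_exp2r 2 n (isT : 0 < 2)%N).
    rewrite (expnM n 2 2); move: (n ^ 2)%N q4 => q q4.
    apply: (@leq_trans (4 * q)); last by rewrite expnS expn1 leq_mul2r q4 orbT.
    by rewrite -[4%N]/(2 + 2)%N mulnDl -addn1 leq_add2l; case: q q4.
  apply: le_trans (ler_wpM2r (expR_ge0 _) hn) _; rewrite -expRD ler_expR.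
  have := ler_wpM2l (ltW K0) l1; move: kl0; lra.
rewrite ler_expR lamE.
have -> : l * L ^+ 3 / (512 * kk ^+ 2) * (4 / L) ^+ 2 * (kk * (128 * kk ^+ 2 / L)) = 4 * (kk * l).
  by field; rewrite !gt_eqF.
move: gl kl0; lra.
Qed.

Lemma scan_tail (kap : nat) : (kap <= k)%N ->
  E (fun om => ([exists (A : {set 'I_n} | #|A| == kap), g < triangle_sum p A om])%R%:R)
    <= 3 * expR (- (2 * (k%:R * l))).
Proof.
move=> kapk.
have w1 (e : 'I_n * 'I_n) : \sum_(b : bool) bern p b = 1 by rewrite big_bool/= addrC subrK.
have w0 (e : 'I_n * 'I_n) b : 0 <= bern p b by case: b => /=; [exact: ltW|rewrite subr_ge0].
apply: (@le_trans _ _ (E (fun om => \sum_(A : {set 'I_n} | #|A| == kap) (g < triangle_sum p A om)%R%:R))).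
  apply: Ew_le => // om; case: existsP => [[A /andP[cA hA]]|_] /=; last by apply: sumr_ge0.
  by rewrite (bigD1 A)//= hA lerDl sumr_ge0.
rewrite Ew_sum.
apply: (@le_trans _ _ (\sum_(A : {set 'I_n} | #|A| == kap) 3 * expR (- (3 * (k%:R * l))))).
  by apply: ler_sum => A /eqP cA; apply: triangle_sum_tail_ln; rewrite cA.
rewrite sumr_const.
have -> : #|[pred A : {set 'I_n} | #|A| == kap]| = 'C(n, kap) by rewrite -[in RHS](card_ord n) -card_draws; apply: eq_card => A; rewrite !inE.
have -> : - (2 * (k%:R * l)) = k%:R * l + - (3 * (k%:R * l)) by ring.
have nE : expR l = n%:R by rewrite lnK// posrE ltr0n (ltn_trans _ n1).
rewrite expRD expRM_natl nE -[leLHS]mulr_natl [leRHS]mulrCA.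
apply: ler_wpM2r; first by rewrite mulr_ge0// expR_ge0.
rewrite -natrX ler_nat.
apply: leq_trans (_ : n ^ kap <= _)%N; last by rewrite leq_pexp2l// (ltn_trans _ n1).
apply: (@leq_trans (n ^_ kap)); first by rewrite -bin_ffact -[X in (X <= _)%N]muln1 leq_mul// fact_gt0.
rewrite ffact_prod; apply: leq_trans (_ : \prod_(i < kap) n <= _)%N.
  by apply: leq_prod => i _; exact: leq_subr.
by rewrite prod_nat_const card_ord.
Qed.

End scan_tail.

Lemma prod_pair (V : comPzSemiRingType) (I J : finType) (F : I * J -> V) :
  \prod_q F q = \prod_i \prod_j F (i, j).
Proof. by rewrite (pair_bigA _ (fun i j => F (i, j))); apply: eq_bigr => -[]. Qed.

(** * Random graphs as functions on pairs *)

Section graph_of_pairs.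
Context {R : realType} {n : nat}.
Local Notation I := ('I_n * 'I_n)%type.
Implicit Types (om : {ffun I -> bool}) (G : graph n).

(** Product laws are indexed by all ordered pairs; the graph reads the coordinates with [e.1 < e.2],
    and the others integrate to 1. *)
Definition edge_set om : {set I} :=
  [set e : I | if (e.1 < e.2)%N then om e else (e.2 < e.1)%N && om (e.2, e.1)]%SET.

Lemma edge_set_simple om : simple_edges (edge_set om).
Proof.
apply/andP; split; apply/forallP => i; first by rewrite inE/= ltnn.
apply/forallP => j; rewrite !inE/=; case: (ltngtP i j) => //= _; exact: eqxx.
Qed.

Definition graph_of om : graph n := Sub (edge_set om) (edge_set_simple om).

Lemma adj_graph_of om (i j : 'I_n) : (i < j)%N -> adj (graph_of om) i j = om (i, j).
Proof. by move=> ij; rewrite /adj SubK inE/= ij. Qed.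

Lemma graph_eqP G G' : (forall i j : 'I_n, (i < j)%N -> adj G i j = adj G' i j) -> G = G'.
Proof.
move=> h; apply: val_inj; apply/setP => -[i j]; rewrite -/(adj G i j) -/(adj G' i j).
have sym (H : graph n) i' j' : adj H i' j' = adj H j' i' :> bool.
  by case: H => H /= /[dup] /andP[_ /forallP/(_ i')/forallP/(_ j')/eqP hs] hh; rewrite /adj/=.
have irr (H : graph n) i' : adj H i' i' = false :> bool.
  by apply/negbTE; case: H => H /= /[dup] /andP[/forallP/(_ i') hs _] hh; rewrite /adj/=.
have [ij|ji|/ord_inj ->] := ltngtP i j; first exact: h.
  by rewrite sym (sym G') h.
by rewrite !irr.
Qed.

Definition graph_law (w : I -> bool -> R) G : R :=
  \prod_(i < n) \prod_(j < n | (i < j)%N) w (i, j) (adj G i j).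

Lemma graph_lawE (w : I -> bool -> R) G : (forall e, \sum_(b : bool) w e b = 1) ->
  graph_law w G = Ew w (fun om => (graph_of om == G)%:R).
Proof.
move=> w1.
pose f (e : I) c : R := if (e.1 < e.2)%N then (c == adj G e.1 e.2)%:R else 1.
have -> : Ew w (fun om => (graph_of om == G)%:R) = Ew w (fun om => \prod_e f e (om e)).
  apply: eq_Ew => om; have [eG|neq] := eqVneq (graph_of om) G.
    rewrite big1// => -[i j] _; rewrite /f/=; case: ifP => // ij.
    by rewrite -eG adj_graph_of// eqxx.
  suff [e he] : exists e, f e (om e) = 0 by rewrite (bigD1 e)//= he mul0r.
  apply: contrapT => hn; case/eqP: neq; apply: graph_eqP => i j ij.
  rewrite adj_graph_of//; apply/eqP/negPn/negP => /negbTE ne; apply: hn; exists (i, j).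
  by rewrite /f/= ij ne.
rewrite Ew_prod prod_pair; apply: eq_bigr => i _; rewrite big_mkcond; apply: eq_bigr => j _ /=.
rewrite /f/=; case: ifP => _; last by rewrite -[LHS](w1 (i, j)); apply: eq_bigr => c _; rewrite mulr1.
by rewrite (bigD1 (adj G i j))//= eqxx mulr1 big1 ?addr0// => c /negbTE ->; rewrite mulr0.
Qed.

Lemma expect_graph_law (w : I -> bool -> R) (f : graph n -> R) :
  (forall e, \sum_(b : bool) w e b = 1) ->
  expect (graph_law w) f = Ew w (f \o graph_of).
Proof.
move=> w1; rewrite /expect.
under eq_bigr do rewrite graph_lawE// /Ew mulr_suml.
rewrite exchange_big/=; apply: eq_bigr => om _.
rewrite (bigD1 (graph_of om))//= eqxx mulr1 big1 ?addr0// => G.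
by rewrite eq_sym => /negbTE ->; rewrite mulr0 mul0r.
Qed.

Lemma prob_expect (law : graph n -> R) (A : pred (graph n)) :
  prob law A = expect law (fun G => (A G)%:R).
Proof.
rewrite /prob /expect big_mkcond/=; apply: eq_bigr => G _.
by case: (A G); rewrite ?mulr1 ?mulr0.
Qed.

Lemma Ew_det (w : I -> bool -> R) (D : {set I}) (om0 : {ffun I -> bool}) f :
  (forall e, \sum_(b : bool) w e b = 1) ->
  (forall e b, e \in D -> w e b = (b == om0 e)%:R) ->
  (forall om, (forall e, e \in D -> om e = om0 e) -> f om = f om0) ->
  Ew w f = f om0.
Proof.
move=> w1 wD fD; rewrite -[RHS](Ew_cst w1); apply: eq_bigr => om _.
have [/forall_inP h|] := boolP [forall e in D, om e == om0 e].
  by congr (_ * _); apply: fD => e /h/eqP.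
rewrite negb_forall_in => /existsP[e /andP[eD /negbTE ne]].
by rewrite /Pw (bigD1 e)//= wD// ne !mul0r.
Qed.

End graph_of_pairs.

Section planted_expectation.
Context {R : realType}.
Variables (n d : nat) (p : R).
Local Notation I := ('I_n * 'I_n)%type.
Local Notation t := (tau p d).
Local Notation mu := (@sphere_points R n d).
Implicit Types (U : n.-tuple (@vec R d)) (S : {set 'I_n}).

Definition visible U : {ffun I -> bool} :=
  [ffun e => (t <= dot (tnth U e.1) (tnth U e.2))%R].

(** Given the hidden set and the points, the edges are independent, those inside [S] being
    deterministic. The planted law is thus a mixture of product laws. *)
Definition planted_pair S U (e : I) (b : bool) : R :=
  if (e.1 \in S) && (e.2 \in S) then (b == visible U e)%:R else bern p b.

Lemma planted_pair_sum1 S U e : \sum_(b : bool) planted_pair S U e b = 1.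
Proof.
rewrite /planted_pair; case: (_ && _); last by rewrite big_bool/= addrC subrK.
by rewrite big_bool/=; case: (visible U e); rewrite ?addr0 ?add0r.
Qed.

Lemma bmeas_visible (e : I) b : bmeas (fun U => (b == visible U e)%:R : R).
Proof.
have h : bmeas (fun U => (visible U e)%:R : R).
  have := @bmeas_edge R d t _ _ _ _ (@measurable_tnth _ (@vec R d) n e.1)
    (@measurable_tnth _ (@vec R d) n e.2).
  by rewrite (_ : (fun U => _) = (fun U => (visible U e)%:R))//; apply/funext => U; rewrite ffunE.
case: b; last first.
  rewrite (_ : (fun _ => _) = (fun U => 1 - (visible U e)%:R)).
    by apply: bmeasB => //; exact: bmeas_cst.
  by apply/funext => U; case: (visible U e); rewrite ?subrr ?subr0.
by rewrite (_ : (fun _ => _) = (fun U => (visible U e)%:R))//; apply/funext => U; case: (visible U e).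
Qed.

Lemma sphere_points1 : mu setT = 1%E.
Proof. by apply: power_setT1; exact: probability_setT. Qed.

Lemma bmeas_prod {d' : measure_display} {T : measurableType d'} (J : Type) (s : seq J) (P : pred J) (f : J -> T -> R) :
  (forall i, bmeas (f i)) -> bmeas (fun x => \prod_(i <- s | P i) f i x).
Proof.
move=> hf; elim: s => [|i s IH].
  by under eq_fun do rewrite big_nil; exact: bmeas_cst.
under eq_fun do rewrite big_cons; case: (P i) => //; exact: bmeasM.
Qed.

Lemma bmeas_planted_pair S e b : bmeas (fun U => planted_pair S U e b).
Proof.
rewrite /planted_pair; case: (_ && _); [exact: bmeas_visible|exact: bmeas_cst].
Qed.

Lemma bmeas_graph_law S G : bmeas (fun U => graph_law (planted_pair S U) G).
Proof. by apply: bmeas_prod => i; apply: bmeas_prod => j; exact: bmeas_planted_pair. Qed.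

Lemma planted_given_Ex S G :
  planted_given p d S G = Ex mu (fun U => graph_law (planted_pair S U) G).
Proof.
pose x (U : n.-tuple (@vec R d)) i j : R := if (i \in S) && (j \in S) then (adj G i j == visible U (i, j))%:R else 1.
pose C : R := \prod_(i < n) \prod_(j < n | (i < j)%N && ~~ ((i \in S) && (j \in S))) bern p (adj G i j).
pose X U := \prod_(i < n) \prod_(j < n | (i < j)%N) x U i j.
have lawE U : graph_law (planted_pair S U) G = C * X U.
  rewrite /graph_law /X /C -big_split; apply: eq_bigr => i _ /=.
  rewrite [X in _ = X * _]big_mkcondr -big_split; apply: eq_bigr => j _ /=.
  by rewrite /planted_pair/x/=; case: ifP => _; rewrite ?mul1r ?mulr1.
have mX : bmeas X.
  apply: bmeas_prod => i; apply: bmeas_prod => j; rewrite /x; case: (_ && _); last exact: bmeas_cst.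
  exact: bmeas_visible.
transitivity (Ex mu (fun U => C * X U)); last first.
  by rewrite /Ex; congr (Rintegral _ _ _); apply/funext => U; rewrite lawE.
rewrite (ExZ sphere_points1 _ mX) mulrC.
congr (_ * _).
pose b U := [forall i : 'I_n, forall j : 'I_n, [==> (i < j)%N, i \in S, j \in S => adj G i j == visible U (i, j)]].
pose A := [set U : n.-tuple (@vec R d) | forall i j : 'I_n, (i < j)%N -> i \in S -> j \in S ->
    adj G i j = (t <= dot (tnth U i) (tnth U j))].
have bA U : b U <-> A U.
  split=> [/forallP h i j ij iS jS|h].
    by have /forallP/(_ j) := h i; rewrite ij iS jS/= ffunE/= => /eqP.
  apply/forallP => i; apply/forallP => j; apply/implyP => ij; apply/implyP => iS; apply/implyP => jS.
  by rewrite ffunE/=; apply/eqP; exact: h.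
have bX U : (b U)%:R = X U.
  have [h|h] := boolP (b U).
    rewrite /X big1// => i _; rewrite big1// => j ij; rewrite /x; case: ifP => // /andP[iS jS].
    by have /forallP/(_ i)/forallP/(_ j) := h; rewrite ij iS jS/= => ->.
  have := h; rewrite negb_forall => /existsP[i]; rewrite negb_forall => /existsP[j].
  rewrite !negb_imply => /and4P[ij iS jS /negbTE ne].
  by rewrite /X (bigD1 i)//= (bigD1 j)//= /x iS jS ne/= !mul0r.
(* The event is a level set of [X], a product of bounded measurable indicators. *)
have mA : measurable A.
  have -> : A = X @^-1` [set 1].
    apply/seteqP; split => U /=.
      by move=> /bA h; rewrite -bX h.
    by rewrite -bX => h; apply/bA; move: h; case: (b U) => //= /eqP; rewrite eq_sym oner_eq0.
  by rewrite -[_ @^-1` _]setTI; apply: mX.1.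
rewrite -(Ex_indic mu mA bA) /Ex; congr (Rintegral _ _ _); apply/funext => U; exact: bX.
Qed.

(** For such functions the expectation given [S] only involves the points: the edges leaving [S]
    integrate out. *)
Definition inside (V : Type) S (f : graph n -> V) := forall G G',
  (forall i j : 'I_n, (i < j)%N -> i \in S -> j \in S -> adj G i j = adj G' i j) -> f G = f G'.

Lemma Ew_planted_pair S (f : graph n -> R) U : inside S f ->
  Ew (planted_pair S U) (f \o graph_of) = f (graph_of (visible U)).
Proof.
move=> hf.
rewrite (@Ew_det _ _ _ [set e : I | (e.1 \in S) && (e.2 \in S)]%SET (visible U))//.
- exact: planted_pair_sum1.
- by move=> e b; rewrite inE /planted_pair => ->.
- move=> om h; apply: hf => i j ij iS jS; rewrite !adj_graph_of//.
  by apply: h; rewrite inE/= iS jS.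
Qed.

Lemma expect_planted_given S (f : graph n -> R) : inside S f ->
  expect (planted_given p d S) f = Ex mu (fun U => f (graph_of (visible U))).
Proof.
move=> hf; rewrite /expect; under eq_bigr do rewrite planted_given_Ex mulrC.
transitivity (Ex mu (fun U => \sum_G f G * graph_law (planted_pair S U) G)).
  have h G : bmeas (fun U => f G * graph_law (planted_pair S U) G).
    by apply: bmeasM; [exact: bmeas_cst|exact: bmeas_graph_law].
  rewrite (Ex_sum sphere_points1 _ _ h); apply: eq_bigr => G _.
  by rewrite (ExZ sphere_points1 _ (bmeas_graph_law S G)).
rewrite /Ex; congr (Rintegral _ _ _); apply/funext => U.
rewrite -(Ew_planted_pair _ hf) -expect_graph_law; last exact: planted_pair_sum1.
by apply: eq_bigr => G _; rewrite mulrC.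
Qed.

Lemma geometric_planted_given : @Defs.geometric R n p d = planted_given p d [set: 'I_n]%SET.
Proof.
apply/funext => G; rewrite /Defs.geometric /planted_given [X in _ * X]big1 ?mulr1; last first.
  by move=> i _; rewrite big1// => j; rewrite !inE andbF.
congr (fine (sphere_points n d _)); apply/seteqP; split => U /= h i j ij; first by move=> _ _; exact: h.
by apply: h => //; rewrite inE.
Qed.

End planted_expectation.

(** * Moments of signed triangles on the sphere *)

Section signed_triangles.
Context {R : realType}.
Variables (n m : nat) (t p : R).
Local Notation d := m.+2.
Local Notation nu := (@uniform_sphere R d).
Local Notation mu := (@sphere_points R n d).
Implicit Types (U : n.-tuple (@vec R d)) (u b c : @vec R d).
Hypotheses (p0 : 0 <= p) (p1 : p <= 1) (capt : @capP R m.+1 t = p).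

Definition sedge u b : R := edge t u b - p.

Definition striangle u b c : R := sedge u b * sedge b c * sedge u c.

(** [Ex_striangle] identifies it with the mean of a signed triangle. This form makes the lower bound
    on [triangle_prob] directly applicable. *)
Definition signed_mean : R := triangle_prob t (axis m.+1) - p ^+ 3.

Local Notation T := signed_mean.

Lemma Ex_sphere_eq (f g : @vec R d -> R) : bmeas f -> bmeas g ->
  (forall x, enorm x = 1 -> f x = g x) -> Ex nu f = Ex nu g.
Proof.
move=> hf hg fg.
exact: (@Ex_ae _ _ _ nu _ f g (@measurable_unit R d) (@uniform_sphere_unit R m.+1) hf hg fg).
Qed.

Lemma sedgeC u b : sedge u b = sedge b u.
Proof. by rewrite /sedge /edge dotC. Qed.

Lemma striangleC12 u b c : striangle u b c = striangle b u c.
Proof. by rewrite /striangle (sedgeC u b); ring. Qed.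

Lemma striangleC13 u b c : striangle u b c = striangle c b u.
Proof. by rewrite /striangle (sedgeC u b) (sedgeC b c) (sedgeC u c); ring. Qed.

Lemma sedge_norm_le1 u b : `|sedge u b| <= 1.
Proof.
have := edge_ge0 t u b; have := edge_le1 t u b; rewrite /sedge ler_norml => h1 h2.
by apply/andP; split; move: p0 p1 h1 h2; lra.
Qed.

Lemma bmeas_sedge d' (X : measurableType d') (f g : X -> @vec R d) :
  measurable_fun setT f -> measurable_fun setT g -> bmeas (fun x => sedge (f x) (g x)).
Proof. by move=> mf mg; apply: bmeasB; [exact: bmeas_edge|exact: bmeas_cst]. Qed.

Lemma bmeas_striangle d' (X : measurableType d') (f g h : X -> @vec R d) :
  measurable_fun setT f -> measurable_fun setT g -> measurable_fun setT h ->
  bmeas (fun x => striangle (f x) (g x) (h x)).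
Proof.
by move=> mf mg mh; apply: bmeasM; [apply: bmeasM|]; exact: bmeas_sedge.
Qed.

Lemma bmeas_sedgel u : bmeas (sedge u).
Proof. by apply: bmeas_sedge; [exact: measurable_cst|exact: measurable_id]. Qed.

Lemma Ex_edge_unit u : enorm u = 1 -> Ex nu (edge t u) = p.
Proof. by move=> u1; rewrite -capt -(edge_measure_unit t u1). Qed.

Definition spath u b : R := Ex nu (fun c => sedge b c * sedge u c).

Lemma bmeas_spath i j : bmeas (fun U => spath (tnth U i) (tnth U j)).
Proof.
have mt (i' : 'I_n) : measurable_fun setT (fun v : n.-tuple (@vec R d) * @vec R d => tnth v.1 i').
  exact: (measurableT_comp (@measurable_tnth _ (@vec R d) n i') measurable_fst).
have h := bmeasM (bmeas_sedge (mt j) measurable_snd) (bmeas_sedge (mt i) measurable_snd).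
exact: (bmeas_Ex (@sphere_points1 R n m.+2) (sphere1 _) h).
Qed.

(** Cauchy-Schwarz, both signed edges having variance [p - p ^+ 2]. *)
Lemma spath_norm_le u b : enorm u = 1 -> enorm b = 1 -> `|spath u b| <= p.
Proof.
move=> u1 b1.
have sq v : enorm v = 1 -> Ex nu (fun c => sedge v c ^+ 2) = p - p ^+ 2.
  move=> v1.
  have -> : (fun c => sedge v c ^+ 2) = (fun c => (1 - 2 * p) * edge t v c + p ^+ 2).
    apply/funext => c; rewrite /sedge /edge.
    by case: (_ <= _); rewrite ?mulr1n ?mulr0n; ring.
  rewrite (ExD (sphere1 _) (bmeasZ _ (bmeas_edgel t v)) (bmeas_cst _)).
  rewrite (ExZ (sphere1 _) _ (bmeas_edgel t v)) Ex_edge_unit// Ex_cst; last exact: sphere1.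
  ring.
apply: le_trans (Ex_mul_le (sphere1 _) (bmeas_sedgel b) (bmeas_sedgel u) _) _.
  by rewrite !sq.
by rewrite sq// lerBlDr lerDl sqr_ge0.
Qed.

Lemma spathE u b : enorm u = 1 -> enorm b = 1 -> spath u b = codegree t u b - p ^+ 2.
Proof.
move=> u1 b1; rewrite /spath.
have he (w v : @vec R d) : bmeas (fun c => edge t w c * edge t v c).
  by apply: bmeasM; exact: bmeas_edgel.
have -> : (fun c => sedge b c * sedge u c) =
  (fun c => (edge t b c * edge t u c - p * edge t b c) - (p * edge t u c - p ^+ 2)).
  by apply/funext => c; rewrite /sedge; ring.
have h1 := bmeasB (he b u) (bmeasZ p (bmeas_edgel t b)).
have h2 := bmeasB (bmeasZ p (bmeas_edgel t u)) (bmeas_cst (p ^+ 2)).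
rewrite (ExB (sphere1 _) h1 h2) (ExB (sphere1 _) (he b u) (bmeasZ p (bmeas_edgel t b))).
rewrite (ExB (sphere1 _) (bmeasZ p (bmeas_edgel t u)) (bmeas_cst (p ^+ 2))).
rewrite !(ExZ (sphere1 _) p (bmeas_edgel t _)) !Ex_edge_unit// Ex_cst; last exact: sphere1.
by rewrite /codegree; ring.
Qed.

Lemma Ex_codegree u : enorm u = 1 -> Ex nu (codegree t u) = p ^+ 2.
Proof.
move=> u1; rewrite /codegree.
have hb : bmeas (fun v : @vec R d * @vec R d => edge t v.1 v.2 * edge t u v.2).
  by apply: bmeasM; apply: bmeas_edge; [exact: measurable_fst|exact: measurable_snd|
    exact: measurable_cst|exact: measurable_snd].
rewrite (Ex_swap (sphere1 _) (sphere1 _) hb) /=.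
transitivity (Ex nu (fun c => p * edge t u c)); last first.
  by rewrite (ExZ (sphere1 _) p (bmeas_edgel t u)) Ex_edge_unit// expr2.
apply: Ex_sphere_eq.
- exact: (bmeas_Ex (sphere1 _) (sphere1 _) (f := fun v => edge t v.2 v.1 * edge t u v.1)
   (bmeasM (bmeas_edge t measurable_snd measurable_fst) (bmeas_edge t (measurable_cst u) measurable_fst))).
- exact: bmeasZ (bmeas_edgel t u).
- move=> c c1 /=.
  have -> : (fun x => edge t x c * edge t u c) = (fun x => edge t u c * edge t c x).
    by apply/funext => x; rewrite mulrC /edge (dotC x).
  by rewrite (ExZ (sphere1 _) _ (bmeas_edgel t c)) Ex_edge_unit// mulrC.
Qed.

(** Expand the product: two edges with a common vertex are independent, so all terms but the full
    triangle combine into [- p ^+ 3]. *)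
Lemma Ex_striangle u : enorm u = 1 -> Ex nu (fun b => Ex nu (fun c => striangle u b c)) = T.
Proof.
move=> u1.
have h0 : bmeas (fun b => Ex nu (fun c => striangle u b c)).
  apply: (bmeas_Ex (sphere1 _) (sphere1 _) (f := fun v => striangle u v.1 v.2)).
  by apply: bmeas_striangle; [exact: measurable_cst|exact: measurable_fst|exact: measurable_snd].
have hc := bmeas_codegree t u.
have he := bmeas_edgel t u.
have h1 : bmeas (fun b => (edge t u b * codegree t u b - p ^+ 2 * edge t u b) - (p * codegree t u b - p ^+ 3)).
  apply: bmeasB; apply: bmeasB; [exact: bmeasM|exact: bmeasZ|exact: bmeasZ|exact: bmeas_cst].
transitivity (Ex nu (fun b => (edge t u b * codegree t u b - p ^+ 2 * edge t u b) - (p * codegree t u b - p ^+ 3))).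
  apply: (Ex_sphere_eq h0 h1) => b /= b1.
  have -> : (fun c => striangle u b c) = (fun c => sedge u b * (sedge b c * sedge u c)).
    by apply/funext => c; rewrite /striangle mulrA.
  rewrite (ExZ (sphere1 _) _ (bmeasM (bmeas_sedgel b) (bmeas_sedgel u))) -/(spath u b) spathE//.
  by rewrite /sedge; ring.
rewrite (ExB (sphere1 _) (bmeasB (bmeasM he hc) (bmeasZ _ he)) (bmeasB (bmeasZ _ hc) (bmeas_cst _))).
rewrite (ExB (sphere1 _) (bmeasM he hc) (bmeasZ _ he)) (ExB (sphere1 _) (bmeasZ _ hc) (bmeas_cst _)).
rewrite (ExZ (sphere1 _) _ he) (ExZ (sphere1 _) _ hc) Ex_codegree// Ex_edge_unit// Ex_cst; last exact: sphere1.
by rewrite -/(triangle_prob t u) triangle_prob_axis// /T; ring.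
Qed.

Definition tri U (i j l : 'I_n) : R := striangle (tnth U i) (tnth U j) (tnth U l).

Lemma bmeas_tri i j l : bmeas (fun U => tri U i j l).
Proof. by apply: bmeas_striangle; exact: measurable_tnth. Qed.

(** Redraw [l], then [j]: given the point [i], the triangle has mean [T] wherever that point is.
    Hence [F] may depend on [i], and triangles with one common vertex are uncorrelated. *)
Lemma Ex_tri_indep (F : n.-tuple (@vec R d) -> R) i j l :
  i != j -> i != l -> j != l -> bmeas F ->
  (forall U u, F (upd U j u) = F U) -> (forall U u, F (upd U l u) = F U) ->
  Ex mu (fun U => F U * tri U i j l) = T * Ex mu F.
Proof.
move=> ij il jl hF Fj Fl.
have h1 : bmeas (fun U => F U * tri U i j l) by apply: bmeasM => //; exact: bmeas_tri.
pose f2 U := Ex nu (fun c => F U * striangle (tnth U i) (tnth U j) c).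
have E1 : Ex mu (fun U => F U * tri U i j l) = Ex mu f2.
  rewrite (Ex_resample (sphere1 _) l h1); congr (Ex mu _); apply/funext => U.
  congr (Ex nu _); apply/funext => c; rewrite Fl /tri !tnth_upd eqxx.
  by rewrite (negbTE il) (negbTE jl).
have h2 : bmeas f2.
  have := bmeas_Ex_upd (sphere1 _) l h1; congr bmeas; apply/funext => U.
  congr (Ex nu _); apply/funext => c; rewrite Fl /tri !tnth_upd eqxx.
  by rewrite (negbTE il) (negbTE jl).
pose g u := Ex nu (fun b => Ex nu (fun c => striangle u b c)).
have hstr u b : bmeas (striangle u b).
  by apply: bmeas_striangle; [exact: measurable_cst|exact: measurable_cst|exact: measurable_id].
have f2E U u : Ex nu (fun b => f2 (upd U j b)) = F U * g (tnth U i).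
  rewrite /g -(ExZ (sphere1 _)).
    congr (Ex nu _); apply/funext => b; rewrite /f2 !tnth_upd eqxx (negbTE ij) Fj.
    by rewrite (ExZ (sphere1 _) _ (hstr _ _)).
  apply: (bmeas_Ex (sphere1 _) (sphere1 _) (f := fun v => striangle (tnth U i) v.1 v.2)).
  by apply: bmeas_striangle; [exact: measurable_cst|exact: measurable_fst|exact: measurable_snd].
have E2 : Ex mu f2 = Ex mu (fun U => F U * g (tnth U i)).
  rewrite (Ex_resample (sphere1 _) j h2); congr (Ex mu _); apply/funext => U.
  exact: (f2E U (tnth U i)).
have hg : bmeas (fun U => F U * g (tnth U i)).
  have := bmeas_Ex_upd (sphere1 _) j h2; congr bmeas; apply/funext => U.
  exact: (f2E U (tnth U i)).
have hg2 : bmeas (fun U => T * F U) by exact: bmeasZ.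
rewrite E1 E2 (Ex_resample (sphere1 _) i hg) -(ExZ (@sphere_points1 R n m.+2) _ hF) (Ex_resample (sphere1 _) i hg2).
congr (Ex mu _); apply/funext => U.
apply: Ex_sphere_eq.
- exact: (bmeas_section1 U (bmeas_upd i hg)).
- exact: (bmeas_section1 U (bmeas_upd i hg2)).
- by move=> u /= u1; rewrite tnth_upd eqxx /g Ex_striangle// mulrC.
Qed.

End signed_triangles.

Section signed_triangle_variance.
Context {R : realType}.
Variables (n m : nat) (t p : R).
Local Notation d := m.+2.
Local Notation nu := (@uniform_sphere R d).
Local Notation mu := (@sphere_points R n d).
Implicit Types (U : n.-tuple (@vec R d)) (u b c : @vec R d).
Hypotheses (p0 : 0 <= p) (p1 : p <= 1) (capt : @capP R m.+1 t = p).
Local Notation sedgep := (sedge t p).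
Local Notation spathp := (spath t p).
Local Notation trip := (tri t p).
Local Notation T := (signed_mean m t p).

Lemma le_Ex_unit2 i j (f g : n.-tuple (@vec R d) -> R) : i != j -> bmeas f -> bmeas g ->
  (forall U, enorm (tnth U i) = 1 -> enorm (tnth U j) = 1 -> f U <= g U) -> Ex mu f <= Ex mu g.
Proof.
move=> ij hf hg fg.
have hf1 := bmeas_Ex_upd (sphere1 d) i hf; have hg1 := bmeas_Ex_upd (sphere1 d) i hg.
rewrite (Ex_resample (sphere1 _) i hf) (Ex_resample (sphere1 _) i hg).
rewrite (Ex_resample (sphere1 _) j hf1) (Ex_resample (sphere1 _) j hg1).
have hf2 := bmeas_Ex_upd (sphere1 d) j hf1; have hg2 := bmeas_Ex_upd (sphere1 d) j hg1.
apply: (le_Ex (@sphere_points1 R n m.+2) hf2 hg2) => U.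
apply: le_Ex_sphere => [||b b1].
- exact: (bmeas_section1 U (bmeas_upd j hf1)).
- exact: (bmeas_section1 U (bmeas_upd j hg1)).
apply: le_Ex_sphere => [||a a1].
- exact: (bmeas_section1 _ (bmeas_upd i hf)).
- exact: (bmeas_section1 _ (bmeas_upd i hg)).
by apply: fg; rewrite !tnth_upd ?eqxx// eq_sym (negbTE ij) ?eqxx.
Qed.

Lemma Ex_sedge_sqr i j : i != j ->
  Ex mu (fun U => sedgep (tnth U i) (tnth U j) ^+ 2) <= p.
Proof.
move=> ij.
have hs : bmeas (fun U : n.-tuple (@vec R d) => sedgep (tnth U i) (tnth U j)).
  by apply: bmeas_sedge; exact: measurable_tnth.
have h2 := bmeasX 2 hs.
have h3 := bmeas_Ex_upd (sphere1 d) j h2.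
rewrite (Ex_resample (sphere1 _) j h2) -[leRHS](Ex_cst (@sphere_points1 R n m.+2)).
apply: (le_Ex_unit2 ij h3 (bmeas_cst _)) => U u1 _.
have -> : (fun u => sedgep (tnth (upd U j u) i) (tnth (upd U j u) j) ^+ 2) = (fun c => (1 - 2 * p) * edge t (tnth U i) c + p ^+ 2).
  apply/funext => c; rewrite !tnth_upd eqxx (negbTE ij) /sedge /edge.
  by case: (_ <= _); rewrite ?mulr1n ?mulr0n; ring.
rewrite (ExD (sphere1 _) (bmeasZ _ (bmeas_edgel t _)) (bmeas_cst _)).
rewrite (ExZ (sphere1 _) _ (bmeas_edgel t _)) (Ex_edge_unit capt)// Ex_cst; last exact: sphere1.
by have := sqr_ge0 p; lra.
Qed.

Lemma Ex_spath_indep (F : n.-tuple (@vec R d) -> R) i j l :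
  i != l -> j != l -> bmeas F -> (forall U u, F (upd U l u) = F U) ->
  Ex mu (fun U => F U * (sedgep (tnth U j) (tnth U l) * sedgep (tnth U i) (tnth U l))) =
  Ex mu (fun U => F U * spathp (tnth U i) (tnth U j)).
Proof.
move=> il jl hF Fl.
have hs i' j' : bmeas (fun U : n.-tuple (@vec R d) => sedgep (tnth U i') (tnth U j')).
  by apply: bmeas_sedge; exact: measurable_tnth.
have h1 := bmeasM hF (bmeasM (hs j l) (hs i l)).
rewrite (Ex_resample (sphere1 _) l h1); congr (Ex mu _); apply/funext => U.
have hb := bmeasM (bmeas_sedgel t p (tnth U j)) (bmeas_sedgel t p (tnth U i)).
rewrite /spath -(ExZ (sphere1 _) _ hb).
congr (Ex nu _); apply/funext => c.
by rewrite Fl !tnth_upd eqxx (negbTE il) (negbTE jl).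
Qed.

(** Integrating out [l] and [l'] separately leaves the squared signed edge times the squared signed
    codegree, which is at most [p ^+ 2]; the squared edge has mean at most [p]. *)
Lemma Ex_tri_shared_edge i j l l' : i != j -> i != l -> j != l -> i != l' -> j != l' -> l != l' ->
  Ex mu (fun U => trip U i j l * trip U i j l') <= p ^+ 3.
Proof.
move=> ij il jl il' jl' ll'.
have hs i' j' : bmeas (fun U : n.-tuple (@vec R d) => sedgep (tnth U i') (tnth U j')).
  by apply: bmeas_sedge; exact: measurable_tnth.
pose F1 U := sedgep (tnth U i) (tnth U j) ^+ 2 * (sedgep (tnth U j) (tnth U l') * sedgep (tnth U i) (tnth U l')).
have hF1 : bmeas F1 := bmeasM (bmeasX 2 (hs i j)) (bmeasM (hs j l') (hs i l')).
pose F2 U := sedgep (tnth U i) (tnth U j) ^+ 2 * spathp (tnth U i) (tnth U j).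
have hF2 : bmeas F2 := bmeasM (bmeasX 2 (hs i j)) (@bmeas_spath R n m t p i j).
have -> : (fun U => trip U i j l * trip U i j l') =
  (fun U => F1 U * (sedgep (tnth U j) (tnth U l) * sedgep (tnth U i) (tnth U l))).
  by apply/funext => U; rewrite /tri /striangle /F1; ring.
rewrite Ex_spath_indep//; last first.
  by move=> U u; rewrite /F1 !tnth_upd (negbTE il) (negbTE jl) eq_sym (negbTE ll').
have -> : (fun U => F1 U * spathp (tnth U i) (tnth U j)) =
  (fun U => F2 U * (sedgep (tnth U j) (tnth U l') * sedgep (tnth U i) (tnth U l'))).
  by apply/funext => U; rewrite /F1 /F2; ring.
rewrite Ex_spath_indep//; last by move=> U u; rewrite /F2 !tnth_upd (negbTE il') (negbTE jl').
have h3 := bmeasM hF2 (@bmeas_spath R n m t p i j); have h4 := bmeasZ (p ^+ 2) (bmeasX 2 (hs i j)).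
apply: (@le_trans _ _ (Ex mu (fun U => p ^+ 2 * sedgep (tnth U i) (tnth U j) ^+ 2))).
  apply: (le_Ex_unit2 ij h3 h4) => U u1 b1.
  rewrite /F2 -mulrA -expr2 mulrC; apply: ler_wpM2r; first exact: sqr_ge0.
  rewrite -[leLHS]real_normK ?num_real// lerXn2r ?nnegrE//.
  exact: (spath_norm_le capt).
rewrite (ExZ (@sphere_points1 R n m.+2) _ (bmeasX 2 (hs i j))) (exprSr p 2); apply: ler_wpM2l; first exact: sqr_ge0.
exact: Ex_sedge_sqr.
Qed.

Lemma triC12 U i j l : trip U i j l = trip U j i l.
Proof. exact: striangleC12. Qed.

Lemma triC13 U i j l : trip U i j l = trip U l j i.
Proof. exact: striangleC13. Qed.

Lemma tri_norm_le1 U i j l : `|trip U i j l| <= 1.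
Proof.
rewrite /tri /striangle !normrM.
by apply: mulr_ile1; rewrite ?mulr_ge0 ?mulr_ile1// sedge_norm_le1.
Qed.

Local Notation I3 := ('I_n * 'I_n * 'I_n)%type.
Implicit Types (q : I3) (A : {set 'I_n}).

Definition mem3 (x : 'I_n) q := [|| x == q.1.1, x == q.1.2 | x == q.2].
Definition increasing q := (q.1.1 < q.1.2)%N && (q.1.2 < q.2)%N.
Definition tri3 U q := trip U q.1.1 q.1.2 q.2.

Lemma bmeas_tri3 q : bmeas (fun U => tri3 U q).
Proof. exact: bmeas_tri. Qed.

Lemma tri3_upd U x u q : ~~ mem3 x q -> tri3 (upd U x u) q = tri3 U q.
Proof.
rewrite /mem3 !negb_or => /and3P[h1 h2 h3].
by rewrite /tri3 /tri !tnth_upd !(eq_sym _ x) (negbTE h1) (negbTE h2) (negbTE h3).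
Qed.

Lemma increasing_neq q : increasing q -> [/\ q.1.1 != q.1.2, q.1.1 != q.2 & q.1.2 != q.2].
Proof.
by move=> /andP[h1 h2]; rewrite !neq_ltn h1 h2 (ltn_trans h1 h2).
Qed.

Lemma tri3_pick q x y : increasing q -> x != y -> mem3 x q -> mem3 y q ->
  exists z, [/\ mem3 z q, x != z, y != z & forall U, tri3 U q = trip U x y z].
Proof.
move=> /increasing_neq; rewrite /tri3 /mem3; case: q => -[i j] l /= [ij il jl] xy.
have H U : [/\ trip U i j l = trip U j i l, trip U i j l = trip U l j i, trip U i j l = trip U i l j,
   trip U i j l = trip U j l i & trip U i j l = trip U l i j].
  split; first exact: triC12; first exact: triC13.
  - by rewrite (triC12 U i j l) (triC13 U j i l) (triC12 U l i j).
  - by rewrite (triC13 U i j l) (triC12 U l j i).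
  - by rewrite (triC12 U i j l) (triC13 U j i l).
by move=> /or3P[] /eqP xE /or3P[] /eqP yE; subst x y; rewrite ?eqxx // in xy *;
  [exists l|exists j|exists l|exists i|exists j|exists i]; split;
  rewrite ?eqxx ?orbT// 1?eq_sym// => U; case: (H U).
Qed.

End signed_triangle_variance.

(** * Counting increasing triples *)

Section increasing_triples.
Variable n : nat.
Local Notation I3 := ('I_n * 'I_n * 'I_n)%type.
Implicit Types (q a b : I3) (A : {set 'I_n}).

Lemma increasing_eq a b : increasing a -> increasing b ->
  mem3 a.1.1 b -> mem3 a.1.2 b -> mem3 a.2 b -> a = b.
Proof.
case: a b => -[i j] l [[i' j'] l'] /andP[/= h1 h2] /andP[/= h3 h4].
move=> /or3P[] /= /eqP e1 /or3P[] /= /eqP e2 /or3P[] /= /eqP e3; subst => //;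
  try by move: h1 h2 h3 h4; rewrite ?ltnn.
all: exfalso; move: h1 h2 h3 h4; clear; lia.
Qed.

Definition triples A : {set I3} :=
  [set q : I3 | [&& q.1.1 \in A, q.1.2 \in A, q.2 \in A & increasing q]]%SET.

Lemma card_triples_le A : (#|triples A| <= #|A| ^ 3)%N.
Proof.
apply: leq_trans (_ : #|finset.setX (finset.setX A A) A| <= _)%N.
  by apply/subset_leq_card/fintype.subsetP => q; rewrite !inE => /and4P[-> -> -> _].
by rewrite !cardsX !expnS expn0 muln1 mulnA.
Qed.

(** The map from a triple to its set of vertices reaches every 3-subset, whose sorted enumeration is
    an increasing triple. *)
Lemma card_triples_ge A : ('C(#|A|, 3) <= #|triples A|)%N.
Proof.
rewrite -cards_draws.
pose f q : {set 'I_n} := [set x : 'I_n | mem3 x q]%SET.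
apply: leq_trans (leq_imset_card f _).
apply/subset_leq_card/fintype.subsetP => B; rewrite inE => /andP[BA /eqP B3].
have : sorted ltn (map val (enum B)).
  rewrite sorted_map; apply: (sorted_filter (leT := relpre val ltn)).
    by move=> y x z; exact: ltn_trans.
  by rewrite -sorted_map -enumT val_enum_ord iota_ltn_sorted.
have : size (enum B) = 3%N by rewrite -cardE.
have mB x : (x \in B) = (x \in enum B) by rewrite mem_enum.
case: (enum B) mB => [//|x [//|y [//|z [|//]]]] mB _ /= /and3P[xy yz _].
have inB w : w \in [:: x; y; z] -> w \in A.
  by rewrite -mB => wB; exact: (fintype.subsetP BA).
apply/imsetP; exists (x, y, z).
  by rewrite inE/= /increasing/= xy yz !inB ?inE ?eqxx ?orbT.
by apply/setP => w; rewrite /f [RHS]inE /mem3/= mB !inE.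
Qed.

(** Six ways to place [x] and [y] among the three positions, times a free vertex. *)
Lemma card_triples_containing A x y : x != y ->
  (#|[set b in triples A | mem3 x b && mem3 y b]%SET| <= 6 * #|A|)%N.
Proof.
move=> xy.
pose f1 z : I3 := (x, y, z). pose f2 z : I3 := (y, x, z). pose f3 z : I3 := (x, z, y).
pose f4 z : I3 := (y, z, x). pose f5 z : I3 := (z, x, y). pose f6 z : I3 := (z, y, x).
pose V := f1 @: A :|: f2 @: A :|: f3 @: A :|: f4 @: A :|: f5 @: A :|: f6 @: A.
apply: (@leq_trans #|V|).
  apply/subset_leq_card/fintype.subsetP => -[[i j] l]; rewrite !inE/= => /andP[/and4P[iA jA lA _]].
  have h1 z : z \in A -> f1 z \in f1 @: A by exact: imset_f.
  have h2 z : z \in A -> f2 z \in f2 @: A by exact: imset_f.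
  have h3 z : z \in A -> f3 z \in f3 @: A by exact: imset_f.
  have h4 z : z \in A -> f4 z \in f4 @: A by exact: imset_f.
  have h5 z : z \in A -> f5 z \in f5 @: A by exact: imset_f.
  have h6 z : z \in A -> f6 z \in f6 @: A by exact: imset_f.
  move=> /andP[/or3P[] /eqP xE /or3P[] /= /eqP yE]; rewrite /= in xE yE;
    move: h1 h2 h3 h4 h5 h6; rewrite /f1 /f2 /f3 /f4 /f5 /f6 -?xE -?yE => h1 h2 h3 h4 h5 h6;
    try by move: xy; rewrite xE yE eqxx.
  - by rewrite h1.
  - by rewrite h3 ?orbT.
  - by rewrite h2 ?orbT.
  - by rewrite h5 ?orbT.
  - by rewrite h4 ?orbT.
  - by rewrite h6 ?orbT.
have c (f : 'I_n -> I3) : (#|f @: A| <= #|A|)%N by exact: leq_imset_card.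
have hU (X Y : {set I3}) x' y' : (#|X| <= x' -> #|Y| <= y' -> #|X :|: Y| <= x' + y')%N.
  by move=> hX hY; apply: leq_trans (leq_card_setU _ _) _; exact: leq_add.
have -> : (6 * #|A| = #|A| + #|A| + #|A| + #|A| + #|A| + #|A|)%N.
  by rewrite !mulSn mul0n addn0 !addnA.
by do 5! (apply: (hU _ _ _ _); last exact: c); exact: c.
Qed.

End increasing_triples.

Section signed_triangle_sum.
Context {R : realType}.
Variables (n m : nat) (t p : R).
Local Notation d := m.+2.
Local Notation mu := (@sphere_points R n d).
Implicit Types (U : n.-tuple (@vec R d)).
Hypotheses (p0 : 0 <= p) (p1 : p <= 1) (capt : @capP R m.+1 t = p).
Local Notation trip := (tri t p).
Local Notation tri3p := (tri3 t p).
Local Notation T := (signed_mean m t p).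
Local Notation I3 := ('I_n * 'I_n * 'I_n)%type.
Implicit Types (q a b : I3) (A : {set 'I_n}).

Let m1 : mu setT = 1%E := @sphere_points1 R n m.+2.
Let ht q : bmeas (fun U => tri3p U q) := @bmeas_tri3 R n m t p q.

Lemma Ex_tri3 q : increasing q -> Ex mu (fun U => tri3p U q) = T.
Proof.
move=> /increasing_neq[h1 h2 h3].
have := @Ex_tri_indep R n m t p capt (fun=> 1) _ _ _ h1 h2 h3 (bmeas_cst _) (fun _ _ => erefl) (fun _ _ => erefl).
rewrite (Ex_cst m1) mulr1 => <-; congr (Ex mu _); apply/funext => U; by rewrite mul1r.
Qed.

Lemma Ex_tri3_uncorrelated a b i j l : increasing a -> increasing b ->
  (forall U, tri3p U a = trip U i j l) -> i != j -> i != l -> j != l ->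
  ~~ mem3 j b -> ~~ mem3 l b -> Ex mu (fun U => tri3p U a * tri3p U b) = T ^+ 2.
Proof.
move=> ia ib ha ij il jl jb lb.
have -> : (fun U => tri3p U a * tri3p U b) = (fun U => tri3p U b * trip U i j l).
  by apply/funext => U; rewrite ha mulrC.
rewrite (Ex_tri_indep capt ij il jl (ht b)) ?Ex_tri3//.
- by move=> U u; exact: tri3_upd.
- by move=> U u; exact: tri3_upd.
Qed.

Lemma Ex_tri3_mul_le1 a b : Ex mu (fun U => tri3p U a * tri3p U b) <= 1.
Proof.
rewrite -[leRHS](Ex_cst m1); apply: (le_Ex m1 (bmeasM (ht a) (ht b)) (bmeas_cst _)) => U.
by apply: le_trans (ler_norm _) _; rewrite normrM mulr_ile1 ?tri_norm_le1.
Qed.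

Definition overlap x y b : R := (mem3 x b && mem3 y b)%:R.

Lemma Ex_tri3_shared a b x y z : increasing a -> increasing b ->
  (forall U, tri3p U a = trip U x y z) -> x != y -> x != z -> y != z ->
  (mem3 x b -> mem3 y b -> mem3 z b -> a = b) -> mem3 x b -> mem3 y b ->
  Ex mu (fun U => tri3p U a * tri3p U b) <= (a == b)%:R + p ^+ 3.
Proof.
move=> ia ib ha xy xz yz hab xb yb.
have [z' [zb xz' yz' hb]] := @tri3_pick R n m t p _ _ _ ib xy xb yb.
have [zz|zz] := eqVneq z z'.
  rewrite -zz in zb; rewrite hab// eqxx; apply: le_trans (Ex_tri3_mul_le1 _ _) _.
  by rewrite lerDl exprn_ge0.
apply: (@le_trans _ _ (p ^+ 3)); last by rewrite lerDr.
have -> : (fun U => tri3p U a * tri3p U b) = (fun U => trip U x y z * trip U x y z').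
  by apply/funext => U; rewrite ha hb.
exact: Ex_tri_shared_edge.
Qed.

(** Eight cases, according to which vertices of [a] belong to [b]. With at most one, the triangles
    are uncorrelated; with two, they share an edge; with three, they are equal and the product is at
    most 1. *)
Lemma Ex_tri3_mul a b : increasing a -> increasing b ->
  Ex mu (fun U => tri3p U a * tri3p U b) <= T ^+ 2 + ((a == b)%:R +
    p ^+ 3 * (overlap a.1.1 a.1.2 b + overlap a.1.2 a.2 b + overlap a.1.1 a.2 b)).
Proof.
move=> ia ib; have [h1 h2 h3] := increasing_neq ia.
have hab := increasing_eq ia ib.
have P0 : 0 <= p ^+ 3 by exact: exprn_ge0.
have T0 := sqr_ge0 T.
have ab0 : 0 <= (a == b)%:R :> R by exact: ler0n.
have t1 U : tri3p U a = trip U a.1.1 a.1.2 a.2 by [].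
have t2 U : tri3p U a = trip U a.1.2 a.2 a.1.1 by rewrite t1 triC13 triC12.
have t3 U : tri3p U a = trip U a.1.1 a.2 a.1.2 by rewrite t1 triC12 triC13 triC12.
rewrite /overlap; case: (boolP (mem3 a.1.1 b)) => b1; case: (boolP (mem3 a.1.2 b)) => b2; case: (boolP (mem3 a.2 b)) => b3 /=; rewrite ?addr0 ?add0r ?mulr0 ?mulr1.
- have := Ex_tri3_shared ia ib t1 h1 h2 h3 hab b1 b2; lra.
- have := Ex_tri3_shared ia ib t1 h1 h2 h3 hab b1 b2; lra.
- have h3' : a.2 != a.1.2 by rewrite eq_sym.
  have := Ex_tri3_shared ia ib t3 h2 h1 h3' (fun x y z => hab x z y) b1 b3; lra.
- rewrite (Ex_tri3_uncorrelated ia ib t1 h1 h2 h3 b2 b3); lra.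
- have h2' : a.2 != a.1.1 by rewrite eq_sym.
  have h1' : a.1.2 != a.1.1 by rewrite eq_sym.
  have := Ex_tri3_shared ia ib t2 h3 h1' h2' (fun x y z => hab z x y) b2 b3; lra.
- have h1' : a.1.2 != a.1.1 by rewrite eq_sym.
  have t4 U : tri3p U a = trip U a.1.2 a.1.1 a.2 by rewrite t1 triC12.
  rewrite (Ex_tri3_uncorrelated ia ib t4 h1' h3 h2 b1 b3); lra.
- have h2' : a.2 != a.1.1 by rewrite eq_sym.
  have h3' : a.2 != a.1.2 by rewrite eq_sym.
  have t4 U : tri3p U a = trip U a.2 a.1.1 a.1.2 by rewrite t1 triC12 triC13.
  have t5 U : tri3p U a = trip U a.2 a.1.1 a.1.2 by [].
  rewrite (Ex_tri3_uncorrelated ia ib t5 h2' h3' h1 b1 b2); lra.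
- rewrite (Ex_tri3_uncorrelated ia ib t1 h1 h2 h3 b2 b3); lra.
Qed.

(** There are at most [#|A| ^ 3] triples. Each contributes 1 for itself and [p ^+ 3] for each triple
    sharing one of its 3 edges, at most [6 * #|A|] per edge. *)
Lemma variance_triples A :
  Ex mu (fun U => (\sum_(q in triples A) tri3p U q - #|triples A|%:R * T) ^+ 2) <=
  #|A|%:R ^+ 3 + 18 * p ^+ 3 * #|A|%:R ^+ 4.
Proof.
set N : R := #|triples A|%:R.
pose S U := \sum_(q in triples A) tri3p U q.
have hS : bmeas S by apply: bmeas_sum => q; exact: ht.
have hi q : q \in triples A -> increasing q by rewrite inE => /and4P[].
have ES : Ex mu S = N * T.
  rewrite (Ex_sum m1 _ _ ht); under eq_bigr => q /hi hq do rewrite Ex_tri3//.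
  by rewrite sumr_const mulr_natl.
have ESS : Ex mu (fun U => S U * S U) = \sum_(a in triples A) \sum_(b in triples A) Ex mu (fun U => tri3p U a * tri3p U b).
  have -> : (fun U => S U * S U) = (fun U => \sum_(a in triples A) \sum_(b in triples A) tri3p U a * tri3p U b).
    by apply/funext => U; rewrite mulr_suml; apply: eq_bigr => a _; rewrite mulr_sumr.
  rewrite (Ex_sum m1); last by move=> a; apply: bmeas_sum => b; exact: bmeasM.
  by apply: eq_bigr => a _; rewrite (Ex_sum m1)// => b; exact: bmeasM.
have -> : Ex mu (fun U => (S U - N * T) ^+ 2) = Ex mu (fun U => S U * S U) - (N * T) ^+ 2.
  have -> : (fun U => (S U - N * T) ^+ 2) = (fun U => S U * S U - (2 * (N * T) * S U - (N * T) ^+ 2)).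
    by apply/funext => U; ring.
  rewrite (ExB m1 (bmeasM hS hS) (bmeasB (bmeasZ _ hS) (bmeas_cst _))).
  rewrite (ExB m1 (bmeasZ _ hS) (bmeas_cst _)) (ExZ m1 _ hS) (Ex_cst m1) ES; ring.
have -> : (N * T) ^+ 2 = \sum_(a in triples A) \sum_(b in triples A) T ^+ 2.
  by rewrite !sumr_const -(mulr_natl (T ^+ 2)) -(mulr_natl (_ * T ^+ 2)) -/N; ring.
rewrite ESS lerBlDr.
have P0 : 0 <= p ^+ 3 by exact: exprn_ge0.
have A0 : 0 <= #|A|%:R :> R by exact: ler0n.
have NA : N <= #|A|%:R ^+ 3 by rewrite /N -natrX ler_nat card_triples_le.
have ov a x y : x != y -> \sum_(b in triples A) overlap x y b <= 6 * #|A|%:R.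
  move=> xy; rewrite -natrM; apply: le_trans (_ : (#|[set b in triples A | mem3 x b && mem3 y b]%SET|)%:R <= _); last first.
    by rewrite ler_nat card_triples_containing.
  rewrite -sum1_card natr_sum big_mkcond [leRHS]big_mkcond/=; apply: ler_sum => b _.
  have -> : (b \in [set b in triples A | mem3 x b && mem3 y b]%SET) = (b \in triples A) && (mem3 x b && mem3 y b) by rewrite !inE.
  rewrite /overlap; case: (b \in triples A); last exact: lexx.
  by case: (mem3 x b && mem3 y b); exact: lexx.
apply: (@le_trans _ _ (\sum_(a in triples A) (\sum_(b in triples A) T ^+ 2 + (1 + p ^+ 3 * (18 * #|A|%:R))))).
  apply: ler_sum => a aA; have ia := hi a aA; have [h1 h2 h3] := increasing_neq ia.
  apply: (@le_trans _ _ (\sum_(b in triples A) (T ^+ 2 + ((a == b)%:R +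
    p ^+ 3 * (overlap a.1.1 a.1.2 b + overlap a.1.2 a.2 b + overlap a.1.1 a.2 b))))).
    by apply: ler_sum => b bA; apply: Ex_tri3_mul => //; exact: hi.
  rewrite big_split lerD2l big_split/= -mulr_sumr !big_split/=; apply: lerD.
    by rewrite (bigD1 a)//= eqxx big1 ?addr0// => b /andP[_ /negbTE]; rewrite eq_sym => ->.
  by apply: ler_wpM2l => //; have := ov a _ _ h1; have := ov a _ _ h2; have := ov a _ _ h3; lra.
rewrite big_split/= addrC lerD2r sumr_const -[leLHS]mulr_natl -/N.
have h0 : 0 <= 1 + p ^+ 3 * (18 * #|A|%:R) by have := mulr_ge0 P0 A0; lra.
apply: le_trans (ler_wpM2r h0 NA) _.
by rewrite le_eqVlt; apply/orP; left; apply/eqP; ring.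
Qed.

End signed_triangle_sum.

Lemma sum_triples (V : nmodType) n (A : {set 'I_n}) (F : 'I_n -> 'I_n -> 'I_n -> V) :
  \sum_(i in A) \sum_(j in A | (i < j)%N) \sum_(l in A | (j < l)%N) F i j l =
  \sum_(q in triples A) F q.1.1 q.1.2 q.2.
Proof.
rewrite [RHS]big_mkcond sum_pair sum_pair big_mkcond; apply: eq_bigr => i _.
case: (boolP (i \in A)) => iA; last first.
  by rewrite big1// => j _; rewrite big1// => l _; rewrite inE/= (negbTE iA).
rewrite big_mkcond; apply: eq_bigr => j _; rewrite fun_if.
case: (boolP (j \in A)) => jA /=; last first.
  by rewrite big1// => l _; rewrite inE/= (negbTE jA) andbF.
case: (boolP (i < j)%N) => ij; last first.
  by rewrite big1// => l _; rewrite inE/= /increasing/= (negbTE ij) !andbF.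
rewrite big_mkcond; apply: eq_bigr => l _.
by rewrite inE/= /increasing/= iA jA ij.
Qed.

(** * The scan statistic *)

Section scan_statistic.
Context {R : realType}.
Variable p : R.

Definition scan_sum n (A : {set 'I_n}) (G : graph n) : R :=
  \sum_(q in triples A) signed_triangle p G q.1.1 q.1.2 q.2.

Lemma f_scanE n k (G : graph n) :
  f_scan p k G = \big[maxe/-oo%E]_(A : {set 'I_n} | #|A| == scan_size k) (scan_sum A G)%:E.
Proof. by apply: eq_bigr => A _; rewrite sum_triples. Qed.

Lemma scan_sum_le_f_scan n k (G : graph n) (A : {set 'I_n}) : #|A| = scan_size k ->
  ((scan_sum A G)%:E <= f_scan p k G)%E.
Proof.
move=> cA; rewrite f_scanE.
exact: (@le_bigmax_cond _ _ _ _ A (fun A : {set 'I_n} => #|A| == scan_size k) (fun A => (scan_sum A G)%:E) (introT eqP cA)).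
Qed.

Lemma f_scan_gt n k (G : graph n) (g : R) : (g%:E < f_scan p k G)%E ->
  exists2 A : {set 'I_n}, #|A| = scan_size k & g < scan_sum A G.
Proof.
move=> h; apply: contrapT => hn; move: h; apply/negP; rewrite -leNgt f_scanE.
apply: bigmax_le; first exact: leNye.
move=> A /eqP cA; rewrite lee_fin leNgt; apply/negP => hA; apply: hn.
by exists A.
Qed.

Lemma signed_triangle_graph_of n (om : {ffun 'I_n * 'I_n -> bool}) (q : 'I_n * 'I_n * 'I_n) :
  increasing q -> signed_triangle p (graph_of om) q.1.1 q.1.2 q.2 =
  cval p (om (q.1.1, q.1.2)) * cval p (om (q.1.2, q.2)) * cval p (om (q.1.1, q.2)).
Proof.
by move=> /andP[h1 h2]; rewrite /signed_triangle !adj_graph_of//; exact: ltn_trans h1 h2.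
Qed.

Lemma scan_sum_graph_of n (A : {set 'I_n}) om : scan_sum A (graph_of om) = triangle_sum p A om.
Proof.
rewrite /triangle_sum (sum_triples A (fun i j l => cval p (om (i, j)) * cval p (om (j, l)) * cval p (om (i, l)))).
by apply: eq_bigr => q; rewrite inE => /and4P[_ _ _ iq]; exact: signed_triangle_graph_of.
Qed.

Lemma erdos_renyi_expect n (f : graph n -> R) :
  expect (erdos_renyi p) f = Ew (fun _ => bern p) (f \o graph_of).
Proof.
by rewrite -expect_graph_law// => e; rewrite big_bool/= addrC subrK.
Qed.

Lemma erdos_renyi_scan n k (g : R) : 0 <= p <= 1 ->
  prob (erdos_renyi p) (fun G : graph n => (g%:E < f_scan p k G)%E) <=
  Ew (fun _ => bern p) (fun om => ([exists (A : {set 'I_n} | #|A| == scan_size k), g < triangle_sum p A om])%R%:R).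
Proof.
move=> /andP[p0 p1]; rewrite prob_expect erdos_renyi_expect.
have w0 (e : 'I_n * 'I_n) b : 0 <= bern p b by case: b => //=; rewrite subr_ge0.
apply: Ew_le => // om /=; case: (boolP (_ < _)%E) => [h|_]; last exact: ler0n.
have [A cA hA] := f_scan_gt h.
suff -> : [exists (A : {set 'I_n} | #|A| == scan_size k), g < triangle_sum p A om] by [].
by apply/existsP; exists A; rewrite cA eqxx -scan_sum_graph_of.
Qed.

End scan_statistic.

Section planted_scan.
Context {R : realType}.
Variables (n m k : nat) (p g : R).
Local Notation d := m.+2.
Local Notation t := (tau p d).
Local Notation mu := (@sphere_points R n d).
Local Notation T := (signed_mean m t p).
Local Notation kap := (scan_size k).
Hypotheses (p0 : 0 <= p) (p1 : p <= 1) (capt : @capP R m.+1 t = p).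
Implicit Types (S A : {set 'I_n}) (U : n.-tuple (@vec R d)).

Lemma signed_triangle_visible U q : increasing q ->
  signed_triangle p (graph_of (visible p U)) q.1.1 q.1.2 q.2 = tri3 t p U q.
Proof. by move=> iq; rewrite signed_triangle_graph_of// !ffunE. Qed.

Lemma scan_sum_inside S A : A \subset S -> inside S (scan_sum p A).
Proof.
move=> /fintype.subsetP AS G G' h; apply: eq_bigr => q; rewrite inE => /and4P[/AS h1 /AS h2 /AS h3 /andP[l1 l2]].
by rewrite /signed_triangle !h//; exact: ltn_trans l1 l2.
Qed.

Lemma planted_given_ge0 S G : 0 <= planted_given p d S G.
Proof.
rewrite planted_given_Ex; apply: Ex_ge0 => U; apply: prodr_ge0 => i _; apply: prodr_ge0 => j _.
rewrite /planted_pair; case: (_ && _); first exact: ler0n.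
by case: (adj _ _ _) => //=; rewrite subr_ge0.
Qed.

Lemma expect_planted_given_le S (f h : graph n -> R) : (forall G, f G <= h G) ->
  expect (planted_given p d S) f <= expect (planted_given p d S) h.
Proof. by move=> fh; apply: ler_sum => G _; rewrite ler_wpM2l// planted_given_ge0. Qed.

Lemma planted_given_sum1 S : expect (planted_given p d S) (fun=> 1) = 1.
Proof.
by rewrite expect_planted_given// Ex_cst//; exact: sphere_points1.
Qed.

(** The maximum is at least the count of one set [A] of the right size inside [S], whose mean is at
    least [2 * g]. Falling to [g] is a deviation of at least [g], and Chebyshev's inequality
    applies. *)
Lemma planted_given_scan S : 0 < g -> 2 * g <= 'C(kap, 3)%:R * T -> (kap <= #|S|)%N ->
  prob (planted_given p d S) (fun G : graph n => (f_scan p k G <= g%:E)%E) <=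
  (kap%:R ^+ 3 + 18 * p ^+ 3 * kap%:R ^+ 4) / g ^+ 2.
Proof.
move=> g0 hg kS.
have [A AS cA] : exists2 A : {set 'I_n}, A \subset S & #|A| = kap.
  have : (0 < #|[set A : {set 'I_n} | A \subset S & #|A| == kap]%SET|)%N.
    by rewrite cards_draws bin_gt0.
  by move=> /card_gt0P[A]; rewrite inE => /andP[AS /eqP cA]; exists A.
pose N : R := #|triples A|%:R.
have NT : 2 * g <= N * T.
  apply: (le_trans hg); apply: ler_wpM2r; last by rewrite ler_nat -cA card_triples_ge.
  have C0 : 0 <= 'C(kap, 3)%:R :> R by exact: ler0n.
  (* The sign of [T] follows from [2 * g] being positive. *)
  rewrite leNgt; apply/negP => T0; have := le_trans hg (mulr_ge0_le0 C0 (ltW T0)).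
  by rewrite leNgt mulr_gt0.
pose h (G : graph n) := (scan_sum p A G - N * T) ^+ 2 / g ^+ 2.
have g20 : 0 < g ^+ 2 by rewrite exprn_gt0.
rewrite prob_expect; apply: (@le_trans _ _ (expect (planted_given p d S) h)).
  apply: expect_planted_given_le => G; case: (boolP (_ <= _)%E) => [fg|_]; last first.
    by rewrite /h divr_ge0 ?sqr_ge0.
  have sg : scan_sum p A G <= g by rewrite -lee_fin; apply: le_trans fg; exact: scan_sum_le_f_scan.
  rewrite /h ler_pdivlMr// mul1r -(sqrrN (_ - _)).
  have x0 : g <= - (scan_sum p A G - N * T) by lra.
  by rewrite !expr2; apply: ler_pM => //; exact: ltW.
have hin : inside S h.
  by move=> G G' GG'; rewrite /h (scan_sum_inside AS GG').
rewrite expect_planted_given//.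
have -> : (fun U => h (graph_of (visible p U))) =
  (fun U => (g ^+ 2)^-1 * (\sum_(q in triples A) tri3 t p U q - N * T) ^+ 2).
  apply/funext => U; rewrite /h mulrC; congr (_ * (_ - _) ^+ 2).
  by apply: eq_bigr => q; rewrite inE => /and4P[_ _ _ iq]; exact: signed_triangle_visible.
have hb : bmeas (fun U => (\sum_(q in triples A) tri3 t p U q - N * T) ^+ 2).
  apply: bmeasX; apply: bmeasB; last exact: bmeas_cst.
  by apply: bmeas_sum => q; exact: bmeas_tri3.
rewrite (ExZ (@sphere_points1 R n m.+2) _ hb) mulrC; apply: ler_wpM2r; first by rewrite invr_ge0 ltW.
have := variance_triples p0 p1 capt A; rewrite cA; exact.
Qed.

Lemma gamma_scanE : (2 < n)%N -> gamma_scan n p d k = 2^-1 * 'C(kap, 3)%:R * T.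
Proof.
clear g; case: n => [|[|[|n']]]//= _; rewrite /gamma_scan; congr (_ * _).
rewrite geometric_planted_given.
pose q : 'I_n'.+3 * 'I_n'.+3 * 'I_n'.+3 := (inord 0, inord 1, inord 2).
have iq : increasing q by rewrite /increasing/= !inordK.
have ins : inside [set: 'I_n'.+3]%SET (fun G => signed_triangle p G (inord 0) (inord 1) (inord 2)).
  move=> G G' h; congr (signed_triangle p _ _ _ _); apply: graph_eqP => i j ij.
  by apply: h; rewrite ?inE.
rewrite (expect_planted_given _ _ ins) -[RHS](@Ex_tri3 R n'.+3 m t p capt q iq).
congr (Ex _ _); apply/funext => U; have /andP[h1 h2] := iq.
by rewrite /signed_triangle !adj_graph_of ?ffunE//; exact: ltn_trans h1 h2.
Qed.

End planted_scan.

(** * The size of the hidden set and the planted model *)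

Section hidden_set.
Context {R : realType}.
Variables (n k : nat).
Hypotheses (k0 : (0 < k)%N) (kn : (k <= n)%N).
Local Notation q := (k%:R / n%:R : R).
Local Notation E := (@Ew R 'I_n (fun _ => bern q)).

Let n0 : 0 < n%:R :> R. Proof. by rewrite ltr0n (leq_trans k0 kn). Qed.
Let q0 : 0 <= q. Proof. by rewrite divr_ge0. Qed.
Let q1 : q <= 1. Proof. by rewrite ler_pdivrMr// mul1r ler_nat. Qed.
Let w0 (e : 'I_n) b : 0 <= bern q b. Proof. by case: b => //=; rewrite subr_ge0. Qed.
Let w1 (e : 'I_n) : \sum_(b : bool) bern q b = 1. Proof. by rewrite big_bool/= addrC subrK. Qed.

Definition hidden_weight (S : {set 'I_n}) : R := \prod_(i < n) bern q (i \in S).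

Lemma hidden_weight_ge0 S : 0 <= hidden_weight S.
Proof. by apply: prodr_ge0 => i _; exact: (w0 i). Qed.

Lemma sum_hidden_weight (f : {set 'I_n} -> R) :
  \sum_S hidden_weight S * f S = E (fun om => f [set i | om i]%SET).
Proof.
rewrite (reindex (fun om : {ffun 'I_n -> bool} => [set i | om i]%SET)) /=; last first.
  exists (fun S : {set 'I_n} => [ffun i => i \in S]) => [om _|S _].
    by apply/ffunP => i; rewrite ffunE inE.
  by apply/setP => i; rewrite inE ffunE.
apply: eq_bigr => om _; congr (_ * _); apply: eq_bigr => i _; by rewrite inE.
Qed.

Lemma hidden_variance : E (fun om => (\sum_i ((om i)%:R - q)) ^+ 2) <= k%:R.
Proof.
have -> : E (fun om => (\sum_i ((om i)%:R - q)) ^+ 2) =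
  \sum_i \sum_j E (fun om => ((om i)%:R - q) * ((om j)%:R - q)).
  transitivity (\sum_i E (fun om => \sum_j ((om i)%:R - q) * ((om j)%:R - q))); last first.
    by apply: eq_bigr => i _; rewrite Ew_sum.
  rewrite -Ew_sum; apply: eq_Ew => om; rewrite expr2 mulr_suml; apply: eq_bigr => i _.
  by rewrite mulr_sumr.
apply: (@le_trans _ _ (\sum_(i < n) q)); last first.
  by rewrite sumr_const card_ord -[leLHS]mulr_natl mulrCA mulfV ?gt_eqF// mulr1.
apply: ler_sum => i _; rewrite (bigD1 i)//= big1 ?addr0.
  rewrite (Ew_merge1 w1 i); rewrite -[leRHS](Ew_cst w1); apply: Ew_le => // om.
  by rewrite big_bool/= !ffunE eqxx/= mulr1n mulr0n; have := sqr_ge0 q; have := mulr_ge0 q0 (sqr_ge0 q); nra.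
move=> j ji; rewrite (Ew_merge1 w1 i) -[RHS](Ew_cst w1); apply: eq_Ew => om.
by rewrite big_bool/= !ffunE eqxx/= (negbTE ji) mulr1n mulr0n; ring.
Qed.

(** Being smaller than the scan size is a deviation of at least [k / 10] from the mean [k], while
    the variance is at most [k]. *)
Lemma hidden_small : \sum_(S : {set 'I_n} | (#|S| < scan_size k)%N) hidden_weight S <= 100 / k%:R.
Proof.
have K0 : 0 < k%:R :> R by rewrite ltr0n.
rewrite big_mkcond; under eq_bigr do rewrite -[if _ then _ else _]mulr1.
apply: (@le_trans _ _ (\sum_S hidden_weight S * ((100 / k%:R ^+ 2) * (#|S|%:R - k%:R) ^+ 2))).
  apply: ler_sum => S _; case: ifPn => h; last first.
    rewrite mul0r; apply: mulr_ge0; first exact: hidden_weight_ge0.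
    apply: mulr_ge0; last exact: sqr_ge0.
    by apply: divr_ge0; [exact: ler0n|exact: sqr_ge0].
  rewrite ler_wpM2l ?hidden_weight_ge0//.
  have h10 : (10 * #|S| <= 9 * k)%N.
    by rewrite mulnC; apply: leq_trans (leq_divM _ 10); rewrite leq_mul2r/= ltnW.
  have h10' : 10 * #|S|%:R <= 9 * k%:R :> R by rewrite -!natrM ler_nat.
  have -> : 100 / k%:R ^+ 2 * (#|S|%:R - k%:R) ^+ 2 = ((10 * k%:R - 10 * #|S|%:R) / k%:R) ^+ 2 :> R.
    by field; rewrite gt_eqF.
  by rewrite exprn_ege1// ler_pdivlMr//; lra.
rewrite sum_hidden_weight EwZ.
have -> : E (fun om => (#|[set i | om i]%SET|%:R - k%:R) ^+ 2) = E (fun om => (\sum_i ((om i)%:R - q)) ^+ 2).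
  apply: eq_Ew => om; congr (_ ^+ 2); rewrite sumrB; congr (_ - _).
    rewrite -sum1_card natr_sum big_mkcond/=; apply: eq_bigr => i _; by rewrite inE; case: (om i).
  by rewrite sumr_const card_ord -[RHS]mulr_natl mulrCA mulfV ?gt_eqF// mulr1.
have c0 : 0 <= 100 / k%:R ^+ 2 :> R by apply: divr_ge0; [exact: ler0n|exact: sqr_ge0].
apply: le_trans (ler_wpM2l c0 hidden_variance) _.
by rewrite le_eqVlt; apply/orP; left; apply/eqP; field; rewrite gt_eqF.
Qed.

Lemma planted_scan m (p g : R) : 0 <= p <= 1 -> @capP R m.+1 (tau p m.+2) = p ->
  0 < g -> 2 * g <= 'C(scan_size k, 3)%:R * signed_mean m (tau p m.+2) p ->
  prob (planted p m.+2 k) (fun G : graph n => (f_scan p k G <= g%:E)%E) <=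
  100 / k%:R + ((scan_size k)%:R ^+ 3 + 18 * p ^+ 3 * (scan_size k)%:R ^+ 4) / g ^+ 2.
Proof.
move=> /andP[p0 p1] capt g0 hg.
set V := (X in _ + X).
have V0 : 0 <= V.
  rewrite divr_ge0 ?sqr_ge0// addr_ge0 ?exprn_ge0// !mulr_ge0 ?exprn_ge0//.
pose P S := prob (planted_given p m.+2 S) (fun G : graph n => (f_scan p k G <= g%:E)%E).
have PE : prob (planted p m.+2 k) (fun G : graph n => (f_scan p k G <= g%:E)%E) =
  \sum_S hidden_weight S * P S.
  rewrite /prob /P; under [RHS]eq_bigr do rewrite mulr_sumr.
  by rewrite [RHS]exchange_big.
have P1 S : P S <= 1.
  rewrite -[leRHS](@planted_given_sum1 R n m p S) /P prob_expect.
  by apply: expect_planted_given_le => // G; case: (_ <= _)%E.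
rewrite PE (bigID (fun S : {set 'I_n} => (#|S| < scan_size k)%N))/=; apply: lerD.
  apply: le_trans hidden_small; apply: ler_sum => S _.
  by rewrite -[leRHS]mulr1 ler_wpM2l ?hidden_weight_ge0.
apply: (@le_trans _ _ (\sum_S hidden_weight S * V)); last first.
  by rewrite (sum_hidden_weight (fun=> V)) Ew_cst.
rewrite big_mkcond; apply: ler_sum => S _; case: ifPn => h.
  rewrite ler_wpM2l ?hidden_weight_ge0//; apply: planted_given_scan => //.
  by rewrite leqNgt.
by rewrite mulr_ge0 ?hidden_weight_ge0.
Qed.

End hidden_set.

(** * Consequences of the assumptions on the parameters *)

Section parameters.
Context {R : realType}.
Implicit Types (p L l K d T g c B : R).

(** Squaring the lower bound on [g] and multiplying by [L ^+ 3] makes [K ^+ 2 * p ^+ 6 * L ^+ 6 / d]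
    appear, exactly the quantity bounded below by the upper bound on [d]. *)
Lemma threshold_lower c B K l L p d T g : 0 < c -> 0 < K -> 0 < l -> 0 < L -> 0 < p -> 0 < d ->
  d <= K ^+ 2 * p ^+ 6 * L ^+ 6 / (B * 96 ^+ 2 / c ^+ 2 * l) -> 0 < B ->
  c * (p ^+ 3 * Num.sqrt L ^+ 3) / Num.sqrt d <= T -> K ^+ 3 / 96 * T <= g ->
  B * K ^+ 4 * l <= g ^+ 2 * L ^+ 3.
Proof.
move=> c0 K0 l0 L0 p0 d0 hd B0 hT hg.
have s0 : 0 < Num.sqrt L by rewrite sqrtr_gt0.
have r0 : 0 < Num.sqrt d by rewrite sqrtr_gt0.
have sE : Num.sqrt L ^+ 2 = L by rewrite sqr_sqrtr// ltW.
have rE : Num.sqrt d ^+ 2 = d by rewrite sqr_sqrtr// ltW.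
set s := Num.sqrt L in hT s0 sE; set r := Num.sqrt d in hT r0 rE.
clearbody s r.
have b96 : 0 < 96 :> R by rewrite ltr0n.
move: (96 : R) b96 hd hg => b b0 hd hg.
have hT0 : 0 < c * (p ^+ 3 * s ^+ 3) / r by rewrite divr_gt0// !mulr_gt0 ?exprn_gt0.
have Kb0 : 0 < K ^+ 3 / b by rewrite divr_gt0 ?exprn_gt0.
have h1 : 0 < K ^+ 3 / b * (c * (p ^+ 3 * s ^+ 3) / r) by exact: mulr_gt0.
have h2 : K ^+ 3 / b * (c * (p ^+ 3 * s ^+ 3) / r) <= g.
  by apply: le_trans hg; apply: ler_wpM2l => //; exact: ltW.
have h3 : (K ^+ 3 / b * (c * (p ^+ 3 * s ^+ 3) / r)) ^+ 2 <= g ^+ 2.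
  by rewrite !expr2; apply: ler_pM => //; exact: ltW.
have L30 : 0 <= L ^+ 3 by apply: exprn_ge0; exact: ltW.
apply: le_trans (ler_wpM2r L30 h3).
have -> : (K ^+ 3 / b * (c * (p ^+ 3 * s ^+ 3) / r)) ^+ 2 * L ^+ 3 =
  (K ^+ 4 * c ^+ 2 / b ^+ 2) * (K ^+ 2 * p ^+ 6 * L ^+ 6 / d).
  by rewrite -sE -rE; field; rewrite !gt_eqF.
have M0 : 0 < B * b ^+ 2 / c ^+ 2 * l.
  by apply: mulr_gt0 => //; apply: divr_gt0; rewrite ?mulr_gt0 ?exprn_gt0.
have h4 : B * b ^+ 2 / c ^+ 2 * l <= K ^+ 2 * p ^+ 6 * L ^+ 6 / d.
  by rewrite ler_pdivlMr// mulrC -ler_pdivlMr.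
have h5 : 0 <= K ^+ 4 * c ^+ 2 / b ^+ 2.
  by apply: divr_ge0; rewrite ?mulr_ge0 ?exprn_ge0// ltW.
apply: le_trans (ler_wpM2l h5 h4).
by rewrite le_eqVlt; apply/orP; left; apply/eqP; field; rewrite !gt_eqF.
Qed.

Lemma mul_ln_inv_sqr_le4 p : 0 < p <= 2^-1 -> p * ln p^-1 ^+ 2 <= 4.
Proof.
move=> /andP[p0 p1]; set s := Num.sqrt p.
have s0 : 0 < s by rewrite sqrtr_gt0.
have ss : s * s = p by rewrite -expr2 sqr_sqrtr// ltW.
have -> : ln p^-1 = 2 * ln s^-1.
  by rewrite -ss invfM lnM ?posrE ?invr_gt0//; ring.
have h2 : ln s^-1 < s^-1 by apply: ln_sublinear; rewrite invr_gt0.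
have s1 : s <= 1 by rewrite -[leRHS]sqrtr1 ler_sqrt//; lra.
have ls0 : 0 <= ln s^-1 by rewrite ln_ge0// invf_ge1.
have h3 : s * ln s^-1 <= 1.
  by have := ler_wpM2l (ltW s0) (ltW h2); rewrite mulfV// gt_eqF.
have -> : p * (2 * ln s^-1) ^+ 2 = 4 * (s * ln s^-1) ^+ 2 by rewrite -ss; ring.
have h4 : (s * ln s^-1) ^+ 2 <= 1 by rewrite exprn_ile1// mulr_ge0// ltW.
lra.
Qed.

(* [d >= 1] forces [k p^3 L^3 >= 1], hence [1/p <= n] and [L^3 <= 64 k] *)
Lemma parameter_bounds (n k : nat) C p d : 0 < p <= 2^-1 -> (k <= n)%N -> (0 < k)%N ->
  1 <= ln n%:R :> R -> 16 <= C -> 1 <= d ->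
  d <= k%:R ^+ 2 * p ^+ 6 * ln p^-1 ^+ 6 / (C * ln n%:R) ->
  ln p^-1 <= ln n%:R /\ ln p^-1 ^+ 3 <= 64 * k%:R.
Proof.
move=> hp kn k0 l1 C16 d1 hd; have /andP[p0 p1] := hp.
have L0 := ln_inv_gt0 hp; have pL := mul_ln_inv_le1 hp; have pL2 := mul_ln_inv_sqr_le4 hp.
set L := ln p^-1 in L0 pL pL2 hd *; set l := ln n%:R in l1 hd *.
have l0 : 0 < l by lra.
have K0 : 0 < k%:R :> R by rewrite ltr0n.
have N0 : 0 < n%:R :> R by rewrite ltr0n (leq_trans k0).
have KN : k%:R <= n%:R :> R by rewrite ler_nat.
have Cl : 16 <= C * l.
  have := ler_wpM2l (le_trans (ler0n _ _) C16) l1; lra.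
have hk : 16 <= k%:R ^+ 2 * p ^+ 6 * L ^+ 6.
  apply: le_trans Cl _; have Cl0 : 0 < C * l by apply: mulr_gt0 => //; lra.
  by have := le_trans d1 hd; rewrite ler_pdivlMr// mul1r.
have pL0 : 0 <= p * L by apply: mulr_ge0; exact: ltW.
have pL20 : 0 <= p * L ^+ 2 by apply: mulr_ge0; [exact: ltW|exact: sqr_ge0].
split.
  suff h : p^-1 <= n%:R by rewrite ler_ln// posrE// invr_gt0.
  have a1 : (p * L ^+ 2) ^+ 2 * (p * L) ^+ 2 <= 16.
    have e1 : (p * L ^+ 2) ^+ 2 <= 16.
      have -> : 16 = 4 ^+ 2 :> R by ring.
      by rewrite !expr2; apply: ler_pM.
    have e2 : (p * L) ^+ 2 <= 1 by rewrite exprn_ile1.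
    rewrite -[leRHS]mulr1; apply: ler_pM => //; exact: sqr_ge0.
  have a2 : 16 <= 16 * (n%:R * p) ^+ 2.
    apply: le_trans hk _.
    have -> : k%:R ^+ 2 * p ^+ 6 * L ^+ 6 = ((p * L ^+ 2) ^+ 2 * (p * L) ^+ 2) * (k%:R * p) ^+ 2 by ring.
    apply: ler_pM => //; first by apply: mulr_ge0; exact: sqr_ge0.
      exact: sqr_ge0.
    by rewrite !expr2; apply: ler_pM; rewrite ?mulr_ge0 ?ler_wpM2r// ltW.
  have a3 : 1 <= (n%:R * p) ^+ 2 by lra.
  rewrite -div1r ler_pdivrMr// leNgt; apply/negP => h.
  have : (n%:R * p) ^+ 2 < 1 by rewrite exprn_ilt1// mulr_ge0// ltW.
  lra.
have b1 : 1 <= k%:R * (p * L) ^+ 3.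
  have x0 : 0 <= k%:R * (p * L) ^+ 3 by apply: mulr_ge0; [exact: ltW|exact: exprn_ge0].
  rewrite leNgt; apply/negP => h.
  have : (k%:R * (p * L) ^+ 3) ^+ 2 < 1 by rewrite exprn_ilt1.
  have -> : (k%:R * (p * L) ^+ 3) ^+ 2 = k%:R ^+ 2 * p ^+ 6 * L ^+ 6 by ring.
  lra.
have L30 : 0 <= L ^+ 3 by apply: exprn_ge0; exact: ltW.
have b2 : (p * L ^+ 2) ^+ 3 <= 64.
  have -> : 64 = 4 ^+ 3 :> R by ring.
  by rewrite lerXn2r ?nnegrE.
have := ler_wpM2l L30 b1; rewrite mulr1.
have -> : L ^+ 3 * (k%:R * (p * L) ^+ 3) = k%:R * (p * L ^+ 2) ^+ 3 by ring.
move=> h; apply: le_trans h _; rewrite mulrC; apply: ler_wpM2r => //; exact: ltW.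
Qed.

(** From [k >= 10] on, the three factors of the falling factorial are at least [k / 2], and
    [48 = 2 ^ 3 * 3!]. *)
Lemma scan_binomial_ge (k : nat) : (10 <= k)%N -> k%:R ^+ 3 / 48 <= 'C(scan_size k, 3)%:R :> R.
Proof.
move=> k10; set kap := scan_size k.
have h : (k <= 2 * (kap - 2))%N.
  have : (9 * k < (kap.+1) * 10)%N by rewrite /kap /scan_size -ltn_divLR.
  move: k10; clear; lia.
have -> : 'C(kap, 3)%:R = (kap * (kap - 1) * (kap - 2))%:R / 6 :> R.
  have := bin_ffact kap 3; rewrite !ffactnS ffactn0 muln1 -[3`!]/6%N -!subn1 -subnDA => h2.
  by rewrite -mulnA -h2 natrM mulfK// pnatr_eq0.
have hr : k%:R / 2 <= (kap - 2)%:R :> R by rewrite ler_pdivrMr// -natrM ler_nat mulnC.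
have r1 : (kap - 2)%:R <= (kap - 1)%:R :> R by rewrite ler_nat leq_sub2l.
have r2 : (kap - 2)%:R <= kap%:R :> R by rewrite ler_nat leq_subr.
have k0 : 0 <= k%:R / 2 :> R by rewrite divr_ge0.
have -> : k%:R ^+ 3 / 48 = (k%:R / 2 * (k%:R / 2) * (k%:R / 2)) / 6 :> R by field.
rewrite !natrM; apply: ler_wpM2r => //.
apply: ler_pM => //; apply: ler_pM => //; exact: le_trans hr _.
Qed.

End parameters.

Section error_bound.
Context {R : realType}.

Let c : R := expR (-36) / 512.
(** [2 ^+ 25] is what the null model requires, [96] is twice the constant of [scan_binomial_ge]
    because of the half in [gamma_scan], and [c] comes from [triangle_lower]. *)
Definition scan_constant : R := 2 ^+ 25 * 96 ^+ 2 / c ^+ 2.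

Let c0 : 0 < c. Proof. by apply: divr_gt0; [exact: expR_gt0|rewrite ltr0n]. Qed.

Lemma scan_constant_ge : 512 <= scan_constant.
Proof.
have c1 : c <= 1.
  rewrite /c ler_pdivrMr ?ltr0n// mul1r; apply: (@le_trans _ _ 1); last by rewrite ler1n.
  by rewrite -expR0 ler_expR lerNl oppr0.
have c2 : c ^+ 2 <= 1 by apply: exprn_ile1 => //; exact: ltW.
rewrite /scan_constant ler_pdivlMr ?exprn_gt0//.
have h : (512 : R) * c ^+ 2 <= 512 by rewrite -[leRHS]mulr1 ler_wpM2l ?ler0n.
apply: le_trans h _; have -> : 512 = 2 ^+ 9 :> R by ring.
apply: (@le_trans _ _ (2 ^+ 25)); first by rewrite ler_weXn2l// ler1n.
by rewrite -[leLHS]mulr1 ler_wpM2l ?exprn_ge0 ?exprn_ege1 ?ler0n ?ler1n.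
Qed.

(** The null model contributes [3 / k], the size of the hidden set [100 / k], and the variance of
    the planted count [2 / ln n]. *)
Lemma scan_error_bound (n k d : nat) (p : R) : (2 < n)%N -> (10 <= k)%N -> 1 <= ln n%:R :> R ->
  0 < p <= 2^-1 -> (k <= n)%N -> scan_constant * ln n%:R ^+ 2 <= k%:R ->
  Num.max scan_constant ((5 * ln p^-1) ^+ 4) <= d%:R ->
  d%:R <= k%:R ^+ 2 * p ^+ 6 * ln p^-1 ^+ 6 / (scan_constant * ln n%:R) ->
  prob (erdos_renyi p) (fun G : graph n => ((gamma_scan n p d k)%:E < f_scan p k G)%E) +
  prob (planted p d k) (fun G : graph n => (f_scan p k G <= (gamma_scan n p d k)%:E)%E)
  <= 103 / k%:R + 2 / ln n%:R.
Proof.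
move=> n2 k10 l1 hp kn hk; rewrite ge_max => /andP[hC h5] hd.
have /andP[p0 p1] := hp; have C512 := scan_constant_ge.
have k0 : (0 < k)%N by exact: leq_trans k10.
have C16 : 16 <= scan_constant by apply: le_trans C512; rewrite ler_nat.
have d32 : (32 <= d)%N.
  by rewrite -(ler_nat R); apply: le_trans hC; apply: le_trans C512; rewrite ler_nat.
have d1 : 1 <= d%:R :> R by rewrite ler1n (leq_trans _ d32).
have [Ll L3k] := parameter_bounds hp kn k0 l1 C16 d1 hd.
have L0 := ln_inv_gt0 hp.
have Ld : ln p^-1 <= d%:R :> R.
  have [L1|L1] := leP (ln p^-1) 1; first exact: le_trans L1 d1.
  apply: le_trans h5; have hL5 : ln p^-1 <= 5 * ln p^-1 by lra.
  apply: (le_trans hL5); apply: (@le_trans _ _ ((5 * ln p^-1) ^+ 1)); first by rewrite expr1.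
  by rewrite ler_weXn2l//; lra.
pose m := (d - 4)%N.
have dE : d = m.+4 by rewrite /m; move: d32; clear; lia.
have m28 : (28 <= m)%N by rewrite /m; move: d32; clear; lia.
clearbody m; subst d.
have [_ capt] := @tau_spec R m.+1 p hp.
have hT : c * (p ^+ 3 * Num.sqrt (ln p^-1) ^+ 3) / Num.sqrt m.+4%:R <= signed_mean m.+2 (tau p m.+4) p.
  exact: triangle_lower.
have p01 : 0 <= p <= 1 by rewrite ltW//=; move: p1; lra.
set T := signed_mean m.+2 (tau p m.+4) p in hT.
have gE : gamma_scan n p m.+4 k = 2^-1 * 'C(scan_size k, 3)%:R * T by exact: gamma_scanE.
set g := gamma_scan n p m.+4 k in gE *.
have K0 : 0 < k%:R :> R by rewrite ltr0n.
have l0 : 0 < ln n%:R :> R by exact: lt_le_trans l1.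
have d0 : 0 < m.+4%:R :> R by rewrite ltr0n.
have T0 : 0 < T.
  apply: lt_le_trans hT; apply: divr_gt0; last by rewrite sqrtr_gt0.
  apply: mulr_gt0 => //; apply: mulr_gt0; first exact: exprn_gt0.
  by rewrite exprn_gt0// sqrtr_gt0.
have hg : k%:R ^+ 3 / 96 * T <= g.
  rewrite gE; apply: ler_wpM2r; first exact: ltW.
  by have := @scan_binomial_ge R k k10; lra.
have g0 : 0 < g.
  by apply: lt_le_trans hg; apply: mulr_gt0 => //; apply: divr_gt0; [exact: exprn_gt0|rewrite ltr0n].
have B0 : 0 < 2 ^+ 25 :> R by exact: exprn_gt0.
have hgk : 2 ^+ 25 * k%:R ^+ 4 * ln n%:R <= g ^+ 2 * ln p^-1 ^+ 3.
  exact: (threshold_lower c0 K0 l0 L0 p0 d0 hd B0 hT hg).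
have hk512 : 512 * ln n%:R ^+ 2 <= k%:R :> R.
  by apply: le_trans hk; apply: ler_wpM2r => //; exact: sqr_ge0.
have n1 : (1 < n)%N by exact: ltnW.
have kk : (scan_size k <= k)%N.
  by rewrite /scan_size -[leqRHS](mulnK _ (isT : 0 < 10)%N) leq_div2r// mulnC leq_mul2l orbT.
have hQ : prob (erdos_renyi p) (fun G : graph n => (g%:E < f_scan p k G)%E) <= 3 / k%:R.
  apply: le_trans (erdos_renyi_scan _ _ _ p01) _.
  apply: le_trans (scan_tail n1 k0 kn p0 p1 l1 Ll hk512 (ltW g0) hgk kk) _.
  apply: ler_wpM2l => //; rewrite expRN lef_pV2 ?posrE ?expR_gt0//.
  apply: le_trans (expR_ge1Dx _); have := ler_wpM2l (ltW K0) l1; lra.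
have hP : prob (planted p m.+4 k) (fun G : graph n => (f_scan p k G <= g%:E)%E) <=
  100 / k%:R + ((scan_size k)%:R ^+ 3 + 18 * p ^+ 3 * (scan_size k)%:R ^+ 4) / g ^+ 2.
  apply: (planted_scan k0 kn p01 capt g0).
  by rewrite gE !mulrA mulfV ?pnatr_eq0// mul1r.
(* Multiply by [L ^+ 3]: since [L ^+ 3 <= 64 k] and [p ^+ 3 * L ^+ 3 <= 1], the variance becomes at
   most [82 k ^ 4], to compare with [2 ^+ 25 * k ^ 4 * ln n]. *)
have hV : ((scan_size k)%:R ^+ 3 + 18 * p ^+ 3 * (scan_size k)%:R ^+ 4) / g ^+ 2 <= 2 / ln n%:R :> R.
  have kkR : (scan_size k)%:R <= k%:R :> R by rewrite ler_nat.
  have g20 : 0 < g ^+ 2 by exact: exprn_gt0.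
  have p30 : 0 <= p ^+ 3 by apply: exprn_ge0; exact: ltW.
  have s3 : (scan_size k)%:R ^+ 3 <= k%:R ^+ 3 :> R by rewrite lerXn2r ?nnegrE.
  have s4 : (scan_size k)%:R ^+ 4 <= k%:R ^+ 4 :> R by rewrite lerXn2r ?nnegrE.
  have pL3 : p ^+ 3 * ln p^-1 ^+ 3 <= 1.
    rewrite -exprMn exprn_ile1 ?mul_ln_inv_le1//.
    by apply: mulr_ge0; exact: ltW.
  set L := ln p^-1 in L0 L3k hgk pL3 *; set l := ln n%:R in l0 hgk *.
  rewrite ler_pdivrMr// [leRHS]mulrAC ler_pdivlMr// -(ler_pM2r (exprn_gt0 3 L0)).
  set K : R := k%:R in K0 L3k hgk s3 s4 *; set sk : R := (scan_size k)%:R in s3 s4 *.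
  have q1 := ler_wpM2l p30 s4.
  have K30 : 0 <= K ^+ 3 by apply: exprn_ge0; exact: ltW.
  have K40 : 0 <= K ^+ 4 by apply: exprn_ge0; exact: ltW.
  have L30 : 0 <= L ^+ 3 by apply: exprn_ge0; exact: ltW.
  have q2 : K ^+ 3 * L ^+ 3 <= 64 * K ^+ 4.
    by have := ler_wpM2l K30 L3k; have -> : 64 * K ^+ 4 = K ^+ 3 * (64 * K) by ring.
  have q3 : p ^+ 3 * K ^+ 4 * L ^+ 3 <= K ^+ 4.
    have -> : p ^+ 3 * K ^+ 4 * L ^+ 3 = K ^+ 4 * (p ^+ 3 * L ^+ 3) by ring.
    by rewrite -[leRHS]mulr1 ler_wpM2l.
  have q4 : (sk ^+ 3 + 18 * p ^+ 3 * sk ^+ 4) * L ^+ 3 <= (K ^+ 3 + 18 * p ^+ 3 * K ^+ 4) * L ^+ 3.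
    apply: ler_wpM2r => //; apply: lerD => //; rewrite -!(mulrA 18).
    by apply: ler_wpM2l; [exact: ler0n|exact: q1].
  have q5 : (sk ^+ 3 + 18 * p ^+ 3 * sk ^+ 4) * L ^+ 3 <= 2 * (2 ^+ 25 * K ^+ 4).
    apply: (le_trans q4).
    have h25 : 2 ^+ 7 <= 2 ^+ 25 :> R by rewrite ler_weXn2l// ler1n.
    have := ler_wpM2r K40 h25; lra.
  have q6 := ler_wpM2r (ltW l0) q5; lra.
have := lerD hQ hP.
have e1 : 103 / k%:R = 3 / k%:R + 100 / k%:R :> R by rewrite -mulrDl -natrD.
rewrite e1; move: hV; lra.
Qed.

End error_bound.

Lemma prob_ge0 (R : realType) n (law : graph n -> R) (A : pred (graph n)) :
  (forall G, 0 <= law G) -> 0 <= prob law A.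
Proof. by move=> h; apply: sumr_ge0. Qed.

Lemma bern_ge0 (R : realType) (p : R) b : 0 <= p <= 1 -> 0 <= bern p b.
Proof. by move=> /andP[p0 p1]; case: b => //=; rewrite subr_ge0. Qed.

Lemma erdos_renyi_ge0 (R : realType) n (p : R) (G : graph n) : 0 <= p <= 1 -> 0 <= erdos_renyi p G.
Proof. by move=> hp; apply: prodr_ge0 => i _; apply: prodr_ge0 => j _; exact: bern_ge0. Qed.

Lemma planted_ge0 (R : realType) n m k (p : R) (G : graph n) : 0 <= p <= 1 -> (0 < k)%N -> (k <= n)%N ->
  0 <= planted p m.+2 k G.
Proof.
move=> /andP[p0 p1] k0 kn; apply: sumr_ge0 => S _; apply: mulr_ge0.
  exact: (@hidden_weight_ge0 R n k k0 kn S).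
exact: planted_given_ge0.
Qed.

Theorem theorem2p2 (R : realType) :
  exists C : R, 0 < C /\
    forall (p : nat -> R) (d k : nat -> nat),
      k n @[n --> \oo] --> \oo ->
      (\forall n \near \oo,
        0 < p n <= 2^-1 /\
        (k n <= n)%N /\
        C * ln n%:R ^+ 2 <= (k n)%:R /\
        Num.max C ((5 * ln (p n)^-1) ^+ 4) <= (d n)%:R /\
        (d n)%:R <= (k n)%:R ^+ 2 * p n ^+ 6 * ln (p n)^-1 ^+ 6
                      / (C * ln n%:R)) ->
      prob (erdos_renyi (p n))
        (fun G : graph n =>
           ((gamma_scan n (p n) (d n) (k n))%:E < f_scan (p n) (k n) G)%E)
      + prob (planted (p n) (d n) (k n))
        (fun G : graph n =>
           (f_scan (p n) (k n) G <= (gamma_scan n (p n) (d n) (k n))%:E)%E)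
      @[n --> \oo] --> (0 : R).
Proof.
exists scan_constant; split; first by apply: lt_le_trans scan_constant_ge; rewrite ltr0n.
move=> p d k hk hyp; apply/cvgrPdist_le => e e0.
(* [103 / k] and [2 / ln n] are each made at most [e / 2]; the 1 added in the exponent below also
   secures [1 <= ln n]. *)
pose K := Num.bound (206 / e).
have hK : 206 / e <= K%:R :> R.
  by apply/ltW/archi_boundP; apply: divr_ge0; [exact: ler0n|exact: ltW].
pose N := Num.bound (expR (4 / e + 1)).
have hN : expR (4 / e + 1) <= N%:R :> R by apply/ltW/archi_boundP; exact: expR_ge0.
have e4 : 0 <= 4 / e by rewrite divr_ge0// ltW.
near=> n.
have [hp [kn [h1 [h2 h3]]]] : 0 < p n <= 2^-1 /\ (k n <= n)%N /\
  scan_constant * ln n%:R ^+ 2 <= (k n)%:R :> R /\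
  Num.max scan_constant ((5 * ln (p n)^-1) ^+ 4) <= (d n)%:R /\
  (d n)%:R <= (k n)%:R ^+ 2 * p n ^+ 6 * ln (p n)^-1 ^+ 6 / (scan_constant * ln n%:R).
  near: n; exact: hyp.
have n2 : (2 < n)%N by near: n; exact: nbhs_infty_gt.
have nN : (N <= n)%N by near: n; exact: nbhs_infty_ge.
have kK : (maxn 10 K <= k n)%N by near: n; move/cvgnyPge: hk; exact.
have /andP[k10 kK'] : (10 <= k n)%N && (K <= k n)%N by rewrite -geq_max.
have n0 : 0 < n%:R :> R by rewrite ltr0n (ltn_trans _ n2).
have ln4 : 4 / e + 1 <= ln n%:R :> R.
  rewrite -ler_expR lnK ?posrE//; apply: le_trans hN _; by rewrite ler_nat.
have l1 : 1 <= ln n%:R :> R by lra.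
have k0 : 0 < (k n)%:R :> R by rewrite ltr0n (leq_trans _ k10).
have p01 : 0 <= p n <= 1 by move: hp => /andP[? ?]; apply/andP; split; lra.
have bound := scan_error_bound n2 k10 l1 hp kn h1 h2 h3.
have b1 : 103 / (k n)%:R <= e / 2.
  have h : 206 / e <= (k n)%:R by apply: le_trans hK _; rewrite ler_nat.
  by rewrite ler_pdivrMr//; move: h; rewrite ler_pdivrMr//; lra.
have b2 : 2 / ln n%:R <= e / 2.
  have l0 : 0 < ln n%:R :> R by lra.
  have h : 4 / e <= ln n%:R by lra.
  by rewrite ler_pdivrMr//; move: h; rewrite ler_pdivrMr//; lra.
have d2 : (2 <= d n)%N.
  rewrite -(ler_nat R); apply: le_trans h2; rewrite le_max; apply/orP; left.
  by apply: le_trans scan_constant_ge; rewrite ler_nat.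
rewrite sub0r normrN ger0_norm; first by lra.
apply: addr_ge0; apply: prob_ge0 => G; first exact: erdos_renyi_ge0.
rewrite -(subnK d2) addn2; apply: planted_ge0 => //; exact: leq_trans k10.
Unshelve. all: by end_near.
Qed.
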